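(* Let $\alpha>\frac12$, $s,d\in\mathbb N$, $D=sd$, and let $b\in\mathbb N$, $b\ge 2$. For $n=1,\dots,d$ and $l\in\mathbb N$ let $U^{(n)}_l$ be a randomized QMC quadrature based on a scrambled $(0,l-1,s)$-net in base $b$, where all the building blocks $(U^{(n)}_l)_{l,n}$ are randomized independently. For $L\ge d$ let $A(L,d)$ denote the corresponding Smolyak method approximating the integral $I_D:\mathcal H^D_\alpha\to\mathbb R$, and let $N$ be the number of function evaluations performed by $A(L,d)$. Then there exists a constant $C$ independent of $N$ such that for every integer $L\ge d$ (with $L>d$ if $d\ge 2$) the randomized error satisfies $$e^{\mathrm r}(I_D,A(L,d))\le C\,\frac{(\log N)^{(d-1)(1+\alpha)}}{N^{\alpha+\frac12}}.$$
   Context: Notation: $\mathbb N=\{1,2,\dots\}$, $\mathbb N_0=\mathbb N\cup\{0\}$; $|\mathbf v|=\sum_r|v_r|$ for vectors; operations between vectors and numbers are coordinatewise. The base $b\ge2$ is fixed. Convention: $(\log N)^0=1$. Nets. For $j\in\mathbb N_0$, $0\le k<b^j$ let $E^j_k=[kb^{-j},(k+1)b^{-j})$. An $s$-dimensional elementary interval (in base $b$) is a product $E^{j_1}_{k_1}\times\cdots\times E^{j_s}_{k_s}$. For $m\in\mathbb N_0$, a finite set $\mathcal P\subset[0,1)^s$ is a $(0,m,s)$-net in base $b$ if each $s$-dimensional elementary interval of volume $b^{-m}$ contains exactly one point of $\mathcal P$ (so $|\mathcal P|=b^m$). Scrambling. A random $b$-ary scrambling $\sigma:[0,1)\to[0,1)$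 of depth $m$ maps $x$ with $b$-ary digits $x_1,x_2,\dots$ (finite expansion chosen if possible) to the point with $b$-ary digits $y_1=\pi(x_1)$, $y_2=\pi_{x_1}(x_2)$, $y_3=\pi_{x_1,x_2}(x_3),\dots$ up to $y_m$, all further digits being $0$; here $\pi,\pi_{x_1},\pi_{x_1,x_2},\dots$ (one permutation for each possible digit prefix) are independent uniformly distributed permutations of $\{0,\dots,b-1\}$. Given a $(0,m,s)$-net $\mathcal P=\{p_1,\dots,p_{b^m}\}$, the associated scrambled net consists of the points $Y_i=(\sigma_1(p_{i,1})+b^{-m}\xi^1_i,\dots,\sigma_s(p_{i,s})+b^{-m}\xi^s_i)$, where $\sigma_1,\dots,\sigma_s$ are independent random scramblings of depth $m$ and $\xi^t_i$ are i.i.d. uniform on $[0,1)$, independent of all permutations. Building blocks. $U^{(n)}_lf=b^{-(l-1)}\sum_{i=1}^{b^{l-1}}f(Y_i)$, where, for some $(0,l-1,s)$-net $\mathcal P^{(n)}_l=\{p_1,\dots,p_{b^{l-1}}\}$ in base $b$, $(Y_i)$ is the associated scrambled net consisting of the points $Y_i=(\sigma_1(p_{i,1})+b^{-(l-1)}\xi^1_i,\dots,\sigma_s(p_{i,s})+b^{-(l-1)}\xi^s_i)$, $i=1,\dots,b^{l-1}$, with independent random $b$-ary scramblings $\sigma_1,\dots,\sigma_s$ of depth $m=l-1$ and $\xi^t_i$ i.i.d. uniform on $[0,1)$, independent of all permutations (the $\sigma_t$ and $\xi^t_i$ depending also on $n$ and $l$); all permutations and all variables $\xi$ used for all $n\in\{1,\dots,d\}$,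 $l\in\mathbb N$ are independent. Put $U^{(n)}_0=0$. Smolyak method. With $\Delta^{(n)}_l=U^{(n)}_l-U^{(n)}_{l-1}$ ($l\in\mathbb N$) and $Q(L,d)=\{\mathbf l\in\mathbb N^d: |\mathbf l|\le L\}$, $L\ge d$, put $A(L,d)=\sum_{\mathbf l\in Q(L,d)}\bigotimes_{n=1}^d\Delta^{(n)}_{l_n}$. Equivalently $A(L,d)=\sum_{L-d+1\le|\mathbf l|\le L}(-1)^{L-|\mathbf l|}\binom{d-1}{L-|\mathbf l|}\bigotimes_{n=1}^dU^{(n)}_{l_n}$ (sum over $\mathbf l\in\mathbb N^d$). The number $N$ of function evaluations is the number of nodes used in the latter representation, $N=\sum_{\mathbf l\in\mathbb N^d,\ L-d+1\le|\mathbf l|\le L}b^{|\mathbf l|-d}$. Haar-wavelet space. For $j\in\mathbb N_0$: $\theta_0=\{0\}$, $\theta_j=\{0,\dots,b-1\}$ for $j\ge1$; $\vartheta_{-1}=\vartheta_0=\{0\}$, $\vartheta_j=\{0,\dots,b^j-1\}$ for $j\ge1$; for vectors, $\theta_{\mathbf j}=\prod_t\theta_{j_t}$, $\vartheta_{\mathbf j}=\prod_t\vartheta_{j_t}$. Put $\psi^0_{0,0}=1_{[0,1)}$ and, for $j\ge1$, $i\in\theta_j$, $k\in\vartheta_{j-1}$, $\psi^j_{i,k}(x)=b^{\frac{j-2}{2}}\left[b\,1_{\lfloor b^jx\rfloor=bk+i}-1_{\lfloor b^{j-1}x\rfloor=k}\right]$. For $\mathbf j\in\mathbb N_0^D$,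 $\mathbf i\in\theta_{\mathbf j}$, $\mathbf k\in\vartheta_{\mathbf j-1}$ put $\Psi^{D,\mathbf j}_{\mathbf i,\mathbf k}(\mathbf x)=\prod_{t=1}^D\psi^{j_t}_{i_t,k_t}(x_t)$ and $\hat f^{\mathbf j}_{\mathbf i,\mathbf k}=\int_{[0,1)^D}f\,\Psi^{D,\mathbf j}_{\mathbf i,\mathbf k}\,d\mathbf x$. Then $\mathcal H^D_\alpha=\{f\in L^2([0,1)^D):\ \|f\|^2_{\mathcal H^D_\alpha}:=\sum_{\mathbf j,\mathbf k,\mathbf i}b^{2\alpha|\mathbf j|}(\hat f^{\mathbf j}_{\mathbf i,\mathbf k})^2<\infty\}$, with sum over all $\mathbf j\in\mathbb N_0^D$, $\mathbf k\in\vartheta_{\mathbf j-1}$, $\mathbf i\in\theta_{\mathbf j}$. Error. $I_Df=\int_{[0,1)^D}f(\mathbf x)\,d\mathbf x$ and $e^{\mathrm r}(I_D,A(L,d))=\sup_{\|f\|_{\mathcal H^D_\alpha}\le1}\left(\mathbf E\,|A(L,d)f-I_Df|^2\right)^{1/2}$. *)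

(* Defs.v *)
From HB Require Import structures.
From mathcomp Require Import all_boot all_order all_algebra all_fingroup.
From mathcomp Require Import all_classical all_reals all_analysis.
Set Implicit Arguments.
Unset Strict Implicit.
Unset Printing Implicit Defensive.
Import Order.TTheory GRing.Theory Num.Theory.
Import numFieldNormedType.Exports.
Local Open Scope classical_set_scope.
Local Open Scope ring_scope.

Definition cons_pair (R : realType) (n : nat) (z : R * n.-tuple R) :
  n.+1.-tuple R := [tuple of z.1 :: z.2].

Lemma measurable_cons_pair (R : realType) (n : nat) :
  measurable_fun [set: R * n.-tuple R] (@cons_pair R n).
Proof. by apply: measurable_cons; [exact: measurable_fst|exact: measurable_snd]. Qed.

Section lebesgue_cons.
Local Open Scope ereal_scope.
Context (R : realType) (n : nat).
Variable m : {sigma_finite_measure set (n.-tuple R) -> \bar R}.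

Definition lebesgue_cons (A : set (n.+1.-tuple R)) : \bar R :=
  (@lebesgue_measure R \x m) (@cons_pair R n @^-1` A).

Let cons0 : lebesgue_cons set0 = 0.
Proof. by rewrite /lebesgue_cons preimage_set0 measure0. Qed.

Let cons_ge0 A : 0 <= lebesgue_cons A.
Proof. exact: measure_ge0. Qed.

Let cons_sigma_additive : semi_sigma_additive lebesgue_cons.
Proof.
have mc A : measurable A -> measurable (@cons_pair R n @^-1` A).
  by move=> mA; rewrite -[X in measurable X]setTI; exact: measurable_cons_pair.
move=> F mF tF mUF; rewrite /lebesgue_cons preimage_bigcup.
apply: measure_semi_sigma_additive.
- by move=> k; exact: mc.
- apply/trivIsetP => /= i j _ _ ij; rewrite -preimage_setI.
  by move/trivIsetP : tF => /(_ _ _ _ _ ij) ->//; rewrite preimage_set0.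
- by rewrite -preimage_bigcup; exact: mc.
Qed.

HB.instance Definition _ := isMeasure.Build _ _ _ lebesgue_cons
  cons0 cons_ge0 cons_sigma_additive.

Lemma lebesgue_consE (A : set R) (B : set (n.-tuple R)) :
    measurable A -> measurable B ->
  lebesgue_cons [set x | A (thead x) /\ B [tuple of behead x]] =
    lebesgue_measure A * m B.
Proof.
move=> mA mB; rewrite -(@product_measure1E _ _ _ _ _ (@lebesgue_measure R) m)//.
rewrite /lebesgue_cons; congr (_ _).
apply/seteqP; split => -[a t] /=; rewrite /cons_pair/= theadE.
  by move=> [? Bt]; split => //; congr (B _): Bt; exact/val_inj.
by move=> [? Bt]; split => //; congr (B _): Bt; exact/val_inj.
Qed.

Lemma measurable_uncons (A : set R) (B : set (n.-tuple R)) :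
    measurable A -> measurable B ->
  measurable [set x : n.+1.-tuple R | A (thead x) /\ B [tuple of behead x]].
Proof.
move=> mA mB; apply: measurableI.
- rewrite -[X in measurable X]setTI.
  exact: (@measurable_tnth _ R n.+1 ord0).
- rewrite -[X in measurable X]setTI.
  exact: (@measurable_behead _ R n).
Qed.

Let cons_sigma_finite : sigma_finite setT lebesgue_cons.
Proof.
have /sigma_finiteP[F [TF ndF Foo]] := sigma_finiteT (@lebesgue_measure R).
have /sigma_finiteP[G [TG ndG Goo]] := sigma_finiteT m.
exists (fun k => [set x | F k (thead x) /\ G k [tuple of behead x]]).
  apply/seteqP; split => // x _.
  have [i _ Fi] : (\bigcup_k F k) (thead x) by rewrite -TF.
  have [j _ Gj] : (\bigcup_k G k) [tuple of behead x] by rewrite -TG.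
  exists (maxn i j) => //; split.
  - by move: Fi; exact/subsetPset/ndF/leq_maxl.
  - by move: Gj; exact/subsetPset/ndG/leq_maxr.
move=> k; have [? ?] := Foo k; have [? ?] := Goo k.
split; first exact: measurable_uncons.
by rewrite lebesgue_consE// lte_mul_pinfty// ge0_fin_numE.
Qed.

HB.instance Definition _ :=
  Measure_isSigmaFinite.Build _ _ _ lebesgue_cons cons_sigma_finite.

End lebesgue_cons.

Fixpoint lebesgue_tuple (R : realType) (n : nat) :
    {sigma_finite_measure set (n.-tuple R) -> \bar R} :=
  match n with
  | 0 => \d_[tuple]
  | k.+1 => lebesgue_cons (lebesgue_tuple R k)
  end.

Lemma lebesgue_tuple_box (R : realType) (n : nat) (B : 'I_n -> set R) :
    (forall t, measurable (B t)) ->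
  lebesgue_tuple R n [set x | forall t, B t (tnth x t)] =
    (\prod_(t < n) lebesgue_measure (B t))%E.
Proof.
suff : (forall t, measurable (B t)) ->
  measurable [set x | forall t, B t (tnth x t)] /\
  lebesgue_tuple R n [set x | forall t, B t (tnth x t)] =
    (\prod_(t < n) lebesgue_measure (B t))%E by move=> /[apply] -[].
elim: n B => [|n IH] B mB.
  rewrite big_ord0 /= (_ : [set _ | _] = setT); last first.
    by apply/seteqP; split => // x _ [].
  by split => //; rewrite diracT.
have [mB' E] := IH (fun t => B (lift ord0 t)) (fun t => mB _).
rewrite (_ : [set _ | _] = [set x | B ord0 (thead x) /\
  [set y : n.-tuple R | forall t, B (lift ord0 t) (tnth y t)]
    [tuple of behead x]]); last first.
  apply/seteqP; split => x /=.
    move=> Bx; split; first exact: Bx.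
    by move=> t; rewrite tnth_behead (_ : inord _ = lift ord0 t)//;
      apply/val_inj; rewrite /= inordK// ltnS.
  move=> [B0 Bx] t; case: (unliftP ord0 t) => [j ->|->]; last exact: B0.
  by have := Bx j; rewrite tnth_behead (_ : inord _ = lift ord0 j)//;
      apply/val_inj; rewrite /= inordK// ltnS.
split; first exact: measurable_uncons.
by rewrite big_ord_recl -E; exact: lebesgue_consE.
Qed.

Definition unit_cube (R : realType) (n : nat) : set (n.-tuple R) :=
  [set x | forall t, 0 <= tnth x t < 1].

Definition elementary_interval (R : realType) (s b : nat)
    (j k : 'I_s -> nat) : set (s.-tuple R) :=
  [set x | forall t, (k t)%:R / b%:R ^+ j t <= tnth x t
                     < (k t).+1%:R / b%:R ^+ j t].

Definition is_net (R : realType) (b m s : nat) (E : set (s.-tuple R)) : Prop :=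
  [/\ finite_set E, E `<=` @unit_cube R s &
   forall j k : 'I_s -> nat, (forall t, (k t < b ^ j t)%N) ->
     lebesgue_tuple R s (elementary_interval b j k) = (b%:R ^- m)%:E ->
     exists! x, (E `&` elementary_interval b j k) x].

(* For x in [0, 1), the j-th digit (j >= 1) of the b-ary expansion of x, the
   finite expansion being preferred. *)
Definition digit (R : realType) (b : nat) (hb : (1 < b)%N) (x : R) (j : nat) :
  'I_b := Ordinal (ltn_pmod (Num.truncn (b%:R ^+ j * x)) (ltnW hb)).

Definition digit_prefix (R : realType) (b : nat) (hb : (1 < b)%N) (x : R)
  (j : nat) : seq 'I_b := [seq digit hb x i | i <- iota 1 j].

(* [pi w] is the permutation applied to the digit that follows the prefix [w]. *)
Definition scramble (R : realType) (b : nat) (hb : (1 < b)%N) (m : nat)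
    (pi : seq 'I_b -> {perm 'I_b}) (x : R) : R :=
  \sum_(j < m) (pi (digit_prefix hb x j) (digit hb x j.+1) : nat)%:R
               / b%:R ^+ j.+1.

Definition scrambled_point (R : realType) (b : nat) (hb : (1 < b)%N)
    (s m : nat) (pi : 'I_s -> seq 'I_b -> {perm 'I_b}) (xi : 'I_s -> R)
    (x : s.-tuple R) : s.-tuple R :=
  [tuple scramble hb m (pi t) (tnth x t) + b%:R ^- m * xi t | t < s].

(* A quadrature is the list of its (weight, node) pairs; it stands for the
   functional f |-> \sum_(q <- Q) q.1 * f q.2. *)
Definition quadrature (R : realType) (s : nat) : Type :=
  seq (R * s.-tuple R).

Definition quad_sub (R : realType) (s : nat) (Q Q' : quadrature R s) :
  quadrature R s := Q ++ [seq (- q.1, q.2) | q <- Q'].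

(* The coordinate t of block n sits at position mxvec_index n t = n * s + t. *)
Definition concat_blocks (R : realType) (d s : nat) (x : 'I_d -> s.-tuple R) :
  (d * s).-tuple R :=
  [tuple mxvec (\matrix_(n < d, t < s) tnth (x n) t) ord0 q | q < d * s].

Definition quad_tensor (R : realType) (d s : nat) (Q : 'I_d -> quadrature R s)
    (f : (d * s).-tuple R -> R) : R :=
  \sum_(c : {dffun forall n : 'I_d, 'I_(size (Q n))})
     (\prod_(n < d) (tnth (in_tuple (Q n)) (c n)).1) *
     f (concat_blocks (fun n => (tnth (in_tuple (Q n)) (c n)).2)).

(* The randomness of all building blocks. [perms n m t w] is the permutation
   attached to the digit prefix [w] by the scrambling of coordinate [t], and
   [noise n m t i] the uniform variable of coordinate [t] of node [i], both for
   the block of level m + 1, whose net has b ^ m points. *)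
Definition perm_family (d s b : nat) (Omega : Type) : Type :=
  'I_d -> nat -> 'I_s -> seq 'I_b -> Omega -> {perm 'I_b}.

Definition noise_family (R : realType) (d s : nat) (Omega : Type) : Type :=
  'I_d -> nat -> 'I_s -> nat -> Omega -> R.

Definition rand_index (d s b : nat) : eqType :=
  (('I_d * nat * 'I_s * seq 'I_b) + ('I_d * nat * 'I_s * nat))%type.

(* Depth m scrambling uses prefixes of length < m. *)
Definition used_index (d s b : nat) : set (rand_index d s b) :=
  [set q | match q with
           | inl (_, m, _, w) => (size w < m)%N
           | inr (_, m, _, i) => (i < b ^ m)%N
           end].

Definition rand_events (R : realType) (d s b : nat) (Omega : Type)
    (perms : perm_family d s b Omega) (noise : noise_family R d s Omega)
    (q : rand_index d s b) : set (set Omega) :=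
  match q with
  | inl (n, m, t, w) =>
      [set A | exists B : set {perm 'I_b}, A = perms n m t w @^-1` B]
  | inr (n, m, t, i) =>
      [set A | exists2 B : set R, measurable B & A = noise n m t i @^-1` B]
  end.

Definition mutually_independent (R : realType) (dd : measure_display)
    (Omega : measurableType dd) (P : probability Omega R) (I : eqType)
    (D : set I) (F : I -> set (set Omega)) : Prop :=
  forall (J : seq I) (A : I -> set Omega), uniq J ->
    (forall i, i \in J -> D i /\ F i (A i)) ->
    P (\bigcap_(i in [set` J]) A i) = (\prod_(i <- J) P (A i))%E.

Definition independent_scrambling (R : realType) (dd : measure_display)
    (Omega : measurableType dd) (P : probability Omega R) (d s b : nat)
    (perms : perm_family d s b Omega) (noise : noise_family R d s Omega) :
    Prop :=
  [/\ forall n m t w, (size w < m)%N -> forall pi : {perm 'I_b},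
        measurable (perms n m t w @^-1` [set pi]) /\
        P (perms n m t w @^-1` [set pi]) = (b`!%:R^-1)%:E,
      forall n m t i, (i < b ^ m)%N ->
        measurable_fun setT (noise n m t i) /\
        forall B : set R, measurable B ->
          P (noise n m t i @^-1` B) = uniform_prob (@ltr01 R) B &
      mutually_independent P (@used_index d s b) (rand_events perms noise)].

(* U^(n)_l, for one outcome of the permutations and of the noise. *)
Definition building_block (R : realType) (b : nat) (hb : (1 < b)%N)
    (d s : nat) (p : 'I_d -> forall m, 'I_(b ^ m) -> s.-tuple R)
    (pi : 'I_d -> nat -> 'I_s -> seq 'I_b -> {perm 'I_b})
    (xi : 'I_d -> nat -> 'I_s -> nat -> R) (n : 'I_d) (l : nat) :
    quadrature R s :=
  match l with
  | 0 => [::]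
  | m.+1 => [seq (b%:R ^- m,
                  scrambled_point hb m (pi n m) (fun t => xi n m t i) (p n m i))
            | i : 'I_(b ^ m)]
  end.

(* Multi-indices l in N^d with |l| <= L; all entries are then at most L. *)
Definition multi_indices (L d : nat) : {set {ffun 'I_d -> 'I_L.+1}} :=
  [set l : {ffun 'I_d -> 'I_L.+1} |
     [forall n, (0 < l n)%N] && (\sum_(n < d) l n <= L)%N].

Definition smolyak (R : realType) (d s : nat)
    (U : 'I_d -> nat -> quadrature R s) (L : nat)
    (f : (d * s).-tuple R -> R) : R :=
  \sum_(l in multi_indices L d)
     quad_tensor (fun n => quad_sub (U n (l n)) (U n (l n).-1)) f.

(* Counts the nodes of the combination form of the method, the sum over
   L - d + 1 <= |l| <= L of tensor products of the U^(n)_(l n). *)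
Definition num_evals (b L d : nat) : nat :=
  \sum_(l in multi_indices L d | (L - d + 1 <= \sum_(n < d) l n)%N)
     b ^ (\sum_(n < d) l n - d).

Definition haar (R : realType) (b j i k : nat) (x : R) : R :=
  if j is j'.+1 then
    (b%:R : R) `^ ((j%:R - 2) / 2) *
    (b%:R * \1_[set y : R | Num.floor (b%:R ^+ j * y) = (b * k + i)%N%:Z] x
     - \1_[set y : R | Num.floor (b%:R ^+ j' * y) = k%:Z] x)
  else \1_`[0, 1[ x.

(* Triples (j, i, k); (j t).-1 = 0 both for j t = 0 and for j t = 1. *)
Definition haar_triple (D : nat) : choiceType :=
  ({ffun 'I_D -> nat} * {ffun 'I_D -> nat} * {ffun 'I_D -> nat})%type.

Definition haar_index (b D : nat) : set (haar_triple D) :=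
  [set q : haar_triple D | forall t : 'I_D,
     (q.1.2 t < if q.1.1 t == 0%N then 1 else b)%N /\
     (q.2 t < b ^ (q.1.1 t).-1)%N].

Definition haar_tensor (R : realType) (b D : nat) (q : haar_triple D)
    (x : D.-tuple R) : R :=
  \prod_(t < D) haar b (q.1.1 t) (q.1.2 t) (q.2 t) (tnth x t).

Definition cube_integral (R : realType) (D : nat) (f : D.-tuple R -> R) : R :=
  \int[lebesgue_tuple R D]_(x in @unit_cube R D) f x.

Definition haar_sqnorm (R : realType) (b D : nat) (alpha : R)
    (f : D.-tuple R -> R) : \bar R :=
  (\esum_(q in @haar_index b D)
     (b%:R `^ (2 * alpha * (\sum_(t < D) q.1.1 t)%N%:R) *
      cube_integral (fun x => f x * haar_tensor b q x)%R ^+ 2)%:E)%E.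

Definition haar_norm (R : realType) (b D : nat) (alpha : R)
  (f : D.-tuple R -> R) : \bar R := (haar_sqnorm b alpha f `^ 2^-1)%E.

(* An element of L^2 of the cube is represented by a function measurable on the
   whole space (extend it by 0); values outside the cube are irrelevant. *)
Definition haar_space (R : realType) (b D : nat) (alpha : R) :
    set (D.-tuple R -> R) :=
  [set f : D.-tuple R -> R | [/\ measurable_fun setT f,
      (\int[lebesgue_tuple R D]_(x in @unit_cube R D) (f x ^+ 2)%:E < +oo)%E &
      (haar_sqnorm b alpha f < +oo)%E]].

Definition randomized_error (R : realType) (dd : measure_display)
    (Omega : measurableType dd) (P : probability Omega R) (b D : nat)
    (alpha : R) (A : Omega -> (D.-tuple R -> R) -> R) : \bar R :=
  ereal_sup
    [set ('E_P[(fun w => `|A w f - cube_integral f| ^+ 2)%R] `^ 2^-1)%E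
    | f in [set f | @haar_space R b D alpha f /\
                    (haar_norm b alpha f <= 1)%E]].

(* Main.v *)
Require Import Defs.
From HB Require Import structures.
From mathcomp Require Import all_boot all_order all_algebra all_fingroup.
From mathcomp Require Import all_classical all_reals all_analysis.
From mathcomp Require Import measurable_realfun.
From mathcomp Require Import zify ring lra.
Set Implicit Arguments.
Unset Strict Implicit.
Unset Printing Implicit Defensive.
Import Order.TTheory GRing.Theory Num.Theory.
Import numFieldNormedType.Exports.
Local Open Scope classical_set_scope.
Local Open Scope ring_scope.

(** The proof expands the integrand into tensor products of Haar functions and estimates the method on a
single one, of level vector [j] with one entry for each of the [d * s] coordinates.

- If [|j| + d <= L], the method integrates it exactly ([smolyak_haar0]).  A scrambled net with [b ^ m] points
  is a net for each outcome, and a net integrates Haar functions of total level at most [m] exactly.  After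
  summation by parts, each term of the method that survives cancellation has total level close to [L]
  ([smolyak_coef_neq0]), so that at least one block is resolved by its net.
- Otherwise the second moment is at most of order [L ^ (d - 1) * b ^- L] ([smolyak_haar_sqr]): about [L ^ (d - 1)]
  terms survive, they are uncorrelated because nets of different levels are randomized independently, and in
  each of them only boundedly many of the roughly [b ^ L] nodes meet the support of the Haar function.
- Haar functions of different levels or supports have uncorrelated images ([smolyak_haar_orth]), so each is
  correlated with at most [b ^ (d * s)] others.

Hence the mean square error is at most a constant times [L ^ (d - 1) * b ^- L] times the sum of the squared
Haar coefficients of level above [L - d] ([discrete_variance]), and this sum is at most a constant times
[b `^ (- 2 * alpha * L)] on the unit ball ([haar_tail_le]).  As the number [N] of evaluations is between
[b ^ (L - d)] and a constant times [L ^ (d - 1) * b ^ (L - d)], this is the claimed rate ([rate_ge]).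

Moments are computed by counting.  Haar functions of level at most [M] see only the first [M] digits of the
nodes, so the relevant outcomes form a finite set of equally likely configurations ([integral_config]).
Composing one permutation, or one digit of the noise, with a fixed permutation of the digits is a bijection of
this set, and all decorrelation statements follow by averaging over such bijections ([shift_average]).

A general integrand is replaced by its truncation to levels at most [M], which is its conditional mean on the
cells of side [b ^- M] ([truncationE]).  The truncations approximate it in mean square ([truncation_best],
[approximable_sqint]), and for fixed [L] the method is continuous in mean square because each of its nodes is
uniformly distributed ([smolyak_continuous]). *)

(** * Combination coefficients of the Smolyak method *)

Section smolyak_combination.
Context (R : realFieldType) (d L : nat) (u : pred 'I_d).
Implicit Types (v : 'I_d -> nat -> R) (k : {ffun 'I_d -> 'I_L.+1}).

(** The coefficient of the quadrature of level [k] in the difference of levels [l] and [l - 1].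
On an inactive block the integrand is constant and all quadratures of positive level agree; the differences
with [l > 1] then vanish, and writing the remaining one with level 1 alone leaves no two distinct
multi-indices [k] with nonzero coefficient that agree on the active blocks.  This is what
makes the terms of the resulting sum uncorrelated. *)
Definition diff_coef (active : bool) (l k : nat) : R :=
  if active then (l == k)%:R - (l == k.+1)%:R else ((l == 1%N) && (k == 1%N))%:R.

Lemma diff_coef_neq0 active (l k : nat) : diff_coef active l k != 0 ->
  if active then l = k \/ l = k.+1 else k = 1%N /\ l = 1%N.
Proof.
rewrite /diff_coef; case: active; last first.
  by case: (l =P 1%N) => [->|_]; case: (k =P 1%N) => [->|_] //=; rewrite eqxx.
have [->|_] := l =P k; first by left.
by have [->|_] := l =P k.+1; [right|rewrite subrr eqxx].
Qed.

Definition smolyak_coef (k : {ffun 'I_d -> 'I_L.+1}) : R :=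
  \sum_(l in multi_indices L d) \prod_(n < d) diff_coef (u n) (l n) (k n).

Lemma sum_ord_delta (F : nat -> R) (m : nat) : (m <= L)%N ->
  \sum_(k < L.+1) (m == k :> nat)%:R * F k = F m.
Proof.
move=> mL; rewrite (bigD1 (inord m)) //= inordK ?ltnS // eqxx mul1r.
rewrite big1 ?addr0 // => k; rewrite -val_eqE /= inordK ?ltnS // eq_sym.
by move=> /negPf ->; rewrite mul0r.
Qed.

Lemma diff_coefE v n (l : 'I_L.+1) : v n 0%N = 0 ->
    (forall m, ~~ u n -> (0 < m)%N -> v n m = 1) -> (0 < l)%N ->
  \sum_(k < L.+1) diff_coef (u n) l k * v n k = v n l - v n l.-1.
Proof.
move=> v0 v1; case: l => [[//|l] /= lL] _; rewrite /diff_coef /=.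
have l1 : (l <= L)%N by rewrite ltnW.
case: (boolP (u n)) => [_|/v1 {}v1].
  under eq_bigr => k _ do rewrite mulrBl eqSS.
  by rewrite sumrB !sum_ord_delta.
case: l lL l1 => [|l] lL l1; last first.
  by rewrite !v1 // subrr big1 // => k _; rewrite /= mul0r.
under eq_bigr => k _ do rewrite eqxx /= eq_sym.
by rewrite sum_ord_delta // v0 subr0.
Qed.

(** Summation by parts: [v n m] stands for the value of the quadrature of level [m] in block [n]. *)
Lemma smolyak_coefE v : (forall n, v n 0%N = 0) ->
    (forall n m, ~~ u n -> (0 < m)%N -> v n m = 1) ->
  \sum_(l in multi_indices L d) \prod_(n < d) (v n (l n) - v n (l n).-1) =
  \sum_k smolyak_coef k * \prod_(n < d) v n (k n).
Proof.
move=> v0 v1; under [RHS]eq_bigr => k _ do rewrite mulr_suml.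
rewrite [RHS]exchange_big /=; apply: eq_bigr => l; rewrite inE => /andP[/forallP l0 _].
transitivity (\prod_(n < d) \sum_(k < L.+1) diff_coef (u n) (l n) k * v n k).
  by apply: eq_bigr => n _; rewrite diff_coefE // => m; exact: v1.
by rewrite bigA_distr_bigA /=; apply: eq_bigr => k _; exact: big_split.
Qed.

(** The last conclusion comes from cancellation.  If [|k| + #|u| <= L], then every [l] with [l n = k n] or
[l n = k n + 1] on the active blocks belongs to the index set, so the sum over [l] factorizes, and each active
factor is [1 - 1]. *)
Lemma smolyak_coef_neq0 k : (forall n, (0 < k n)%N) -> smolyak_coef k != 0 ->
  [/\ forall n, ~~ u n -> k n = 1%N :> nat, (\sum_(n < d) k n <= L)%N &
   (0 < #|u|)%N -> (L < \sum_(n < d) k n + #|u|)%N].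
Proof.
move=> k0 c0.
have [l lQ] : exists2 l, l \in multi_indices L d &
    \prod_(n < d) diff_coef (u n) (l n) (k n) != 0.
  apply/exists_inP; apply: contraNT c0 => /exists_inPn h.
  by apply/eqP/big1 => l /h; rewrite negbK => /eqP.
move=> /prodf_neq0 h; split.
- by move=> n /negPf un; have /diff_coef_neq0 := h n isT; rewrite un => -[].
- move: lQ; rewrite inE => /andP[_]; apply: leq_trans; apply: leq_sum => n _.
  have /diff_coef_neq0 := h n isT.
  by case: (u n) => [[]->|[-> ->]] //.
- move=> /card_gt0P[n0 un0]; rewrite ltnNge; apply: contraNN c0 => kL.
  have key (l' : {ffun 'I_d -> 'I_L.+1}) : (forall n, diff_coef (u n) (l' n) (k n) != 0) -> l' \in multi_indices L d.
    move=> h'; rewrite inE; apply/andP; split.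
      apply/forallP => n; have /diff_coef_neq0 := h' n.
      by case: (u n) => [[]->|[_ ->]].
    apply: leq_trans kL; rewrite -sum1_card [X in (_ + X)%N]big_mkcond /= -big_split /=.
    apply: leq_sum => n _; have /diff_coef_neq0 := h' n; rewrite unfold_in.
    by case: (u n) => [[]->|[-> ->]]; rewrite ?leq_addr ?addn1.
  have -> : smolyak_coef k = \sum_(l : {ffun 'I_d -> 'I_L.+1}) \prod_(n < d) diff_coef (u n) (l n) (k n).
    rewrite /smolyak_coef big_mkcond /=; apply: eq_bigr => l' _.
    case: ifPn => //; apply: contraNeq.
    by rewrite eq_sym => /prodf_neq0 h'; apply: key => n; apply: h'.
  rewrite -(bigA_distr_bigA (fun (n : 'I_d) (l : 'I_L.+1) => diff_coef (u n) l (k n))) (bigD1 n0) //=.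
  rewrite [X in X * _](_ : _ = 0) ?mul0r // /diff_coef (un0 : u n0).
  have kn : ((k n0).+1 <= L)%N.
    apply: leq_trans kL; rewrite (bigD1 n0) //= -addn1 -addnA leq_add2l.
    by apply: leq_trans (leq_addl _ _); apply/card_gt0P; exists n0.
  have S m : (m <= L)%N -> \sum_(l < L.+1) (l == m :> nat)%:R = 1 :> R.
    move=> mL; rewrite -[RHS](sum_ord_delta (fun=> 1) mL).
    by apply: eq_bigr => l' _; rewrite mulr1 eq_sym.
  by rewrite sumrB !S ?subrr // ltnW.
Qed.

Lemma smolyak_coef_bound k : `|smolyak_coef k| <= 2 ^+ d.
Proof.
have D (l : 'I_L.+1) n : `|diff_coef (u n) l (k n)| <=
    (l == k n :> nat)%:R + (l == (k n).+1 :> nat)%:R.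
  rewrite /diff_coef; case: ifP => _.
    by apply: le_trans (ler_normB _ _) _; rewrite !normr_nat.
  case: (k n =P 1%N :> nat) => [->|_]; last by rewrite andbF normr0 addr_ge0.
  by rewrite andbT normr_nat lerDl.
have S m : \sum_(l < L.+1) (l == m :> nat)%:R <= 1 :> R.
  have [mL|Lm] := leqP m L.
    rewrite -[leRHS](sum_ord_delta (fun=> 1) mL).
    by apply: ler_sum => l' _; rewrite mulr1 eq_sym.
  rewrite big1 // => l _; case: eqP => // lm; by have := ltn_ord l; rewrite lm ltnS leqNgt Lm.
apply: (@le_trans _ _ (\sum_(l : {ffun 'I_d -> 'I_L.+1}) \prod_(n < d) `|diff_coef (u n) (l n) (k n)|)).
  apply: le_trans (ler_norm_sum _ _ _) _.
  rewrite big_mkcond /=; apply: ler_sum => l _; case: ifP => _.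
    by rewrite normr_prod.
  exact: prodr_ge0.
rewrite -(bigA_distr_bigA (fun (n : 'I_d) (l : 'I_L.+1) => `|diff_coef (u n) l (k n)|)).
rewrite -[in leRHS](card_ord d) -prodr_const; apply: ler_prod => n _.
rewrite sumr_ge0 //=; apply: le_trans (ler_sum _ (fun l _ => D l n)) _.
rewrite big_split /=; have := S (k n); have := S (k n).+1.
lra.
Qed.

End smolyak_combination.

(** The total [|l|] takes at most [d] values, and it determines the first entry from the others. *)
Lemma card_top_indices (L d : nat) : (0 < d)%N ->
  (#|[set l in multi_indices L d | (L < \sum_(n < d) l n + d)%N]| <= d * L.+1 ^ d.-1)%N.
Proof.
case: d => [//|d] _ /=.
pose F (l : {ffun 'I_d.+1 -> 'I_L.+1}) : 'I_d.+1 * {ffun 'I_d -> 'I_L.+1} :=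
  (inord (L - \sum_(n < d.+1) l n)%N, [ffun n => l (lift ord0 n)]).
set A := finset _; have Finj : {in A &, injective F}.
  move=> l l'; rewrite !inE => /andP[/andP[_ lL] lt] /andP[/andP[_ l'L] lt'] [].
  move=> /(congr1 val) /=; rewrite !inordK; [|lia|lia] => e.
  have {}e : (\sum_(n < d.+1) l n = \sum_(n < d.+1) l' n)%N.
    rewrite -[LHS](subKn lL) -[RHS](subKn l'L); congr (L - _)%N; exact: e.
  move=> /ffunP h; have {}h n : l (lift ord0 n) = l' (lift ord0 n).
    by have := h n; rewrite !ffunE.
  apply/ffunP => n; case: (unliftP ord0 n) => [m ->//|->].
  apply/val_inj => /=; move: e; rewrite !big_ord_recl /=.
  by under eq_bigr => i _ do rewrite h; move/addIn.
rewrite -(card_in_imset Finj); apply: leq_trans (max_card _) _.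
by rewrite card_prod card_ffun !card_ord.
Qed.

(** * The number of function evaluations *)

Lemma num_evals_ge (b L d : nat) : (0 < d <= L)%N -> (b ^ (L - d) <= num_evals b L d)%N.
Proof.
case: d => [//|d] /= dL; have L0 : (0 < L)%N by lia.
(* The index (L - d + 1, 1, ..., 1) alone accounts for b ^ (L - d) nodes. *)
pose l : {ffun 'I_d.+1 -> 'I_L.+1} :=
  [ffun n => if n == ord0 then inord (L - d)%N else inord 1%N].
have E : (\sum_(n < d.+1) l n = L)%N.
  rewrite big_ord_recl ffunE eqxx inordK; last by rewrite ltnS leq_subr.
  rewrite (eq_bigr (fun=> 1%N)) => [|i _]; last by rewrite ffunE /= inordK.
  by rewrite sum1_card card_ord subnK // ltnW.
have lQ : l \in multi_indices L d.+1.
  rewrite inE E leqnn andbT; apply/forallP => n; rewrite ffunE; case: ifP => _.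
    by rewrite inordK ?subn_gt0 // ltnS leq_subr.
  by rewrite inordK.
rewrite /num_evals (bigD1 l) /= ?E ?leq_addr //.
by rewrite lQ; lia.
Qed.

Lemma num_evals_le (b L d : nat) : (0 < b)%N -> (0 < d <= L)%N ->
  (num_evals b L d <= d * L.+1 ^ d.-1 * b ^ (L - d))%N.
Proof.
move=> b0 /andP[d0 dL].
apply: (@leq_trans (\sum_(l in [set l in multi_indices L d |
    (L < \sum_(n < d) l n + d)%N]%SET) b ^ (L - d))); last first.
  by rewrite sum_nat_const leq_mul2r card_top_indices ?orbT.
rewrite /num_evals [leqRHS](eq_bigl (fun l => (l \in multi_indices L d) &&
    (L - d + 1 <= \sum_(n < d) l n)%N)); last first.
  by move=> l; rewrite !inE; congr (_ && _); lia.
apply: leq_sum => l /andP[]; rewrite inE => /andP[_ lL] _.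
by rewrite leq_pexp2l // leq_sub2r.
Qed.

(** Since [b ^ (L - d) <= N <= d * L.+1 ^ d.-1 * b ^ (L - d)], it is enough to bound powers of [L]
by powers of [ln N].  The exponent of [ln N] accounts both for the power of [L] on the left and for the one in
the upper bound of [N].  The logarithm is at least a multiple of [L] when [L > d]; for [d = 1] its exponent is
zero. *)
Lemma rate_ge (R : realType) (alpha K : R) (b d : nat) :
    0 < alpha -> 0 <= K -> (1 < b)%N -> (0 < d)%N ->
  exists2 C : R, 0 <= C & forall L : nat, (d <= L)%N -> ((2 <= d)%N -> (d < L)%N) ->
    K * (L.+1%:R ^+ d.-1 * (b%:R ^- L * b%:R `^ (- (2 * alpha * L%:R)))) <=
    (C * (ln (num_evals b L d)%:R `^ ((d%:R - 1) * (1 + alpha))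
          / (num_evals b L d)%:R `^ (alpha + 2^-1))) ^+ 2.
Proof.
move=> a0 K0 b1 d0.
have Ld L : (d < L)%N -> (L.+1 <= (L - d) * d.+2)%N.
  by move=> /subnKC <-; move: (L - d.+1)%N => k; rewrite addSnnS addKn; nia.
pose B : R := b%:R; have B1 : 1 < B by rewrite ltr1n.
have B0 : 0 < B by apply: lt_trans B1.
have B0w : 0 <= B := ltW B0.
pose g : R := (d%:R - 1) * (1 + alpha); pose e : R := alpha + 2^-1.
have g0 : 0 <= g by rewrite mulr_ge0 ?subr_ge0 ?ler1n ?addr_ge0 ?ltW.
have e0 : 0 <= e by rewrite addr_ge0 // ltW.
(* From L.+1 <= (L - d) * d.+2, valid for L > d. *)
pose c : R := ln B / (d.+2)%:R.
have c0 : 0 < c by rewrite divr_gt0 ?ln_gt0.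
exists (Num.sqrt K * (d%:R `^ e / c `^ g)).
  by rewrite mulr_ge0 ?sqrtr_ge0 // divr_ge0 ?powR_ge0.
move=> L dL dL'; set N : R := (num_evals b L d)%:R.
have dL0 : (0 < d <= L)%N by rewrite d0.
have NB : B ^+ (L - d) <= N by rewrite -natrX ler_nat num_evals_ge.
have N0 : 0 < N by apply: lt_le_trans NB; rewrite exprn_gt0.
pose x : R := L.+1%:R; have x0 : 0 < x by rewrite ltr0n.
have x0w : 0 <= x := ltW x0; have N0w : 0 <= N := ltW N0; have c0w : 0 <= c := ltW c0.
have Nx : N <= d%:R * (x ^+ d.-1 * B ^+ L).
  apply: (@le_trans _ _ (d * L.+1 ^ d.-1 * b ^ (L - d))%N%:R).
    by rewrite ler_nat num_evals_le // ltnW.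
  rewrite !natrM !natrX -mulrA ler_wpM2l // ler_wpM2l ?exprn_ge0 //.
  by rewrite ler_eXn2l // leq_subr.
have lnN : (c * x) `^ g <= ln N `^ g.
  have [d1|d2] := leqP d 1.
    have dE : d = 1%N by apply/eqP; rewrite eqn_leq d1.
    by rewrite /g dE subrr mul0r !powRr0.
  have {dL'}dL' := dL' d2.
  have h : c * x <= ln N.
    apply: (@le_trans _ _ (ln (B ^+ (L - d)))); last first.
      by rewrite ler_ln // posrE ?exprn_gt0.
    rewrite lnXn // -[leRHS]mulr_natr /c mulrAC -mulrA; apply: ler_wpM2l; first exact/ln_ge0/ltW.
    rewrite ler_pdivrMr ?ltr0n // -natrM ler_nat.
    exact: Ld.
  by apply: ge0_ler_powR => //; rewrite nnegrE ?(le_trans _ h) // mulr_ge0.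
have NE : N `^ e <= d%:R `^ e * (x ^+ d.-1 * B ^+ L) `^ e.
  rewrite -powRM ?mulr_ge0 ?exprn_ge0 //.
  by apply: ge0_ler_powR => //; rewrite nnegrE ?mulr_ge0 ?exprn_ge0.
have rate_low : (c * x) `^ g / (d%:R `^ e * (x ^+ d.-1 * B ^+ L) `^ e) <= ln N `^ g / N `^ e.
  apply: ler_pM => //; rewrite ?powR_ge0 ?invr_ge0 ?mulr_ge0 ?powR_ge0 //.
  rewrite lef_pV2 // posrE ?powR_gt0 // mulr_gt0 // powR_gt0 ?ltr0n //.
  by rewrite mulr_gt0 // exprn_gt0.
apply: (@le_trans _ _ ((Num.sqrt K * (d%:R `^ e / c `^ g) *
   ((c * x) `^ g / (d%:R `^ e * (x ^+ d.-1 * B ^+ L) `^ e))) ^+ 2)); last first.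
  rewrite lerXn2r // ?nnegrE ?ler_wpM2l ?mulr_ge0 ?sqrtr_ge0 ?invr_ge0 ?mulr_ge0 ?powR_ge0 //.
rewrite powRM //.
have -> : Num.sqrt K * (d%:R `^ e / c `^ g) *
     (c `^ g * x `^ g / (d%:R `^ e * (x ^+ d.-1 * B ^+ L) `^ e)) =
   Num.sqrt K * (x `^ g / (x ^+ d.-1 * B ^+ L) `^ e).
  by field; rewrite !gt_eqF ?powR_gt0 ?ltr0n // mulr_gt0 // exprn_gt0.
rewrite exprMn sqr_sqrtr // ler_wpM2l //.
rewrite powRM ?exprn_ge0 // -!powR_mulrn //; last by rewrite divr_ge0 ?mulr_ge0 ?powR_ge0.
rewrite -!powRrM invfM -!powRN !powRM ?mulr_ge0 ?powR_ge0 // -!powRrM mulrA.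
have P y r t : 0 < y -> y `^ r * y `^ t = y `^ (r + t).
  by move=> y0; rewrite powRD //; apply/implyP => _; rewrite gt_eqF.
rewrite [_ * (_ * _)]mulrA !P //.
have -> : d.-1%:R = d%:R - 1 :> R by rewrite -subn1 natrB.
rewrite le_eqVlt; apply/orP; left; apply/eqP; rewrite /g /e -mulrA P //.
by congr (_ `^ _ * _ `^ _); field.
Qed.

(** * Digits in base [b] *)

(** Words are digit prefixes, most significant digit first; [word_num] reads them in base [b]. *)
Section words.
Context (b : nat).
Implicit Types (w : seq 'I_b).

Definition word_num w : nat := foldl (fun n (a : 'I_b) => n * b + a)%N 0%N w.

Lemma word_num_rcons w a : word_num (rcons w a) = (word_num w * b + a)%N.
Proof. by rewrite /word_num foldl_rcons. Qed.

Lemma word_num_cat w w' :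
  word_num (w ++ w') = (word_num w * b ^ size w' + word_num w')%N.
Proof.
elim/last_ind: w' => [|w' a IH]; first by rewrite cats0 muln1 addn0.
by rewrite -rcons_cat !word_num_rcons IH size_rcons expnSr; lia.
Qed.

Lemma word_num_lt w : (word_num w < b ^ size w)%N.
Proof.
elim/last_ind: w => [//|w a IH]; rewrite word_num_rcons size_rcons expnSr.
have ab := ltn_ord a.
apply: (@leq_trans ((word_num w).+1 * b)%N); first by rewrite mulSn addnC ltn_add2r.
by rewrite leq_mul2r IH orbT.
Qed.

Lemma word_num_rcons_eq w (a : 'I_b) k i : (i < b)%N ->
  (word_num (rcons w a) == k * b + i)%N = (word_num w == k) && (a == i :> nat).
Proof.
move=> ib; have ab := ltn_ord a; have b0 : (0 < b)%N by apply: leq_ltn_trans ab.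
rewrite word_num_rcons; apply/eqP/andP => [e|[/eqP-> /eqP->] //].
have := congr1 (divn^~ b) e; have := congr1 (modn^~ b) e.
rewrite /= !modnMDl !modn_small // !divnMDl // !divn_small // !addn0.
by move=> -> ->; rewrite !eqxx.
Qed.

Lemma word_num_inj w w' : size w = size w' -> word_num w = word_num w' -> w = w'.
Proof.
elim/last_ind: w w' => [|w a IH] w'; first by case: w'.
case/lastP: w' => [|w' a']; rewrite !size_rcons // => -[sw] /eqP.
by rewrite [X in _ == X]word_num_rcons word_num_rcons_eq // => /andP[/eqP/(IH _ sw)-> /eqP/val_inj->].
Qed.

Lemma word_num_surj j k : (k < b ^ j)%N -> exists2 w, size w = j & word_num w = k.
Proof.
elim: j k => [|j IH] k kb; first by exists [::] => //; move: kb; case: k.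
have b0 : (0 < b)%N by case: b kb => //; rewrite exp0n.
have [|w sw kw] := IH (k %/ b)%N; first by rewrite ltn_divLR // -expnSr.
exists (rcons w (Ordinal (ltn_pmod k b0))); first by rewrite size_rcons sw.
by rewrite word_num_rcons kw /= -divn_eq.
Qed.

End words.

Section digits.
Context (R : realType) (b : nat) (hb : (1 < b)%N).
Implicit Types (x y z : R).

Let b0 : (0 < b)%N. Proof. exact: ltnW. Qed.

Let B0 n : 0 < b%:R ^+ n :> R. Proof. by rewrite exprn_gt0 // ltr0n. Qed.

Let X0 n y : 0 <= y -> 0 <= b%:R ^+ n * y.
Proof. by move=> y0; rewrite mulr_ge0 // ltW. Qed.

Lemma truncn_mul_div (c : nat) z : (0 < c)%N -> 0 <= z ->
  (Num.truncn (c%:R * z) %/ c)%N = Num.truncn z.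
Proof.
move=> c0 z0; apply/eqP; rewrite eq_sym truncn_eq //.
have cz0 : 0 <= c%:R * z by rewrite mulr_ge0.
have c0' : 0 < c%:R :> R by rewrite ltr0n.
have /andP[h1 h2] := truncn_itv cz0; apply/andP; split.
  rewrite -(ler_pM2l c0') -natrM; apply: le_trans h1; rewrite ler_nat mulnC.
  exact: leq_trunc_div.
rewrite -(ltr_pM2l c0') -natrM; apply: lt_le_trans h2 _; rewrite ler_nat.
by rewrite mulnC -ltn_divLR // ltnSn.
Qed.

Lemma truncn_expn_div j k y : 0 <= y ->
  (Num.truncn (b%:R ^+ (j + k) * y) %/ b ^ k)%N = Num.truncn (b%:R ^+ j * y).
Proof.
move=> y0; rewrite addnC exprD -mulrA -natrX truncn_mul_div ?expn_gt0 ?b0 //.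
exact: X0.
Qed.

Definition digits y (r : nat) : 'I_b := digit hb y r.+1.

Lemma truncn_digits y j : 0 <= y < 1 ->
  Num.truncn (b%:R ^+ j * y) = word_num (mkseq (digits y) j).
Proof.
move=> /andP[y0 y1]; elim: j => [|j IH].
  by rewrite expr0 mul1r /=; apply: truncn_def; rewrite y0.
rewrite mkseqS word_num_rcons -IH -(@truncn_expn_div j 1) // addn1 /= expn1.
exact: divn_eq.
Qed.

Lemma digits_unique (a : nat -> 'I_b) y j :
    Num.truncn (b%:R ^+ j.+1 * y) = word_num (mkseq a j.+1) ->
  digits y j = a j.
Proof.
move=> e; apply/val_inj => /=; rewrite e mkseqS word_num_rcons modnMDl.
by rewrite modn_small.
Qed.

Lemma digit_prefixE x j : digit_prefix hb x j = mkseq (digits x) j.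
Proof. by rewrite /digit_prefix (iotaDl 1 0) -map_comp. Qed.

Lemma word_num_sum (a : nat -> 'I_b) m :
  \sum_(j < m) (a j : nat)%:R / b%:R ^+ j.+1 =
  (word_num (mkseq a m))%:R / b%:R ^+ m :> R.
Proof.
elim: m => [|m IH]; first by rewrite big_ord0 mul0r.
rewrite big_ord_recr /= IH mkseqS word_num_rcons natrD natrM mulrDl exprS.
by congr (_ + _); rewrite invfM mulrA mulfK // pnatr_eq0 -lt0n.
Qed.

(** The number whose first [m] digits are prescribed and whose further digits are those of [x]: a scrambled
coordinate has this form, with [x] the noise. *)
Section append.
Context (a : nat -> 'I_b) (m : nat) (x : R).
Hypothesis x01 : 0 <= x < 1.

Definition append_digits (r : nat) : 'I_b := if (r < m)%N then a r else digits x (r - m).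

Let y := (word_num (mkseq a m))%:R / b%:R ^+ m + b%:R ^- m * x.

Let yE : b%:R ^+ m * y = (word_num (mkseq a m))%:R + x.
Proof. by rewrite /y mulrDr [_ * (_ / _)]mulrC mulfVK ?mulVKf ?gt_eqF. Qed.

Lemma append_itv : 0 <= y < 1.
Proof.
case/andP: x01 => x0 x1.
rewrite -(pmulr_rge0 _ (B0 m)) yE addr_ge0 //= -(ltr_pM2l (B0 m)) yE mulr1 -natrX.
apply: (@lt_le_trans _ _ (word_num (mkseq a m)).+1%:R).
  by rewrite -natr1 ltrD2l.
by rewrite ler_nat -{2}(size_mkseq a m) word_num_lt.
Qed.

Let mkseq_append k : mkseq append_digits (m + k) = mkseq a m ++ mkseq (digits x) k.
Proof.
rewrite /mkseq iotaD map_cat; congr (_ ++ _).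
  by apply/eq_in_map => r; rewrite mem_iota /append_digits => /= ->.
rewrite add0n -{1}[m]addn0 iotaDl -map_comp; apply: eq_map => r /=.
by rewrite /append_digits ltnNge leq_addr /= addKn.
Qed.

Lemma digits_append r : digits y r = append_digits r.
Proof.
have /andP[y0 _] := append_itv; have /andP[x0 _] := x01.
have H k : Num.truncn (b%:R ^+ (m + k) * y) = word_num (mkseq append_digits (m + k)).
  rewrite addnC exprD -mulrA yE mulrDr addnC mkseq_append word_num_cat size_mkseq.
  rewrite -truncn_digits // -natrX -natrM truncnD ?natr_nat //.
    by rewrite natrK mulnC.
  by rewrite nnegrE mulr_ge0.
apply: digits_unique.
have [rm|mr] := leqP m r.+1; first by rewrite -(subnKC rm).
rewrite -(@truncn_expn_div _ (m - r.+1)) // subnKC ?(ltnW mr) //.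
have := H 0%N; rewrite addn0 => ->.
have -> : mkseq append_digits m = mkseq append_digits r.+1 ++ drop r.+1 (mkseq append_digits m).
  rewrite -{1}(cat_take_drop r.+1 (mkseq append_digits m)); congr (_ ++ _).
  by rewrite /mkseq -map_take take_iota (minn_idPl (ltnW mr)).
rewrite word_num_cat size_drop size_mkseq divnMDl ?expn_gt0 ?b0 // divn_small ?addn0 //.
by rewrite -{2}(size_mkseq append_digits m) -size_drop word_num_lt.
Qed.

End append.

Lemma scrambleE (m : nat) (pi : seq 'I_b -> {perm 'I_b}) x :
  scramble hb m pi x =
  (word_num (mkseq (fun j => pi (mkseq (digits x) j) (digits x j)) m))%:R / b%:R ^+ m.
Proof.
rewrite /scramble -word_num_sum; apply: eq_bigr => j _.
by rewrite digit_prefixE.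
Qed.

(** The univariate Haar function, as a function of the digits of its argument.  It is this form that links
the continuous and the discrete parts of the proof: the first [j] digits determine the value. *)
Definition digit_haar (j i k : nat) (a : nat -> 'I_b) : R :=
  if j is j'.+1 then
    b%:R `^ ((j%:R - 2) / 2) *
    ((word_num (mkseq a j') == k)%:R * (b%:R * (a j' == i :> nat)%:R - 1))
  else 1.

Lemma haar_digits j i k y : 0 <= y < 1 -> (i < b)%N ->
  haar b j i k y = digit_haar j i k (digits y).
Proof.
move=> y01 ib; have /andP[y0 y1] := y01; case: j => [|j] /=.
  by rewrite indicE mem_set //= in_itv /= y0.
congr (_ * _).
have F n : (Num.floor (b%:R ^+ n * y) = (word_num (mkseq (digits y) n))%:Z).
  rewrite -truncn_digits // truncn_floor X0 // gez0_abs //.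
  by rewrite floor_ge_int X0.
rewrite !indicE.
have -> : (y \in [set z | Num.floor (b%:R ^+ j.+1 * z) = (b * k + i)%N%:Z]) =
    (word_num (mkseq (digits y) j) == k) && (digits y j == i :> nat).
  rewrite -word_num_rcons_eq // -mkseqS mulnC.
  by apply/idP/eqP => [/set_mem/=|e]; [rewrite F => -[]|apply/mem_set; rewrite /= F e].
have -> : (y \in [set z | Num.floor (b%:R ^+ j * z) = k%:Z]) =
    (word_num (mkseq (digits y) j) == k).
  by apply/idP/eqP => [/set_mem/=|e]; [rewrite F => -[]|apply/mem_set; rewrite /= F e].
by case: (_ == k); case: (_ == i); rewrite /= ?mulr1 ?mulr0 ?mul0r ?mul1r ?subr0.
Qed.

End digits.

(** * Haar functions summed over a net *)

(** Cauchy-Schwarz against the constant 1. *)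
Lemma sqr_sum_le (R : realFieldType) (I : finType) (A : {pred I}) (x : I -> R) :
  (\sum_(i in A) x i) ^+ 2 <= #|A|%:R * \sum_(i in A) x i ^+ 2.
Proof.
rewrite expr2 mulr_suml.
under eq_bigr => i _ do rewrite mulr_sumr.
have -> : #|A|%:R * \sum_(i in A) x i ^+ 2 =
    \sum_(i in A) \sum_(j in A) (x i ^+ 2 + x j ^+ 2) / 2.
  under [RHS]eq_bigr => i _ do rewrite -mulr_suml big_split /= sumr_const -[_ *+ _]mulr_natl.
  rewrite -mulr_suml big_split /= sumr_const -[_ *+ _]mulr_natl -mulr_sumr; by field.
apply: ler_sum => i _; apply: ler_sum => j _.
have := sqr_ge0 (x i - x j); lra.
Qed.

Lemma prodr_bool (R : comPzRingType) (I : finType) (P : pred I) :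
  \prod_i (P i)%:R = [forall i, P i]%:R :> R.
Proof.
case: (boolP [forall i, P i]) => [/forallP h|/forallPn[i h]].
  by rewrite big1 // => i _; rewrite h.
by rewrite (bigD1 i) //= (negPf h) mul0r.
Qed.

Section discrete_net.
Context (R : realType) (b s m : nat) (I : finType) (a : I -> 'I_s -> nat -> 'I_b).
Hypotheses (hb : (1 < b)%N) (hs : (0 < s)%N).

(** The prefixes [w] encode an elementary interval, of volume [b] to the minus total length of [w]. *)
Definition in_cell (w : 'I_s -> seq 'I_b) (i : I) : bool :=
  [forall t, mkseq (a i t) (size (w t)) == w t].

Definition discrete_net : Prop := forall w : 'I_s -> seq 'I_b,
  (\sum_(t < s) size (w t) = m)%N -> #|in_cell w| = 1%N.

Hypothesis net_a : discrete_net.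

Lemma card_cell_le w w' : (forall i, in_cell w i -> in_cell w' i) ->
  (#|in_cell w| <= #|in_cell w'|)%N.
Proof. by move=> h; apply/subset_leq_card/fintype.subsetP => i; apply: h. Qed.

(** Larger elementary intervals split, along any coordinate, into [b] intervals of the next size. *)
Lemma card_cell w : (\sum_(t < s) size (w t) <= m)%N ->
  #|in_cell w| = (b ^ (m - \sum_(t < s) size (w t)))%N.
Proof.
move=> wm; have [k] := ubnP (m - \sum_(t < s) size (w t))%N.
elim: k w wm => // k IH w wm.
have [wk|] := leqP m (\sum_(t < s) size (w t)).
  by rewrite net_a; [rewrite (eqP (_ : m - _ == 0)%N) // subn_eq0|apply/eqP; rewrite eqn_leq wm].
move=> wlt mk; pose t0 := Ordinal hs.
pose w' c t := if t == t0 then rcons (w t) c else w t.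
have S c : (\sum_(t < s) size (w' c t) = (\sum_(t < s) size (w t)).+1)%N.
  rewrite (bigD1 t0) //= [in RHS](bigD1 t0) //= /w' eqxx size_rcons addSn; congr ((_ + _).+1).
  by apply: eq_bigr => t /negPf ->.
have E c i : in_cell (w' c) i = in_cell w i && (a i t0 (size (w t0)) == c).
  apply/forallP/andP => [h|[/forallP h /eqP <-] t]; last first.
    rewrite /w'; case: (t =P t0) => [->|_ //]; rewrite size_rcons mkseqS eqseq_rcons eqxx andbT.
    exact: h.
  split; last by have := h t0; rewrite /w' eqxx size_rcons mkseqS eqseq_rcons => /andP[].
  apply/forallP => t; have := h t; rewrite /w'; case: (t =P t0) => // _.
  by rewrite size_rcons mkseqS eqseq_rcons => /andP[].
rewrite -sum1_card (partition_big (fun i => a i t0 (size (w t0))) xpredT) //=.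
rewrite (eq_bigr (fun=> b ^ (m - (\sum_(t < s) size (w t)).+1))%N) => [|c _].
  by rewrite sum_nat_const card_ord -expnS subnS prednK // subn_gt0.
rewrite -(S c) -IH ?S //; last by rewrite -ltnS (leq_trans _ mk) // ltnS subnS prednK ?subn_gt0.
by rewrite -sum1_card; apply: eq_bigl => i; rewrite -[RHS]/(in_cell (w' c) i) E.
Qed.

(** Cropping the prefixes puts a small interval into one of volume [b ^- h]. *)
Lemma card_cell_ub w h : (h <= \sum_(t < s) size (w t))%N -> (h <= m)%N ->
  (#|in_cell w| <= b ^ (m - h))%N.
Proof.
move=> hw hm; have [k kE] : {k | (\sum_(t < s) size (w t) = h + k)%N}.
  by exists (\sum_(t < s) size (w t) - h)%N; rewrite subnKC.
elim: k w {hw} kE => [|k IH] w kE.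
  by rewrite card_cell kE addn0.
have [t0 t00] : exists t0, (0 < size (w t0))%N.
  apply/existsP; apply: contra_eqT kE => /existsPn h0.
  rewrite big1 ?addnS // => t _; have := h0 t; by rewrite lt0n negbK => /eqP.
pose w' t := if t == t0 then take (size (w t)).-1 (w t) else w t.
apply: (@leq_trans #|in_cell w'|).
  apply: card_cell_le => i /forallP h0; apply/forallP => t; have := h0 t.
  rewrite /w'; case: (t =P t0) => [-> /eqP e|//].
  rewrite size_takel ?leq_pred // -[X in _ == take _ X]e.
  by case: (size _) t00 => // n _; rewrite mkseqS -cats1 take_size_cat ?size_mkseq.
apply: IH; apply/eq_add_S; rewrite -addnS -kE [in LHS](bigD1 t0) //= [in RHS](bigD1 t0) //=.
rewrite /w' eqxx size_takel ?leq_pred // -addSn prednK //; congr (_ + _)%N.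
by apply: eq_bigr => t /negPf ->.
Qed.

Section haar_sum.
Context (j e k : 'I_s -> nat).
Hypothesis ok : forall t, (e t < b)%N /\ (k t < b ^ (j t).-1)%N.

(** A Haar function of positive level is a combination of the indicators of a cell and of one of its
children, with integral zero. *)
Lemma digit_haar_split (t : 'I_s) : exists (coef : bool -> R) (w : bool -> seq 'I_b),
  [/\ forall f : nat -> 'I_b, digit_haar R (j t) (e t) (k t) f =
        \sum_(x : bool) coef x * (mkseq f (size (w x)) == w x)%:R,
      forall x, (size (w x) <= j t)%N &
      (0 < j t)%N -> \sum_(x : bool) coef x * b%:R ^- size (w x) = 0].
Proof.
have [et kt] := ok t; case: (j t) kt => [|j'] kt.
  exists (fun x => x%:R), (fun=> [::]); split => // f.
  by rewrite big_bool /= mulr1 mul0r addr0.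
have [w sw wk] := word_num_surj kt.
pose c : R := b%:R `^ ((j'.+1%:R - 2) / 2).
have num f : (mkseq f j' == w) = (word_num (mkseq f j') == k t).
  apply/eqP/eqP => [->//|]; rewrite -wk; apply: word_num_inj.
  by rewrite size_mkseq sw.
exists (fun x => if x then c * b%:R else - c).
exists (fun x => if x then rcons w (Ordinal et) else w); split.
- move=> f; rewrite big_bool /= size_rcons sw mkseqS eqseq_rcons num.
  rewrite -val_eqE /= /c; case: (_ == k t); case: (_ == e t) => /=; ring.
- by case; rewrite ?size_rcons sw.
- move=> _; rewrite big_bool /= size_rcons sw exprS invfM mulrA mulfK ?mulNr ?subrr //.
  by rewrite pnatr_eq0 -lt0n ltnW.
Qed.

(** The product expands into indicators of elementary intervals of volume at least [b ^- m].  The net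
counts them exactly, so the sum is [b ^ m] times the integral, which vanishes. *)
Lemma net_haar_sum0 : (0 < \sum_(t < s) j t <= m)%N ->
  \sum_i \prod_(t < s) digit_haar R (j t) (e t) (k t) (a i t) = 0.
Proof.
move=> /andP[j0 jm].
have [coef /choice[w H]] := choice digit_haar_split.
have -> : \sum_i \prod_(t < s) digit_haar R (j t) (e t) (k t) (a i t) =
    b%:R ^+ m * \prod_(t < s) \sum_(x : bool) coef t x * b%:R ^- size (w t x).
  under eq_bigr => i _.
    under eq_bigr => t _ do rewrite (let: And3 h _ _ := H t in h).
    rewrite bigA_distr_bigA /=.
    over.
  rewrite exchange_big /= bigA_distr_bigA mulr_sumr; apply: eq_bigr => x _.
  under eq_bigr => i _ do rewrite big_split /=.
  rewrite -mulr_sumr big_split /= mulrCA; congr (_ * _).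
  have wm : (\sum_(t < s) size (w t (x t)) <= m)%N.
    by apply: leq_trans jm; apply: leq_sum => t _; have [_ h _] := H t; apply: h.
  transitivity (#|in_cell (fun t => w t (x t))|%:R : R).
    rewrite -sum1_card natr_sum [RHS]big_mkcond /=; apply: eq_bigr => i _.
    by rewrite prodr_bool unfold_in /in_cell; case: [forall t, _].
  rewrite card_cell // natrX expfB_cond; last by rewrite pnatr_eq0 gtn_eqF ?(ltnW hb).
  by rewrite expr_sum -prodfV.
have [t0 t00] : exists t0, (0 < j t0)%N.
  apply/existsP; apply: contraTT j0 => /existsPn h0.
  by rewrite -leqNgt leqn0 big1 // => t _; apply/eqP; rewrite -leqn0 leqNgt h0.
have [_ _ h] := H t0.
by rewrite (bigD1 t0) //= h // mul0r mulr0.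
Qed.

Lemma digit_haar_neq0 (t : 'I_s) (w : seq 'I_b) (f : nat -> 'I_b) :
  size w = (j t).-1 -> word_num w = k t -> digit_haar R (j t) (e t) (k t) f != 0 ->
  mkseq f (size w) = w.
Proof.
move=> sw wk; rewrite sw; case: (j t) sw => [|j'] /=; first by case: w {wk}.
move=> sw; rewrite -wk; case: (_ =P word_num w) => [h _|_]; last by rewrite mul0r mulr0 eqxx.
by apply: word_num_inj; rewrite ?size_mkseq.
Qed.

(** Only the points of the cell that carries the Haar function contribute, and the net puts at most [b ^ s]
points there. *)
Lemma net_haar_sum_sqr : (m < \sum_(t < s) j t)%N || (m == 0)%N ->
  (\sum_i \prod_(t < s) digit_haar R (j t) (e t) (k t) (a i t)) ^+ 2 <=
  b%:R ^+ s * \sum_i (\prod_(t < s) digit_haar R (j t) (e t) (k t) (a i t)) ^+ 2.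
Proof.
move=> mj; pose x i := \prod_(t < s) digit_haar R (j t) (e t) (k t) (a i t).
rewrite -[leLHS]/((\sum_i x i) ^+ 2) -[leRHS]/(b%:R ^+ s * \sum_i x i ^+ 2).
have /choice[w W] (t : 'I_s) : exists w : seq 'I_b, size w = (j t).-1 /\ word_num w = k t.
  have [_ /word_num_surj[w sw wk]] := ok t; by exists w.
have xA i : i \notin in_cell w -> x i = 0.
  apply: contraNeq => /prodf_neq0 h; rewrite unfold_in; apply/forallP => t.
  by apply/eqP; have [sw wk] := W t; apply: (digit_haar_neq0 sw wk); apply: h.
have -> : \sum_i x i = \sum_(i in in_cell w) x i.
  by rewrite [RHS]big_mkcond /=; apply: eq_bigr => i _; case: ifPn => // /xA.
apply: le_trans (sqr_sum_le _ _) _.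
apply: ler_pM => //; first by apply: sumr_ge0 => i _; exact: sqr_ge0.
  have jw : (\sum_(t < s) j t <= \sum_(t < s) size (w t) + s)%N.
    rewrite -[X in (_ <= _ + X)%N](card_ord s) -sum1_card -big_split /=.
    by apply: leq_sum => t _; have [-> _] := W t; rewrite addn1 leqSpred.
  rewrite -natrX ler_nat; apply: (@leq_trans (b ^ (m - (m - s)))).
    apply: card_cell_ub; last by rewrite leq_subr.
    case/orP: mj => [mj|/eqP->]; last by rewrite sub0n.
    by rewrite leq_subLR addnC; apply: leq_trans jw; apply: ltnW.
  rewrite leq_exp2l //; lia.
rewrite big_mkcond /=; apply: ler_sum => i _; case: ifP => // _; exact: sqr_ge0.
Qed.

End haar_sum.

End discrete_net.

(** * Configurations: finitely many random digits *)

(** A scrambling permutes the words of each length, and so permutes the cells of each size. *)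
Lemma scramble_word (b : nat) (pi : seq 'I_b -> {perm 'I_b}) (w' : seq 'I_b) :
  exists2 w : seq 'I_b, size w = size w' & forall a : nat -> 'I_b,
    (mkseq (fun r => pi (mkseq a r) (a r)) (size w') == w') = (mkseq a (size w) == w).
Proof.
elim/last_ind: w' => [|w' x [w sw IH]]; first by exists [::].
exists (rcons w ((pi w)^-1%g x)); first by rewrite !size_rcons sw.
move=> a; rewrite !size_rcons !mkseqS !eqseq_rcons IH -sw.
case: eqP => //= ->; rewrite -[RHS](inj_eq (@perm_inj _ (pi w))).
by rewrite permKV.
Qed.

(** The preimage of an elementary interval under the scramblings is an elementary interval of the same
shape. *)
Lemma scrambled_net (b s m : nat) (I : finType) (a a' : I -> 'I_s -> nat -> 'I_b)
    (pi : 'I_s -> seq 'I_b -> {perm 'I_b}) :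
    (forall i t r, (r < m)%N -> a' i t r = pi t (mkseq (a i t) r) (a i t r)) ->
  discrete_net m a -> discrete_net m a'.
Proof.
move=> aE net w' w'm.
have /choice[w W] t : exists w : seq 'I_b, size w = size (w' t) /\ forall a,
    (mkseq (fun r => pi t (mkseq a r) (a r)) (size (w' t)) == w' t) = (mkseq a (size w) == w).
  by have [w sw H] := scramble_word (pi t) (w' t); exists w.
rewrite -[RHS](net w); last by rewrite -w'm; apply: eq_bigr => t _; case: (W t).
apply: eq_card => i; apply: eq_forallb => t; have [_ <-] := W t.
congr (_ == _); apply/eq_in_map => r; rewrite mem_iota => /= rw.
by rewrite aE // (leq_trans rw) // -w'm (bigD1 t) //= leq_addr.
Qed.

Section configurations.
Context (b s d L M : nat).

Definition perm_keys : seq ('I_d * nat * 'I_s * seq 'I_b) :=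
  [seq (x.1.1.1, val x.1.1.2, x.1.2, val x.2) |
     x : 'I_d * 'I_L * 'I_s * (L.-bseq 'I_b) <- enum {: 'I_d * 'I_L * 'I_s * (L.-bseq 'I_b)} & (size x.2 < x.1.1.2)%N].

Definition noise_keys : seq ('I_d * nat * 'I_s * nat) :=
  [seq (x.1.1.1, val x.1.1.2, x.1.2, val x.2) |
     x : 'I_d * 'I_L * 'I_s * 'I_(b ^ L) <- enum {: 'I_d * 'I_L * 'I_s * 'I_(b ^ L)} & (x.2 < b ^ x.1.1.2)%N].

Lemma perm_keys_uniq : uniq perm_keys.
Proof.
rewrite map_inj_uniq; first by apply: filter_uniq; exact: enum_uniq.
by move=> [[[n m] t] w] [[[n' m'] t'] w'] [-> /val_inj-> -> /val_inj->].
Qed.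

Lemma noise_keys_uniq : uniq noise_keys.
Proof.
rewrite map_inj_uniq; first by apply: filter_uniq; exact: enum_uniq.
by move=> [[[n m] t] w] [[[n' m'] t'] w'] [-> /val_inj-> -> /val_inj->].
Qed.

Lemma mem_perm_keys n m t w :
  ((n, m, t, w) \in perm_keys) = (m < L)%N && (size w < m)%N.
Proof.
apply/mapP/andP => [[[[[n' m'] t'] w']]|[mL wm]].
  by rewrite mem_filter => /andP[/= h _] [_ -> _ ->].
have wL : (size w <= L)%N by lia.
exists (n, Ordinal mL, t, Bseq wL) => //.
by rewrite mem_filter mem_enum andbT.
Qed.

Lemma mem_noise_keys n m t i : (0 < b)%N ->
  ((n, m, t, i) \in noise_keys) = (m < L)%N && (i < b ^ m)%N.
Proof.
move=> b0; apply/mapP/andP => [[[[[n' m'] t'] w']]|[mL wm]].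
  by rewrite mem_filter => /andP[/= h _] [_ -> _ ->].
have wL : (i < b ^ L)%N by apply: leq_trans wm _; rewrite leq_pexp2l // ltnW.
exists (n, Ordinal mL, t, Ordinal wL) => //.
by rewrite mem_filter mem_enum andbT.
Qed.

(** All the randomness that is visible in the first [M] digits of the nodes of levels at most [L]: the
permutations themselves and the leading digits of the noise. *)
Definition config : finType :=
  ({ffun seq_sub perm_keys -> {perm 'I_b}} *
   {ffun seq_sub noise_keys -> {ffun 'I_M -> 'I_b}})%type.

Implicit Types (c : config).

Definition config_perm c n m t w : {perm 'I_b} :=
  oapp c.1 1%g (insub (n, m, t, w)).

Context (z0 : 'I_b).

Definition config_noise c n m t i r : 'I_b :=
  match insub (n, m, t, i), insub r with
  | Some k, Some r' => c.2 k r'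
  | _, _ => z0
  end.

Context (src : 'I_d -> nat -> 'I_s -> nat -> nat -> 'I_b).

(** Digit [r] of coordinate [t] of the [i]-th node of block [n], for the net with [b ^ m] points and digits
[src]. *)
Definition config_digit c n m t i r : 'I_b :=
  if (r < m)%N then config_perm c n m t (mkseq (src n m t i) r) (src n m t i r)
  else config_noise c n m t i (r - m).

(** Composing one permutation, or one digit of the noise, with a fixed permutation of the digits preserves
the uniform law on configurations.  The symmetries [shift] below act in this way on the variable that decides
a given digit of a given node; averaging over them replaces independence. *)
Definition shift_perm (key : 'I_d * nat * 'I_s * seq 'I_b) (g : {perm 'I_b}) c : config :=
  ([ffun k => if val k == key then (c.1 k * g)%g else c.1 k], c.2).

Definition shift_noise (key : 'I_d * nat * 'I_s * nat) (r : nat) (g : {perm 'I_b}) c : config :=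
  (c.1, [ffun k => [ffun r' : 'I_M => if (val k == key) && (val r' == r)
                                      then g (c.2 k r') else c.2 k r']]).

Definition shift n m t i r (g : {perm 'I_b}) c : config :=
  if (r < m)%N then shift_perm (n, m, t, mkseq (src n m t i) r) g c
  else shift_noise (n, m, t, i) (r - m) g c.

Lemma shift_inj n m t i r g : injective (shift n m t i r g).
Proof.
apply: (can_inj (g := shift n m t i r g^-1)) => -[c1 c2]; rewrite /shift.
case: (r < m)%N; rewrite /shift_perm /shift_noise /=; congr (_, _); apply/ffunP => k; rewrite !ffunE.
  by case: (ssval k == _) => //; rewrite mulgK.
by apply/ffunP => r'; rewrite !ffunE; case: (_ && _) => //; rewrite permK.
Qed.

Lemma config_digit_shift n m t i r g c :
    (m < L)%N -> (r < M)%N -> (i < b ^ m)%N ->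
  config_digit (shift n m t i r g c) n m t i r = g (config_digit c n m t i r).
Proof.
move=> mL rM ib; have b0 : (0 < b)%N by case: (b) z0 => // -[].
rewrite /config_digit /shift; case: (ltnP r m) => rm.
  rewrite /config_perm insubT /=; first by rewrite mem_perm_keys size_mkseq mL.
  by move=> h; rewrite ffunE eqxx permM.
rewrite /config_noise insubT /=; first by rewrite mem_noise_keys // mL.
move=> h; rewrite insubT => [|h']; first by rewrite (leq_ltn_trans (leq_subr _ _)).
by rewrite !ffunE !eqxx.
Qed.

(** Whether the digits [r] of two nodes in coordinate [t] are decided by the same random variable; such
nodes also share all their preceding digits. *)
Definition same_key n t m i m' i' r : bool :=
  (m == m') && (if (r < m)%N then mkseq (src n m t i) r == mkseq (src n m' t i') r
                else i == i').

Lemma config_digit_shift_other n m t i r g c n' m' t' i' r' :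
    ~~ [&& n == n', t == t', r == r' & same_key n t m i m' i' r] ->
  config_digit (shift n m t i r g c) n' m' t' i' r' = config_digit c n' m' t' i' r'.
Proof.
move=> h; rewrite /config_digit /shift; case: (ltnP r' m') => rm'; case: (ltnP r m) => rm //.
- rewrite /config_perm; case: insubP => //= k _ kE.
  rewrite ffunE; case: eqP => // e; case/negP: h.
  move: e; rewrite kE => -[<- <- <- e]; rewrite !eqxx /=.
  have er : r' = r by have := congr1 size e; rewrite !size_mkseq.
  by rewrite -er /same_key !eqxx rm' /= e er.
- rewrite /config_noise; case: insubP => //= k _ kE; case: insubP => //= q _ qE.
  rewrite !ffunE; case: eqP => //= e; case: eqP => // e'; case/negP: h.
  move: e; rewrite kE => -[<- em <- ei]; rewrite !eqxx /=; move: e'; rewrite qE em => e'.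
  have er : r = r' by lia.
  by rewrite -er /same_key !eqxx ei /= eqxx; case: ifP.
Qed.

Lemma same_key_digit n t m i m' i' r r' c : (r' < r)%N ->
  same_key n t m i m' i' r -> config_digit c n m t i r' = config_digit c n m' t i' r'.
Proof.
move=> rr /andP[/eqP<-]; case: ifP => [rm /eqP e|_ /eqP-> //].
rewrite /config_digit (ltn_trans rr rm).
have e' k : (k < r)%N -> src n m t i k = src n m t i' k.
  by move=> kr; have := congr1 (nth z0 ^~ k) e; rewrite /= !nth_mkseq.
rewrite e' //; congr (config_perm c n m t _ _).
by apply/eq_in_map => k; rewrite mem_iota => /= kr; apply: e'; apply: ltn_trans rr.
Qed.

Section averages.
Context (R : realFieldType).

(** The image of a point under a uniform permutation is uniform, by transitivity of the symmetric group. *)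
Lemma sum_perm_apply (h : 'I_b -> R) (x : 'I_b) :
  b%:R * \sum_(g : {perm 'I_b}) h (g x) = #|{perm 'I_b}|%:R * \sum_y h y.
Proof.
have E y : \sum_(g : {perm 'I_b}) h (g x) = \sum_(g : {perm 'I_b}) h (g y).
  rewrite (reindex_inj (mulgI (tperm x y))) /=.
  by apply: eq_bigr => g _; rewrite permM tpermL.
have -> : b%:R * \sum_(g : {perm 'I_b}) h (g x) =
    \sum_(y < b) \sum_(g : {perm 'I_b}) h (g y).
  by under [RHS]eq_bigr => y _ do rewrite -(E y); rewrite sumr_const card_ord mulr_natl.
rewrite exchange_big /= (eq_bigr (fun=> \sum_y h y)) => [|g _].
  by rewrite sumr_const mulr_natl.
by rewrite [RHS](reindex_inj (@perm_inj _ g)).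
Qed.

(** Given all that the symmetry leaves unchanged, the digit is uniformly distributed. *)
Lemma shift_average n m t i r (Z : config -> R) (h : 'I_b -> R) :
    (m < L)%N -> (r < M)%N -> (i < b ^ m)%N ->
    (forall g c, Z (shift n m t i r g c) = Z c) ->
  b%:R * \sum_c Z c * h (config_digit c n m t i r) = (\sum_c Z c) * \sum_y h y.
Proof.
move=> mL rM ib Zinv; set S := \sum_c _.
(* The sum is invariant under each shift, hence equal to its mean over all of them. *)
have E (g : {perm 'I_b}) : S = \sum_c Z c * h (g (config_digit c n m t i r)).
  rewrite /S (reindex_inj (@shift_inj n m t i r g)) /=.
  by apply: eq_bigr => c _; rewrite Zinv config_digit_shift.
have p0 : #|{perm 'I_b}|%:R != 0 :> R.
  by rewrite pnatr_eq0 -lt0n; apply/card_gt0P; exists 1%g.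
have T : #|{perm 'I_b}|%:R * S =
    \sum_(g : {perm 'I_b}) \sum_c Z c * h (g (config_digit c n m t i r)).
  by rewrite mulr_natl -sumr_const; apply: eq_bigr => g _; exact: E.
apply: (mulfI p0); rewrite mulrCA T.
rewrite exchange_big /= mulr_sumr mulr_suml mulr_sumr; apply: eq_bigr => c _.
by rewrite -mulr_sumr mulrCA sum_perm_apply mulrCA.
Qed.

End averages.

End configurations.

(** * Second moments of Haar functions at random nodes *)

Section node_averages.
Context (R : realType) (b s d L M : nat) (hb : (1 < b)%N) (z0 : 'I_b).
Context (src : 'I_d -> nat -> 'I_s -> nat -> nat -> 'I_b).

Notation config := (config b s d L M).
Notation digit c := (@config_digit b s d L M z0 src c).

(** The digits of a node are independent and uniform: they can be averaged out one at a time, as no two of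
them are decided by the same variable. *)
Lemma node_law (m i : 'I_d -> nat) (phi : 'I_d -> 'I_s -> 'I_M -> 'I_b -> R) :
    (forall n, (m n < L)%N) -> (forall n, (i n < b ^ m n)%N) ->
  \sum_(c : config) \prod_(n < d) \prod_(t < s) \prod_(r < M)
      phi n t r (digit c n (m n) t (i n) r) =
  #|config|%:R * \prod_(n < d) \prod_(t < s) \prod_(r < M) ((\sum_y phi n t r y) / b%:R).
Proof.
move=> mL ib; pose T := ('I_d * 'I_s * 'I_M)%type.
have H (S : seq T) : uniq S ->
    \sum_(c : config) \prod_(x <- S) phi x.1.1 x.1.2 x.2
       (digit c x.1.1 (m x.1.1) x.1.2 (i x.1.1) x.2) =
    #|config|%:R * \prod_(x <- S) ((\sum_y phi x.1.1 x.1.2 x.2 y) / b%:R).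
  elim: S => [_|[[n t] r] S IH /= /andP[xS uS]].
    rewrite [LHS](eq_bigr (fun=> 1)) => [|c _]; last by rewrite big_nil.
    by rewrite sumr_const big_nil mulr1.
  rewrite [LHS](eq_bigr (fun c => (\prod_(x <- S) phi x.1.1 x.1.2 x.2
       (digit c x.1.1 (m x.1.1) x.1.2 (i x.1.1) x.2)) *
       phi n t r (digit c n (m n) t (i n) r))) => [|c _]; last by rewrite big_cons mulrC.
  have bR : b%:R != 0 :> R by rewrite pnatr_eq0 -lt0n ltnW.
  apply: (mulfI bR); rewrite shift_average // => [|g c].
    by rewrite big_cons IH //=; field.
  rewrite big_seq [RHS]big_seq; apply: eq_bigr => -[[n' t'] r'] xS' /=.
  congr (phi _ _ _ _); apply: config_digit_shift_other.
  apply: contraNN xS => /and4P[/eqP-> /eqP-> /eqP/val_inj-> _]; exact: xS'.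
have P (F : 'I_d -> 'I_s -> 'I_M -> R) :
    \prod_(n < d) \prod_(t < s) \prod_(r < M) F n t r =
    \prod_(x : T) F x.1.1 x.1.2 x.2.
  by rewrite pair_bigA pair_bigA.
under eq_bigr => c _ do rewrite P.
by rewrite P H // /index_enum -enumT enum_uniq.
Qed.

Lemma digit_haar_ext j e k (a a' : nat -> 'I_b) :
  (forall r, (r < j)%N -> a r = a' r) -> digit_haar R j e k a = digit_haar R j e k a'.
Proof.
case: j => //= j aE; rewrite aE //; congr (_ * ((word_num _ == _)%:R * _)).
by apply/eq_in_map => r; rewrite mem_iota => /= rj; rewrite aE // ltnW.
Qed.

Lemma sum_ord_eqn (e : nat) : (e < b)%N -> \sum_(y < b) (y == e :> nat)%:R = 1 :> R.
Proof.
move=> eb; rewrite (bigD1 (Ordinal eb)) //= eqxx big1 ?addr0 // => y.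
by rewrite -val_eqE /= => /negPf ->.
Qed.

Lemma prod_first (j : nat) (f : nat -> R) (g : R) : (j < M)%N ->
  \prod_(r < M) (if (r < j)%N then f r else if r == j :> nat then g else 1) =
  (\prod_(r < j) f r) * g.
Proof.
move=> jM; rewrite (bigD1 (Ordinal jM)) //= ltnn eqxx mulrC; congr (_ * _).
rewrite (big_ord_widen M f (ltnW jM)) big_mkcond [RHS]big_mkcond /=.
by apply: eq_bigr => r _; rewrite -val_eqE /=; case: (ltngtP r j).
Qed.

(** The square of a Haar function is a product of functions of single digits.  The quantity bounded at
the end is its integral, namely 1 for level 0 and [1 - b^-1] otherwise. *)
Lemma digit_haar_sqr j e k : (e < b)%N -> (k < b ^ j.-1)%N -> (j <= M)%N ->
  exists (C : R) (phi : 'I_M -> 'I_b -> R),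
    (forall a : nat -> 'I_b, digit_haar R j e k a ^+ 2 = C * \prod_(r < M) phi r (a r)) /\
    0 <= C * \prod_(r < M) ((\sum_y phi r y) / b%:R) <= 1.
Proof.
have bR : b%:R != 0 :> R by rewrite pnatr_eq0 -lt0n ltnW.
move=> eb; case: j => [|j] /= kb jM.
  exists 1, (fun _ _ => 1); split=> [a|]; first by rewrite expr1n big1 ?mulr1.
  by rewrite mul1r big1 ?ler01 ?lexx // => r _; rewrite sumr_const card_ord divff.
have [w sw wk] := word_num_surj kb.
pose c : R := b%:R `^ ((j.+1%:R - 2) / 2).
exists (c ^+ 2), (fun r y => if (r < j)%N then (y == nth z0 w r)%:R
  else if r == j :> nat then (b%:R * (y == e :> nat)%:R - 1) ^+ 2 else 1); split=> [a|].
  rewrite (eq_bigr (fun r : 'I_M => if (r < j)%N then (a r == nth z0 w r)%:R else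
      if r == j :> nat then (b%:R * (a j == e :> nat)%:R - 1) ^+ 2 else 1)) => [|r _]; last first.
    by case: ifP => // _; case: (r =P j :> nat) => // ->.
  rewrite (@prod_first _ (fun r => (a r == nth z0 w r)%:R)) //.
  rewrite prodr_bool -/c !exprMn; congr (_ * (_ * _)).
  have -> : [forall r : 'I_j, a r == nth z0 w r] = (word_num (mkseq a j) == k).
    rewrite -wk; apply/forallP/eqP => [h|h r].
      congr word_num; apply: (@eq_from_nth _ z0); first by rewrite size_mkseq.
      by rewrite size_mkseq => r rj; rewrite nth_mkseq //; exact/eqP/(h (Ordinal rj)).
    have <- : mkseq a j = w by apply: word_num_inj; rewrite ?size_mkseq.
    by rewrite nth_mkseq.
  by case: (_ == k); rewrite ?expr1n ?expr0n.
rewrite (eq_bigr (fun r : 'I_M => if (r < j)%N then b%:R^-1 else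
    if r == j :> nat then b%:R - 1 else 1)) => [|r _]; last first.
  case: ifP => _.
    rewrite (eq_bigr (fun y : 'I_b => (y == nth z0 w r :> nat)%:R)) => [|y _ //].
    by rewrite sum_ord_eqn ?mul1r.
  case: ifP => _; last by rewrite sumr_const card_ord divff.
  have E (y : 'I_b) : (b%:R * (y == e :> nat)%:R - 1) ^+ 2 =
      (b%:R ^+ 2 - 2 * b%:R) * (y == e :> nat)%:R + 1 :> R.
    by case: (y == e :> nat) => /=; ring.
  under eq_bigr => y _ do rewrite E.
  by rewrite big_split /= -mulr_sumr sum_ord_eqn // sumr_const card_ord; field.
rewrite (@prod_first _ (fun=> b%:R^-1)) // prodr_const card_ord.
have -> : c ^+ 2 = b%:R ^+ j / b%:R.
  rewrite expr2 -powRD; last by apply/implyP.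
  have -> : (j.+1%:R - 2) / 2 + (j.+1%:R - 2) / 2 = j%:R - 1 :> R.
    by rewrite -addn1 natrD; field.
  rewrite powRD ?bR ?implybT // powR_mulrn ?ler0n //.
  by rewrite powR_inv1 ?ler0n.
have -> : b%:R ^+ j / b%:R * (b%:R^-1 ^+ j * (b%:R - 1)) = 1 - b%:R^-1 :> R.
  by rewrite exprVn; field; rewrite bR expf_neq0.
by rewrite subr_ge0 lerBlDr lerDl invr_ge0 ler0n invf_le1 ?ltr0n ?ler1n ?(ltnW hb).
Qed.

(** [q n t] is the Haar index, level, shift and position in this order, of coordinate [t] of block [n]. *)
Definition haar_at (q : 'I_d -> 'I_s -> nat * nat * nat) n t (a : nat -> 'I_b) : R :=
  digit_haar R (q n t).1.1 (q n t).1.2 (q n t).2 a.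

Definition haar_valid (q : 'I_d -> 'I_s -> nat * nat * nat) : Prop := forall n t,
  [/\ ((q n t).1.1 <= M)%N, ((q n t).1.2 < b)%N & ((q n t).2 < b ^ (q n t).1.1.-1)%N].

Lemma node_sqr (q : 'I_d -> 'I_s -> nat * nat * nat) (m i : 'I_d -> nat) :
    haar_valid q -> (forall n, (m n < L)%N) -> (forall n, (i n < b ^ m n)%N) ->
  \sum_(c : config) \prod_(n < d) \prod_(t < s)
      haar_at q n t (digit c n (m n) t (i n)) ^+ 2 <= #|config|%:R.
Proof.
move=> qV mL ib.
have /choice[C H] (x : 'I_d * 'I_s) : exists C : R * ('I_M -> 'I_b -> R),
    (forall a : nat -> 'I_b, haar_at q x.1 x.2 a ^+ 2 = C.1 * \prod_(r < M) C.2 r (a r)) /\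
    0 <= C.1 * \prod_(r < M) ((\sum_y C.2 r y) / b%:R) <= 1.
  have [qM qb qk] := qV x.1 x.2.
  by have [c [phi h]] := digit_haar_sqr qb qk qM; exists (c, phi).
under eq_bigr => c _.
  under eq_bigr => n _.
    under eq_bigr => t _ do rewrite (H (n, t)).1 /=.
    rewrite big_split /=; over.
  rewrite big_split /=; over.
rewrite -mulr_sumr (node_law (fun n t => (C (n, t)).2)) // mulrCA -[leRHS]mulr1.
rewrite ler_wpM2l // -big_split /=.
under eq_bigr => n _ do rewrite -big_split /=.
rewrite pair_bigA /=; apply: prodr_ile1 => -[n t] /=.
by move=> _; have [_] := H (n, t).
Qed.

Definition node_haar (q : 'I_d -> 'I_s -> nat * nat * nat) (m i : 'I_d -> nat)
    (c : config) : R :=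
  \prod_(n < d) \prod_(t < s) haar_at q n t (digit c n (m n) t (i n)).

Lemma node_haar_pair q m i c : node_haar q m i c =
  \prod_(x : 'I_d * 'I_s) haar_at q x.1 x.2 (digit c x.1 (m x.1) x.2 (i x.1)).
Proof. by rewrite /node_haar pair_bigA. Qed.

(** Resampling the digit of the first node that decides the finer of the two Haar functions of coordinate
[t0] leaves everything else unchanged, unless the second node shares this digit; then both nodes share the
coarser cell as well, and Haar functions of the same scale on distinct cells have disjoint supports. *)
Lemma node_haar_orth_wlog (q q' : 'I_d -> 'I_s -> nat * nat * nat)
    (m i m' i' : 'I_d -> nat) (n0 : 'I_d) (t0 : 'I_s) :
    haar_valid q -> haar_valid q' ->
    (forall n, (m n < L)%N) -> (forall n, (i n < b ^ m n)%N) ->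
    (0 < (q n0 t0).1.1)%N -> ((q' n0 t0).1.1 <= (q n0 t0).1.1)%N ->
    ((q n0 t0).1.1, (q n0 t0).2) <> ((q' n0 t0).1.1, (q' n0 t0).2) \/ m n0 <> m' n0 ->
  \sum_c node_haar q m i c * node_haar q' m' i' c = 0.
Proof.
move=> qV qV' mL ib j0 jj neq.
have [jM eb _] := qV n0 t0; pose r := (q n0 t0).1.1.-1.
have rj : r.+1 = (q n0 t0).1.1 by rewrite /r prednK.
pose share := same_key src n0 t0 (m n0) (i n0) (m' n0) (i' n0) r.
(* First the case of a shared digit, where the product of the two factors vanishes identically. *)
have [/and3P[/eqP jE kN sh]|] := boolP [&& (q' n0 t0).1.1 == (q n0 t0).1.1,
    (q' n0 t0).2 != (q n0 t0).2 & share].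
  apply: big1 => c _; rewrite !node_haar_pair -big_split /= (bigD1 (n0, t0)) //=.
  rewrite [X in X * _](_ : _ = 0) ?mul0r // /haar_at jE -rj /=.
  have -> : mkseq (digit c n0 (m' n0) t0 (i' n0)) r = mkseq (digit c n0 (m n0) t0 (i n0)) r.
    by apply/eq_in_map => r'; rewrite mem_iota => /= rr; rewrite (same_key_digit z0 c rr sh).
  case: (_ =P (q n0 t0).2) => [->|_]; last by rewrite !(mul0r, mulr0).
  by rewrite [(q n0 t0).2 == _]eq_sym (negPf kN) !(mul0r, mulr0).
rewrite 2!negb_and negbK => nshare.
have {nshare neq jj} nshare : ((q' n0 t0).1.1 < (q n0 t0).1.1)%N \/ ~~ share.
  case/or3P: nshare => [h|/eqP h|h]; last by right.
    by left; rewrite ltn_neqAle h.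
  case: neq => [neq|neq]; last by right; rewrite /share /same_key; case: eqP.
  left; rewrite ltn_neqAle jj andbT; apply/eqP => e; apply: neq; by rewrite e h.
pose C : R := b%:R `^ ((r.+1%:R - 2) / 2).
pose A c := \prod_(x : 'I_d * 'I_s | x != (n0, t0))
   haar_at q x.1 x.2 (digit c x.1 (m x.1) x.2 (i x.1)).
pose Z c := C * (word_num (mkseq (digit c n0 (m n0) t0 (i n0)) r) == (q n0 t0).2)%:R *
   A c * node_haar q' m' i' c.
pose h (y : 'I_b) : R := b%:R * (y == (q n0 t0).1.2 :> nat)%:R - 1.
rewrite (eq_bigr (fun c => Z c * h (digit c n0 (m n0) t0 (i n0) r))); last first.
  move=> c _; rewrite node_haar_pair (bigD1 (n0, t0)) //= -/(A c).
  by rewrite [haar_at q _ _ _]/haar_at -rj /= -/C /Z /h; ring.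
have bR : b%:R != 0 :> R by rewrite pnatr_eq0 -lt0n ltnW.
apply: (mulfI bR); rewrite mulr0 shift_average //; last 2 first.
- by rewrite rj.
- move=> g c; rewrite /Z; congr (C * (word_num _ == _)%:R * _ * _).
  + apply/eq_in_map => r'; rewrite mem_iota => /= rr.
    by apply: config_digit_shift_other; rewrite [r == r']gtn_eqF // !andbF.
  + apply: eq_bigr => -[n t] /= nt; apply: digit_haar_ext => r' _.
    apply: config_digit_shift_other; apply: contraNN nt.
    by case/and4P => /eqP<- /eqP<-.
  + rewrite !node_haar_pair; apply: eq_bigr => -[n t] _ /=; apply: digit_haar_ext => r' rr.
    apply: config_digit_shift_other; apply/negP => /and4P[/eqP en /eqP et /eqP er sh].
    case: nshare => [jj|/negP]; last by apply; rewrite /share; move: sh; rewrite -en.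
    by move: rr; rewrite -en -et -er -ltnS rj ltnNge jj.
rewrite /h sumrB -mulr_sumr sum_ord_eqn // sumr_const card_ord mulr1 subrr mulr0 //.
Qed.

Lemma node_haar_orth (q q' : 'I_d -> 'I_s -> nat * nat * nat)
    (m i m' i' : 'I_d -> nat) (n0 : 'I_d) (t0 : 'I_s) :
    haar_valid q -> haar_valid q' ->
    (forall n, (m n < L)%N) -> (forall n, (i n < b ^ m n)%N) ->
    (forall n, (m' n < L)%N) -> (forall n, (i' n < b ^ m' n)%N) ->
    ((q n0 t0).1.1, (q n0 t0).2) <> ((q' n0 t0).1.1, (q' n0 t0).2) \/
      m n0 <> m' n0 /\ (0 < (q n0 t0).1.1)%N ->
  \sum_c node_haar q m i c * node_haar q' m' i' c = 0.
Proof.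
move=> qV qV' mL ib mL' ib' neq.
have [jj|jj] := leqP (q' n0 t0).1.1 (q n0 t0).1.1.
  apply: (@node_haar_orth_wlog _ _ _ _ _ _ n0 t0) => //; last first.
    by case: neq => [neq|[neq _]]; [left|right].
  case: neq => [neq|[] //]; rewrite lt0n; apply/eqP => j0; apply: neq.
  move: jj; rewrite j0 leqn0 => /eqP j0'; have [_ _] := qV n0 t0; have [_ _] := qV' n0 t0.
  by rewrite j0 j0' /= !ltnS !leqn0 => /eqP-> /eqP->.
under eq_bigr => c _ do rewrite mulrC.
apply: (@node_haar_orth_wlog _ _ _ _ _ _ n0 t0) => //.
- exact: leq_ltn_trans jj.
- exact: ltnW.
- by left => -[e _]; move: jj; rewrite e ltnn.
Qed.

End node_averages.

(** * The Smolyak method on one Haar function *)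

(** Expanding a product of sums of different lengths: the indices are taken from the common type ['I_K]. *)
Lemma prod_sum_widen (R : comPzRingType) (d K : nat) (N : 'I_d -> nat) (F : 'I_d -> nat -> R) :
    (forall n, (N n <= K)%N) ->
  \prod_(n < d) \sum_(i < N n) F n i =
  \sum_(f in family (fun n (i : 'I_K) => (i < N n)%N)) \prod_(n < d) F n (f n).
Proof.
move=> NK; rewrite -(bigA_distr_big_dep _ (fun n (i : 'I_K) => F n i)).
by apply: eq_bigr => n _; rewrite (big_ord_widen K (F n) (NK n)).
Qed.

Section smolyak_haar.
Context (R : realType) (b s d L M : nat) (hb : (1 < b)%N) (hs : (0 < s)%N) (z0 : 'I_b).
Context (src : 'I_d -> nat -> 'I_s -> nat -> nat -> 'I_b).
Hypothesis src_net : forall n m, (m < L)%N ->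
  discrete_net m (fun (i : 'I_(b ^ m)) t => src n m t i).

Notation config := (config b s d L M).
Notation digit c := (@config_digit b s d L M z0 src c).

Implicit Types (q : 'I_d -> 'I_s -> nat * nat * nat) (c : config).

Definition block_sum q c (n : 'I_d) (m : nat) : R :=
  \sum_(i < b ^ m) \prod_(t < s) haar_at R q n t (digit c n m t i).

(** The value of the quadrature of level [l] in block [n] on the block factor of a tensor Haar function. *)
Definition block_mean q c (n : 'I_d) (l : nat) : R :=
  if l is m.+1 then b%:R ^- m * block_sum q c n m else 0.

Definition level q (n : 'I_d) : nat := \sum_(t < s) (q n t).1.1.

Definition smolyak_haar q c : R :=
  \sum_(l in multi_indices L d)
     \prod_(n < d) (block_mean q c n (l n) - block_mean q c n (l n).-1).

Let active q : pred 'I_d := fun n => (0 < level q n)%N.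

(** Scrambled nets are nets, for each realization of the permutations. *)
Lemma digit_net c n m : (m < L)%N ->
  discrete_net m (fun (i : 'I_(b ^ m)) t => digit c n m t i).
Proof.
move=> mL; apply: (scrambled_net (pi := fun t => config_perm c n m t)) (src_net n mL).
by move=> i t r rm; rewrite /config_digit rm.
Qed.

Lemma block_sum0 q c n m : haar_valid b M q -> (m < L)%N ->
  (0 < level q n <= m)%N -> block_sum q c n m = 0.
Proof.
move=> qV mL lm; apply: (@net_haar_sum0 R b s m _ _ hb hs (digit_net c n mL)
  (fun t => (q n t).1.1) (fun t => (q n t).1.2) (fun t => (q n t).2) _ lm).
by move=> t; have [] := qV n t.
Qed.

Lemma block_sum_sqr q c n m : haar_valid b M q -> (m < L)%N ->
  (m < level q n)%N || (m == 0)%N ->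
  block_sum q c n m ^+ 2 <= b%:R ^+ s *
    \sum_(i < b ^ m) \prod_(t < s) haar_at R q n t (digit c n m t i) ^+ 2.
Proof.
move=> qV mL lm.
under [X in _ <= _ * X]eq_bigr => i _ do rewrite prodrXl.
apply: (@net_haar_sum_sqr R b s m _ _ hb hs (digit_net c n mL)
  (fun t => (q n t).1.1) (fun t => (q n t).1.2) (fun t => (q n t).2) _ lm).
by move=> t; have [] := qV n t.
Qed.

Lemma block_mean1 q c n l : level q n = 0%N -> (0 < l)%N -> block_mean q c n l = 1.
Proof.
case: l => // m /eqP; rewrite /level sum_nat_eq0 => /forallP j0 _ /=.
rewrite /block_sum (eq_bigr (fun=> 1)) => [|i _]; last first.
  by rewrite big1 // => t _; rewrite /haar_at (eqP (implyP (j0 t) isT)).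
by rewrite sumr_const card_ord natrX mulVf // expf_neq0 // pnatr_eq0 -lt0n (ltnW hb).
Qed.

Lemma smolyak_haarE q c : smolyak_haar q c =
  \sum_(k : {ffun 'I_d -> 'I_L.+1}) smolyak_coef R (active q) k *
    \prod_(n < d) block_mean q c n (k n).
Proof.
apply: (@smolyak_coefE _ _ _ (active q) (block_mean q c)) => // n m; rewrite -eqn0Ngt => /eqP ln.
exact: block_mean1.
Qed.

Lemma block_mean_prod q c (k : {ffun 'I_d -> 'I_L.+1}) : (forall n, 0 < k n)%N ->
  \prod_(n < d) block_mean q c n (k n) =
  b%:R ^- (\sum_(n < d) (k n).-1) * \prod_(n < d) block_sum q c n (k n).-1.
Proof.
move=> k0; rewrite expr_sum -prodfV -big_split /=; apply: eq_bigr => n _.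
by move: (k0 n); case: (k n : nat).
Qed.

Lemma block_mean_prod0 q c (k : {ffun 'I_d -> 'I_L.+1}) : ~ (forall n, 0 < k n)%N ->
  \prod_(n < d) block_mean q c n (k n) = 0.
Proof.
move=> k0; have [n kn] : exists n, k n = 0%N :> nat.
  apply: contrapT => h; apply: k0 => n; rewrite lt0n; apply/eqP => kn; apply: h.
  by exists n.
by rewrite (bigD1 n) //= kn mul0r.
Qed.

Let expn_leL m : (m < L)%N -> (b ^ m <= b ^ L)%N.
Proof. by move=> mL; rewrite leq_pexp2l ?(ltnW hb) ?(ltnW mL). Qed.

Lemma block_sum_prod q c (m : 'I_d -> nat) : (forall n, (m n < L)%N) ->
  \prod_(n < d) block_sum q c n (m n) =
  \sum_(f in family (fun n (i : 'I_(b ^ L)) => (i < b ^ m n)%N))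
     node_haar R z0 src q m (fun n => f n) c.
Proof.
move=> mL; rewrite (@prod_sum_widen R d (b ^ L) (fun n => b ^ m n)%N
  (fun n i => \prod_(t < s) haar_at R q n t (digit c n (m n) t i))) //.
by move=> n; exact: expn_leL.
Qed.

Lemma block_sum_orth q q' (m m' : 'I_d -> nat) (n0 : 'I_d) (t0 : 'I_s) :
    haar_valid b M q -> haar_valid b M q' ->
    (forall n, (m n < L)%N) -> (forall n, (m' n < L)%N) ->
    ((q n0 t0).1.1, (q n0 t0).2) <> ((q' n0 t0).1.1, (q' n0 t0).2) \/
      m n0 <> m' n0 /\ (0 < (q n0 t0).1.1)%N ->
  \sum_c (\prod_(n < d) block_sum q c n (m n)) * \prod_(n < d) block_sum q' c n (m' n) = 0.
Proof.
move=> qV qV' mL mL' neq.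
under eq_bigr => c _ do rewrite !block_sum_prod // mulr_suml.
rewrite exchange_big big1 //= => f /familyP fm.
under eq_bigr => c _ do rewrite mulr_sumr.
rewrite exchange_big big1 //= => f' /familyP fm'.
exact: (node_haar_orth R hb z0 src qV qV' mL fm mL' fm' neq).
Qed.

(** The second alternative says that the two terms use nets of different levels in block [n0]; these are
randomized independently, so that the Haar functions decouple even if they are equal. *)
Lemma block_mean_orth q q' (k k' : {ffun 'I_d -> 'I_L.+1}) (n0 : 'I_d) (t0 : 'I_s) :
    haar_valid b M q -> haar_valid b M q' ->
    ((q n0 t0).1.1, (q n0 t0).2) <> ((q' n0 t0).1.1, (q' n0 t0).2) \/
      k n0 <> k' n0 /\ (0 < (q n0 t0).1.1)%N ->
  \sum_c (\prod_(n < d) block_mean q c n (k n)) * \prod_(n < d) block_mean q' c n (k' n) = 0.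
Proof.
move=> qV qV' neq; case: (pselect (forall n, 0 < k n)%N) => k0; last first.
  by rewrite big1 // => c _; rewrite (block_mean_prod0 _ _ k0) mul0r.
case: (pselect (forall n, 0 < k' n)%N) => k0'; last first.
  by rewrite big1 // => c _; rewrite (block_mean_prod0 _ _ k0') mulr0.
under eq_bigr => c _ do rewrite !block_mean_prod // mulrACA.
rewrite -mulr_sumr (@block_sum_orth _ _ (fun n => (k n).-1) (fun n => (k' n).-1) n0 t0) ?mulr0 //.
- by move=> n; rewrite prednK // -ltnS.
- by move=> n; rewrite prednK // -ltnS.
- case: neq => [|[neq j0]]; [by left|right; split => // e; apply: neq].
  apply/val_inj; have := k0 n0; have := k0' n0; move: e => /=.
  by case: (k n0 : nat) => //; case: (k' n0 : nat) => // ? ? /= ->.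
Qed.

(** In each block at most [b ^ s] nodes can see the support of the Haar function, so the square of the
sum is at most [b ^ s] times the sum of the squares; each of the latter has mean at most one, by [node_sqr]. *)
Lemma block_sum_second_moment q (m : 'I_d -> nat) :
    haar_valid b M q -> (forall n, (m n < L)%N) ->
    (forall n, (m n < level q n)%N || (m n == 0)%N) ->
  \sum_c (\prod_(n < d) block_sum q c n (m n)) ^+ 2 <=
  b%:R ^+ (s * d) * b%:R ^+ (\sum_(n < d) m n) * #|config|%:R.
Proof.
move=> qV mL lm.
pose F c n i : R := \prod_(t < s) haar_at R q n t (digit c n (m n) t i) ^+ 2.
apply: (@le_trans _ _ (\sum_c b%:R ^+ (s * d) *
    \sum_(f in family (fun n (i : 'I_(b ^ L)) => (i < b ^ m n)%N)) \prod_(n < d) F c n (f n))).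
  apply: ler_sum => c _.
  rewrite -prodrXl -(@prod_sum_widen _ _ _ (fun n => b ^ m n)%N); last first.
    by move=> n; exact: expn_leL.
  have -> : b%:R ^+ (s * d) = \prod_(n < d) b%:R ^+ s :> R.
    by rewrite prodr_const card_ord exprM.
  rewrite -big_split /=.
  by apply: ler_prod => n _; rewrite sqr_ge0 /=; exact: block_sum_sqr.
rewrite -mulr_sumr -mulrA ler_wpM2l ?exprn_ge0 // exchange_big /=.
apply: (@le_trans _ _ (\sum_(f in family (fun n (i : 'I_(b ^ L)) => (i < b ^ m n)%N)) #|config|%:R)).
  by apply: ler_sum => f /familyP fm; apply: (node_sqr R hb z0 src qV mL fm).
rewrite sumr_const card_family -[_ *+ _]mulr_natl ler_wpM2r // -natrX ler_nat.
rewrite foldrE big_map big_enum /= expn_sum; apply: leq_prod => n _.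
by rewrite -sum1_card -(big_ord_widen (b ^ L) (fun=> 1%N)) ?expn_leL // sum1_card card_ord.
Qed.

Lemma smolyak_haar_orth q q' (n0 : 'I_d) (t0 : 'I_s) :
    haar_valid b M q -> haar_valid b M q' ->
    ((q n0 t0).1.1, (q n0 t0).2) <> ((q' n0 t0).1.1, (q' n0 t0).2) ->
  \sum_c smolyak_haar q c * smolyak_haar q' c = 0.
Proof.
move=> qV qV' neq.
under eq_bigr => c _ do rewrite !smolyak_haarE mulr_suml.
rewrite exchange_big big1 //= => k _.
under eq_bigr => c _ do rewrite mulr_sumr.
rewrite exchange_big big1 //= => k' _.
under eq_bigr => c _ do rewrite mulrACA.
by rewrite -mulr_sumr (@block_mean_orth _ _ _ _ n0 t0) ?mulr0 //; left.
Qed.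

Lemma sum_active q : (\sum_(n < d | active q n) level q n = \sum_(n < d) level q n)%N.
Proof.
rewrite big_mkcond /=; apply: eq_bigr => n _; rewrite /active.
by case: ifPn => //; rewrite -eqn0Ngt => /eqP.
Qed.

Lemma active_gt0 q : (0 < \sum_(n < d) level q n)%N -> (0 < #|active q|)%N.
Proof.
move=> j0; apply/card_gt0P; apply/existsP; apply: contraTT j0 => /existsPn h.
by rewrite -eqn0Ngt big1 // => n _; have := h n; rewrite unfold_in /active -eqn0Ngt => /eqP.
Qed.

(** A term with nonzero coefficient has total level above [L] less the number of active blocks.  If the Haar
levels add up to at most [L - d], some active block is fine enough to integrate its factor exactly, and the
factor is zero. *)
Lemma smolyak_haar0 q c : haar_valid b M q ->
  (0 < \sum_(n < d) level q n)%N -> (\sum_(n < d) level q n + d <= L)%N ->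
  smolyak_haar q c = 0.
Proof.
move=> qV j0 jL; rewrite smolyak_haarE big1 // => k _.
apply/eqP; rewrite mulf_eq0; apply/orP; case: (eqVneq (smolyak_coef R (active q) k) 0) => [_|ck].
  by left.
right; case: (pselect (forall n, 0 < k n)%N) => k0; last by rewrite (block_mean_prod0 _ _ k0).
have [ku kL /(_ (active_gt0 j0)) Lk] := smolyak_coef_neq0 k0 ck.
have [n /andP[un nk]] : exists n, active q n && (level q n < k n)%N.
  apply/existsP; apply: contraTT Lk => /existsPn h; rewrite -leqNgt.
  apply: leq_trans jL; rewrite -[X in (_ <= _ + X)%N](card_ord d) -(cardC (active q)).
  rewrite addnCA [X in (_ <= X)%N]addnC leq_add2r -sum_active.
  rewrite (bigID (active q)) /= leq_add //.
    by apply: leq_sum => n un; have := h n; rewrite un -leqNgt.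
  rewrite -sum1_card (eq_bigr (fun=> 1%N)) => [|n]; first by apply: eq_leq; apply: eq_bigl.
  exact: ku.
rewrite (bigD1 n) //= mulf_eq0; apply/orP; left; case: (k n) nk => [[//|m] /= mL] nk.
by rewrite block_sum0 ?mulr0 // -/(active q n) un.
Qed.

Lemma smolyak_haar1 q c : (d <= L)%N -> (\sum_(n < d) level q n = 0)%N -> smolyak_haar q c = 1.
Proof.
move=> dL /eqP; rewrite sum_nat_eq0 => /forallP lv0.
have lv n : level q n = 0%N by exact/eqP/(implyP (lv0 n)).
have E n (l : 'I_L.+1) : (0 < l)%N ->
    block_mean q c n l - block_mean q c n l.-1 = (l == 1%N :> nat)%:R.
  case: l => [[//|[|l]] lL] _ /=; first by rewrite subr0 -[LHS]/(block_mean q c n 1) block_mean1.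
  by rewrite -[X in X - _]/(block_mean q c n l.+2) -[X in _ - X]/(block_mean q c n l.+1) !block_mean1 ?subrr.
have [d0|d0] := posnP d.
  rewrite /smolyak_haar (bigD1 [ffun=> ord0]) /=; last first.
    rewrite inE; apply/andP; split; first by apply/forallP => n; have := ltn_ord n; rewrite {2}d0.
    by rewrite big1 // => n; have := ltn_ord n; rewrite {2}d0.
  rewrite !big1 ?addr0 //; last first.
    by move=> n _; have := ltn_ord n; rewrite {2}d0.
  move=> l /andP[_ /eqP h]; exfalso; apply: h; apply/ffunP => n.
  by have := ltn_ord n; rewrite {2}d0.
have L1 : (1 < L.+1)%N by rewrite ltnS (leq_trans d0).
pose l1 : {ffun 'I_d -> 'I_L.+1} := [ffun=> Ordinal L1].
have l1Q : l1 \in multi_indices L d.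
  rewrite inE; apply/andP; split; first by apply/forallP => n; rewrite ffunE.
  by rewrite (eq_bigr (fun=> 1%N)) ?sum1_card ?card_ord // => n _; rewrite ffunE.
rewrite /smolyak_haar (bigD1 l1) //= big1 => [|n _]; last by rewrite E ffunE.
rewrite big1 ?addr0 // => l /andP[]; rewrite inE => /andP[/forallP l0 _] ll1.
have [n ln] : exists n, l n != 1%N :> nat.
  apply/existsP; apply: contraNT ll1 => /existsPn h.
  by apply/eqP/ffunP => n; apply/val_inj; rewrite ffunE /=; have := h n; rewrite negbK => /eqP.
by rewrite (bigD1 n) //= E // (negPf ln) mul0r.
Qed.

(** The terms of the combination formula are uncorrelated.  The ones that do not vanish have total level
between [L - d + 1] and [L]; there are at most [d * L.+1 ^ d.-1] of them, and each has second moment of order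
[b ^- L]. *)
Lemma smolyak_haar_sqr q : haar_valid b M q -> (0 < d <= L)%N ->
  (L < \sum_(n < d) level q n + d)%N ->
  \sum_c smolyak_haar q c ^+ 2 <=
  #|config|%:R * (d%:R * L.+1%:R ^+ d.-1 * (4 ^+ d * b%:R ^+ (s * d + d.*2)) / b%:R ^+ L).
Proof.
move=> qV /andP[d0 dL] Lj.
have j0 : (0 < \sum_(n < d) level q n)%N by rewrite -(ltn_add2r d); apply: leq_ltn_trans Lj.
pose T (k : {ffun 'I_d -> 'I_L.+1}) c := \prod_(n < d) block_mean q c n (k n).
pose C := smolyak_coef R (L := L) (active q).
pose K : R := 4 ^+ d * b%:R ^+ (s * d + d.*2) / b%:R ^+ L * #|config|%:R.
have K0 : 0 <= K by rewrite !mulr_ge0 ?exprn_ge0 ?invr_ge0 ?exprn_ge0.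
have -> : \sum_c smolyak_haar q c ^+ 2 = \sum_k C k ^+ 2 * \sum_c T k c ^+ 2.
  under eq_bigr => c _ do rewrite smolyak_haarE expr2 mulr_suml.
  rewrite exchange_big /=; apply: eq_bigr => k _; rewrite mulr_sumr.
  under eq_bigr => c _ do rewrite mulr_sumr.
  rewrite exchange_big /= (bigD1 k) //= [X in _ + X]big1 ?addr0 => [|k' kk'].
    by apply: eq_bigr => c _; rewrite -/(C k) -/(T k c); ring.
  under eq_bigr => c _ do rewrite mulrACA.
  rewrite -mulr_sumr -/(C k) -/(C k').
  have [->|ck] := eqVneq (C k) 0; first by rewrite !mul0r.
  have [->|ck'] := eqVneq (C k') 0; first by rewrite mulr0 mul0r.
  case: (pselect (forall n, 0 < k n)%N) => k0; last first.
    by rewrite big1 ?mulr0 // => c _; rewrite (block_mean_prod0 _ _ k0) mul0r.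
  case: (pselect (forall n, 0 < k' n)%N) => k0'; last first.
    by rewrite big1 ?mulr0 // => c _; rewrite (block_mean_prod0 _ _ k0') mulr0.
  have [ku _ _] := smolyak_coef_neq0 k0 ck.
  have [ku' _ _] := smolyak_coef_neq0 k0' ck'.
  have [n kn] : exists n, k n != k' n.
    apply/existsP; apply: contraNT kk' => /existsPn h; apply/eqP/ffunP => n.
    by have := h n; rewrite negbK => /eqP.
  have un : active q n.
    by apply: contraNT kn => un; rewrite -val_eqE /= ku // ku'.
  have [t t0] : exists t, (0 < (q n t).1.1)%N.
    apply/existsP; apply: contraTT un => /existsPn h.
    by rewrite /active -eqn0Ngt /level big1 // => t _; apply/eqP; rewrite eqn0Ngt.
  rewrite (@block_mean_orth _ _ _ _ n t) ?mulr0 //; right; split=> //.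
  exact/eqP.
pose top : {pred {ffun 'I_d -> 'I_L.+1}} :=
  mem [set l in multi_indices L d | (L < \sum_(n < d) l n + d)%N]%SET.
apply: (@le_trans _ _ (\sum_(k in top) K)); last first.
  rewrite sumr_const -[_ *+ _]mulr_natl.
  apply: (@le_trans _ _ ((d * L.+1 ^ d.-1)%N%:R * K)).
    by rewrite ler_wpM2r // ler_nat; exact: card_top_indices.
  rewrite natrM natrX /K le_eqVlt; apply/orP; left; apply/eqP.
  by move: (4 ^+ d) (b%:R ^- L) (b%:R ^+ (s * d + d.*2)) (L.+1%:R ^+ d.-1) => x y z t; ring.
rewrite [leRHS]big_mkcond /=; apply: ler_sum => k _.
have Z : C k ^+ 2 * \sum_c T k c ^+ 2 = 0 \/ (k \in top /\ \sum_c T k c ^+ 2 <=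
    b%:R ^+ (s * d + d.*2) / b%:R ^+ L * #|config|%:R).
  have [->|ck] := eqVneq (C k) 0; first by left; rewrite expr0n mul0r.
  case: (pselect (forall n, 0 < k n)%N) => k0; last first.
    by left; rewrite big1 ?mulr0 // => c _; rewrite /T (block_mean_prod0 _ _ k0) expr0n.
  have [ku kL /(_ (active_gt0 j0)) Lk] := smolyak_coef_neq0 k0 ck.
  have mL n : ((k n).-1 < L)%N by rewrite prednK // -ltnS.
  have [/existsP[n /andP[un kn]]|/existsPn h] :=
      boolP [exists n, active q n && (level q n <= (k n).-1)%N].
    left; rewrite big1 ?mulr0 // => c _; rewrite /T block_mean_prod // [X in _ * X](bigD1 n) //=.
    by rewrite (block_sum0 c qV (mL n)) ?mul0r ?mulr0 ?expr0n // -/(active q n) un.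
  right; have Lk' : (L < \sum_(n < d) k n + d)%N.
    by apply: leq_trans Lk _; rewrite leq_add2l -[leqRHS](card_ord d) max_card.
  split.
    rewrite inE; apply/andP; split=> //; rewrite inE kL andbT.
    by apply/forallP.
  pose S := (\sum_(n < d) (k n).-1)%N.
  have SE : (\sum_(n < d) k n = S + d)%N.
    rewrite -[X in (_ + X)%N](card_ord d) -sum1_card -big_split /=.
    by apply: eq_bigr => n _; rewrite addn1 prednK.
  under eq_bigr => c _ do rewrite /T block_mean_prod // exprMn.
  rewrite -mulr_sumr.
  apply: (@le_trans _ _ ((b%:R ^- S) ^+ 2 * (b%:R ^+ (s * d) * b%:R ^+ S * #|config|%:R))).
    rewrite ler_wpM2l ?sqr_ge0 // -/S.
    apply: (@block_sum_second_moment q (fun n => (k n).-1)) => // n.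
    have := h n; rewrite negb_and /active -eqn0Ngt -ltnNge => /orP[/eqP l0|->//].
    by rewrite ku ?eqxx ?orbT // /active l0.
  have bS i : b%:R ^+ i != 0 :> R by rewrite expf_neq0 // pnatr_eq0 -lt0n (ltnW hb).
  rewrite !mulrA ler_wpM2r //.
  have -> : (b%:R ^- S) ^+ 2 * b%:R ^+ (s * d) * b%:R ^+ S = b%:R ^+ (s * d) / b%:R ^+ S :> R.
    by field.
  rewrite exprD -mulrA ler_wpM2l ?exprn_ge0 // ler_pdivlMr ?exprn_gt0 ?ltr0n ?(ltnW hb) //.
  rewrite mulrC ler_pdivrMr ?exprn_gt0 ?ltr0n ?(ltnW hb) // -exprD.
  by rewrite ler_weXn2l ?ler1n ?(ltnW hb) //; lia.
case: Z => [->|[kt le]]; first by case: ifP.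
rewrite kt /K -!mulrA mulrA; apply: ler_pM => //; rewrite ?sqr_ge0 //.
- by apply: sumr_ge0 => c _; exact: sqr_ge0.
- have -> : 4 ^+ d = (2 ^+ d) ^+ 2 :> R by rewrite -!natrX -expnM mulnC expnM.
  rewrite -expr2 -real_normK ?num_real //.
  by rewrite lerXn2r ?nnegrE ?exprn_ge0 //; exact: smolyak_coef_bound.
- by rewrite mulrA.
Qed.

End smolyak_haar.

(** * Variance of the method on a finite Haar expansion *)

(** Each [A g] is correlated with at most [N] others; the mixed terms are bounded by the arithmetic-geometric
mean inequality. *)
Lemma almost_orthogonal_sum (R : realFieldType) (G C : finType) (S : pred G)
    (e : rel G) (A : G -> C -> R) (K : R) (N : nat) (x : G -> R) :
    symmetric e -> 0 <= K ->
    (forall g g', S g -> S g' -> ~~ e g g' -> \sum_c A g c * A g' c = 0) ->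
    (forall g, S g -> \sum_c A g c ^+ 2 <= K) ->
    (forall g, #|[pred g' | e g g']| <= N)%N ->
  \sum_c (\sum_(g | S g) x g * A g c) ^+ 2 <= K * N%:R * \sum_(g | S g) x g ^+ 2.
Proof.
move=> esym K0 orth AK eN.
pose B g g' := \sum_c (x g * A g c) * (x g' * A g' c).
have -> : \sum_c (\sum_(g | S g) x g * A g c) ^+ 2 = \sum_(g | S g) \sum_(g' | S g') B g g'.
  under eq_bigr => c _ do rewrite expr2 mulr_suml.
  rewrite exchange_big /=; apply: eq_bigr => g _.
  under eq_bigr => c _ do rewrite mulr_sumr.
  by rewrite exchange_big.
have xK g : S g -> \sum_c (x g * A g c) ^+ 2 <= x g ^+ 2 * K.
  move=> Sg; under eq_bigr => c _ do rewrite exprMn.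
  by rewrite -mulr_sumr ler_wpM2l ?sqr_ge0 ?AK.
have BK g g' : S g -> S g' -> B g g' <= (e g g')%:R * (K / 2 * (x g ^+ 2 + x g' ^+ 2)).
  move=> Sg Sg'; case: (boolP (e g g')) => [_|gg']; last first.
    rewrite mul0r /B; under eq_bigr => c _ do rewrite mulrACA.
    by rewrite -mulr_sumr orth // mulr0.
  have h : \sum_c (x g * A g c - x g' * A g' c) ^+ 2 =
      \sum_c (x g * A g c) ^+ 2 + \sum_c (x g' * A g' c) ^+ 2 - 2 * B g g'.
    rewrite mulr_sumr -big_split -sumrB /=; apply: eq_bigr => c _; ring.
  have h0 : 0 <= \sum_c (x g * A g c - x g' * A g' c) ^+ 2.
    by apply: sumr_ge0 => c _; exact: sqr_ge0.
  have := xK _ Sg; have := xK _ Sg'; rewrite mul1r; lra.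
apply: (@le_trans _ _ (\sum_(g | S g) \sum_(g' | S g')
    (e g g')%:R * (K / 2 * (x g ^+ 2 + x g' ^+ 2)))).
  by apply: ler_sum => g Sg; apply: ler_sum => g' Sg'; exact: BK.
pose W := \sum_(g | S g) \sum_(g' | S g') (e g g')%:R * (K / 2 * x g ^+ 2).
have -> : \sum_(g | S g) \sum_(g' | S g') (e g g')%:R * (K / 2 * (x g ^+ 2 + x g' ^+ 2)) = W + W.
  rewrite {2}/W [X in _ = _ + X]exchange_big /= -big_split /=; apply: eq_bigr => g _.
  by rewrite -big_split /=; apply: eq_bigr => g' _; rewrite (esym g'); ring.
have WN : W <= K / 2 * N%:R * \sum_(g | S g) x g ^+ 2.
  rewrite mulr_sumr; apply: ler_sum => g _.
  rewrite -mulr_suml mulrC mulrAC ler_wpM2r ?sqr_ge0 // ler_wpM2l ?divr_ge0 //.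
  apply: le_trans (_ : #|[pred g' | e g g']|%:R <= _); last by rewrite ler_nat.
  rewrite -sum1_card natr_sum [leRHS]big_mkcond [leLHS]big_mkcond /=; apply: ler_sum => g' _.
  by rewrite inE; case: (S g'); case: (e g g').
by apply: le_trans (lerD WN WN) _; rewrite -2!mulrDl -splitr.
Qed.

Section finite_haar_indices.
Context (b D M : nat).

(** Triples of level, shift and position of univariate Haar functions of level at most [M].  The ranges of
shift and position depend on the level; [cell_index_ok] imposes them, so as to keep a nondependent finite
type. *)
Definition haar_cell_index : finType := ('I_M.+1 * 'I_b * 'I_(b ^ M))%type.

Definition finite_index : finType := {ffun 'I_D -> haar_cell_index}.

Definition cell_index_ok (x : haar_cell_index) : bool :=
  (x.1.2 < if x.1.1 == 0%N :> nat then 1 else b)%N && (x.2 < b ^ x.1.1.-1)%N.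

Definition finite_index_ok (g : finite_index) : bool := [forall t, cell_index_ok (g t)].

Definition index_level (g : finite_index) : nat := \sum_(t < D) (g t).1.1.

(** Indices that differ in the shifts only.  The method need not decorrelate the corresponding Haar
functions, which have the same support and are not even orthogonal to each other. *)
Definition same_cell (g g' : finite_index) : bool :=
  [forall t, ((g t).1.1 == (g' t).1.1) && ((g t).2 == (g' t).2)].

Lemma card_same_cell g : (#|[pred g' | same_cell g g']| <= b ^ D)%N.
Proof.
pose F (g' : finite_index) : {ffun 'I_D -> 'I_b} := [ffun t => (g' t).1.2].
have Finj : {in [pred g' | same_cell g g'] &, injective F}.
  move=> g1 g2 /forallP h1 /forallP h2 /ffunP e; apply/ffunP => t.
  have := e t; rewrite !ffunE; move: (h1 t) (h2 t).
  case: (g1 t) (g2 t) => [[j1 i1] k1] [[j2 i2] k2] /=.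
  by move=> /andP[/eqP<- /eqP<-] /andP[/eqP<- /eqP<-] ->.
rewrite -(card_in_imset Finj); apply: leq_trans (max_card _) _.
by rewrite card_ffun !card_ord.
Qed.

Lemma same_cell_sym : symmetric same_cell.
Proof. by move=> g g'; apply: eq_forallb => t; rewrite eq_sym [X in _ && X]eq_sym. Qed.

End finite_haar_indices.

Lemma big_mxvec_index (R : Type) (idx : R) (op : Monoid.com_law idx) (d s : nat)
    (F : 'I_(d * s) -> R) :
  \big[op/idx]_(q < d * s) F q =
  \big[op/idx]_(n < d) \big[op/idx]_(t < s) F (mxvec_index n t).
Proof.
rewrite pair_bigA (reindex _ (curry_mxvec_bij d s)) /=.
by apply: eq_bigr => -[n t] _.
Qed.

Section discrete_variance.
Context (R : realType) (b s d L M : nat) (hb : (1 < b)%N) (hs : (0 < s)%N) (z0 : 'I_b).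
Context (src : 'I_d -> nat -> 'I_s -> nat -> nat -> 'I_b).
Hypothesis src_net : forall n m, (m < L)%N ->
  discrete_net m (fun (i : 'I_(b ^ m)) t => src n m t i).
Hypothesis dL : (0 < d <= L)%N.

Notation config := (config b s d L M).
Notation index := (finite_index b (d * s) M).

Definition block_index (g : index) (n : 'I_d) (t : 'I_s) : nat * nat * nat :=
  let x := g (mxvec_index n t) in (nat_of_ord x.1.1, nat_of_ord x.1.2, nat_of_ord x.2).

Definition variance_factor : R :=
  d%:R * L.+1%:R ^+ d.-1 * (4 ^+ d * b%:R ^+ (s * d + d.*2)) / b%:R ^+ L.

Lemma index_level_block g :
  index_level g = (\sum_(n < d) level (block_index g) n)%N.
Proof. by rewrite /index_level big_mxvec_index. Qed.

Lemma block_index_valid g : finite_index_ok g -> haar_valid b M (block_index g).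
Proof.
move=> /forallP ok n t; have /andP[] := ok (mxvec_index n t); rewrite /block_index /=.
by move=> _ h2; split=> //; rewrite -ltnS.
Qed.

(** Coarse frequencies are integrated exactly, and the others are almost orthogonal. *)
Lemma discrete_variance (x : index -> R) (x0 : R) :
    (forall g, finite_index_ok g -> index_level g = 0%N -> x g = x0) ->
  \sum_(c : config) (\sum_(g | finite_index_ok g)
      x g * smolyak_haar R z0 src (block_index g) c - x0) ^+ 2 <=
  #|config|%:R * variance_factor * b%:R ^+ (d * s) *
    \sum_(g | finite_index_ok g && (L < index_level g + d)%N) x g ^+ 2.
Proof.
move=> x0E; have /andP[d0 dL'] := dL.
pose S (g : index) := finite_index_ok g && (L < index_level g + d)%N.
have -> : \sum_(c : config) (\sum_(g | finite_index_ok g)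
      x g * smolyak_haar R z0 src (block_index g) c - x0) ^+ 2 =
    \sum_(c : config) (\sum_(g | S g) x g * smolyak_haar R z0 src (block_index g) c) ^+ 2.
  apply: eq_bigr => c _; congr (_ ^+ 2).
  have b0 : (0 < b)%N := ltnW hb.
  have bM0 : (0 < b ^ M)%N by rewrite expn_gt0 b0.
  (* The only index of level 0; its Haar function is the constant 1, which the method integrates exactly. *)
  pose g0 : index := [ffun=> (ord0, Ordinal b0, Ordinal bM0)].
  have g0ok : finite_index_ok g0.
    by apply/forallP => t; rewrite ffunE /cell_index_ok /= expn_gt0 b0.
  have g0l : index_level g0 = 0%N by rewrite /index_level big1 // => t _; rewrite ffunE.
  rewrite (bigD1 g0) //= (smolyak_haar1 R hb) //; last by rewrite -index_level_block.
  rewrite mulr1 (x0E _ g0ok g0l) addrAC subrr add0r.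
  rewrite big_mkcond [RHS]big_mkcond /=; apply: eq_bigr => g _; rewrite /S.
  case: (boolP (finite_index_ok g)) => //= gok.
  have [Lg|gL] := ltnP L (index_level g + d).
    case: eqP => // gg0; move: Lg; rewrite gg0 g0l; lia.
  case: (posnP (index_level g)) => [gl|gl]; last first.
    rewrite (smolyak_haar0 R hb hs z0 src_net) ?mulr0 ?if_same -?index_level_block //.
    exact: block_index_valid.
  case: eqP => //= gg0; exfalso; apply: gg0; apply/ffunP => t; rewrite ffunE.
  have := forallP gok t; rewrite /cell_index_ok.
  have /eqP : (g t).1.1 = 0%N :> nat.
    by move/eqP: gl; rewrite sum_nat_eq0 => /forallP/(_ t)/implyP/(_ isT)/eqP.
  case: (g t) => [[j i] k] /= /eqP j0; rewrite j0 /= !ltnS !leqn0 => /andP[/eqP i0 /eqP k0].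
  by congr (_, _, _); apply/val_inj.
rewrite -/S; set K := #|config|%:R * variance_factor.
rewrite -natrX; apply: (almost_orthogonal_sum (e := @same_cell b (d * s) M)).
- exact: same_cell_sym.
- by rewrite !mulr_ge0 ?invr_ge0 ?exprn_ge0.
- move=> g g' /andP[gok _] /andP[gok' _] /forallPn[t]; rewrite negb_and => neq.
  case/mxvec_indexP: t neq => n t neq.
  apply: (@smolyak_haar_orth R b s d L M hb z0 src _ _ n t); try exact: block_index_valid.
  by rewrite /block_index /= => -[/val_inj e1 /val_inj e2]; move: neq; rewrite e1 e2 !eqxx.
- move=> g /andP[gok gl]; apply: (smolyak_haar_sqr R hb hs z0 src_net) => //.
    exact: block_index_valid.
  by rewrite -index_level_block.
- exact: card_same_cell.
Qed.

End discrete_variance.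

(** * Configurations as equally likely events *)

Section config_law.
Context (R : realType) (dd : measure_display) (Omega : measurableType dd)
  (P : probability Omega R) (d s b : nat) (hb : (1 < b)%N) (z0 : 'I_b).
Context (perms : perm_family d s b Omega) (noise : noise_family R d s Omega).
Hypothesis hrand : independent_scrambling P perms noise.
Context (L M : nat).

Notation config := (config b s d L M).

(** The numbers of [[0, 1)] whose first [N] digits are those of [a]. *)
Definition digit_cell (N : nat) (a : nat -> 'I_b) : set R :=
  `[(word_num (mkseq a N))%:R / b%:R ^+ N, (word_num (mkseq a N)).+1%:R / b%:R ^+ N[.

Let B0 n : 0 < b%:R ^+ n :> R. Proof. by rewrite exprn_gt0 // ltr0n ltnW. Qed.

Lemma mem_digit_cell N a x : digit_cell N a x <->
  (word_num (mkseq a N))%:R <= b%:R ^+ N * x < (word_num (mkseq a N)).+1%:R.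
Proof.
by rewrite /digit_cell /= in_itv /= ler_pdivrMr // ltr_pdivlMr // mulrC.
Qed.

Lemma digit_cell_itv N a x : digit_cell N a x -> 0 <= x < 1.
Proof.
move=> /mem_digit_cell /andP[h1 h2]; apply/andP; split.
  by rewrite -(pmulr_rge0 _ (B0 N)); apply: le_trans h1.
rewrite -(ltr_pM2l (B0 N)) mulr1; apply: lt_le_trans h2 _.
by rewrite -natrX ler_nat -[X in (b ^ X)%N](size_mkseq a N) word_num_lt.
Qed.

Lemma digit_cellE N a x : 0 <= x < 1 ->
  digit_cell N a x <-> mkseq (digits hb x) N = mkseq a N.
Proof.
move=> x01; have /andP[x0 x1] := x01; rewrite mem_digit_cell.
have p0 : 0 <= b%:R ^+ N * x by rewrite mulr_ge0 // ltW.
rewrite -truncn_eq // truncn_digits //; split => [/eqP h|-> //].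
by apply: word_num_inj; rewrite ?size_mkseq.
Qed.

Lemma digit_cell_digits N a x r : digit_cell N a x -> (r < N)%N -> digits hb x r = a r.
Proof.
move=> ax rN; have x01 := digit_cell_itv ax; move/(digit_cellE _ _ x01) : ax => e.
by have := congr1 (nth z0 ^~ r) e; rewrite /= !nth_mkseq.
Qed.

Lemma measurable_digit_cell N a : measurable (digit_cell N a).
Proof. exact: measurable_itv. Qed.

Lemma lebesgue_digit_cell N a : lebesgue_measure (digit_cell N a) = (b%:R ^- N)%:E.
Proof.
rewrite lebesgue_measure_itv /= lte_fin ltr_pM2r ?invr_gt0 // ltr_nat ltnSn.
by rewrite -EFinD -mulrBl -natrB // subSnn mul1r.
Qed.

Lemma uniform_digit_cell N a : uniform_prob (@ltr01 R) (digit_cell N a) = (b%:R ^- N)%:E.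
Proof.
rewrite /uniform_prob (eq_integral (cst 1%E)); last first.
  move=> x /set_mem /digit_cell_itv /andP[x0 x1].
  by rewrite /uniform_pdf x0 (ltW x1) subr0 invr1.
rewrite integral_cst; last exact: measurable_digit_cell.
by rewrite mul1e; exact: lebesgue_digit_cell.
Qed.

Definition config_constraint (c : config) (q : rand_index d s b) : set Omega :=
  match q with
  | inl (n, m, t, w) => perms n m t w @^-1` [set config_perm c n m t w]
  | inr (n, m, t, i) => noise n m t i @^-1` digit_cell M (config_noise z0 c n m t i)
  end.

Definition used_keys : seq (rand_index d s b) :=
  [seq inl k | k <- perm_keys b s d L] ++ [seq inr k | k <- noise_keys b s d L].

Definition config_event (c : config) : set Omega :=
  \bigcap_(q in [set` used_keys]) config_constraint c q.

Lemma used_keys_uniq : uniq used_keys.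
Proof.
have il : injective (inl : _ -> rand_index d s b) by move=> x y [].
have ir : injective (inr : _ -> rand_index d s b) by move=> x y [].
rewrite cat_uniq (map_inj_uniq il) (map_inj_uniq ir) perm_keys_uniq noise_keys_uniq.
by rewrite andbT /=; apply/hasPn => _ /mapP[k _ ->]; apply/mapP => -[].
Qed.

Lemma used_keysP q : q \in used_keys -> @used_index d s b q.
Proof.
rewrite mem_cat => /orP[] /mapP[[[[n m] t] w] h ->] /=.
  by move: h; rewrite mem_perm_keys => /andP[].
by move: h; rewrite mem_noise_keys ?(ltnW hb) // => /andP[].
Qed.

Lemma measurable_constraint c q : q \in used_keys -> measurable (config_constraint c q).
Proof.
have [hp hn _] := hrand; move=> /used_keysP; case: q => [[[[n m] t] w]|[[[n m] t] i]] /= h.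
  by have [] := hp n m t w h (config_perm c n m t w).
have [mf _] := hn n m t i h; rewrite -[X in measurable X]setTI; apply: mf => //.
exact: measurable_digit_cell.
Qed.

Lemma measurable_config_event c : measurable (config_event c).
Proof. by apply: fin_bigcap_measurable => // q; exact: measurable_constraint. Qed.

Lemma card_config : #|config| =
  (b`! ^ size (perm_keys b s d L) * (b ^ M) ^ size (noise_keys b s d L))%N.
Proof.
rewrite card_prod !card_ffun !card_ord !card_seq_sub ?perm_keys_uniq ?noise_keys_uniq //.
congr (_ ^ _ * _)%N.
have := card_perm [set: 'I_b]%SET; rewrite cardsT card_ord => <-.
by apply: eq_card => g; rewrite inE; apply/esym/fintype.subsetP => x _; rewrite inE.
Qed.

Lemma config_event_prob c : P (config_event c) = (#|config|%:R^-1)%:E.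
Proof.
have [hp hn hI] := hrand.
rewrite /config_event hI ?used_keys_uniq //; last first.
  move=> q qK; split; first exact: used_keysP.
  case: q {qK} => [[[[n m] t] w]|[[[n m] t] i]] /=.
    by exists [set config_perm c n m t w].
  by exists (digit_cell M (config_noise z0 c n m t i)) => //; exact: measurable_digit_cell.
rewrite big_cat /= big_map [X in (_ * X)%E]big_map big_seq [X in (_ * X)%E]big_seq.
rewrite (eq_bigr (fun=> (b`!%:R^-1)%:E)) => [|[[[n m] t] w]]; last first.
  rewrite mem_perm_keys => /andP[_ h].
  by have [_ h'] := hp n m t w h (config_perm c n m t w); exact: h'.
rewrite [X in (_ * X)%E](eq_bigr (fun=> (b%:R ^- M)%:E)) => [|[[[n m] t] i]]; last first.
  rewrite mem_noise_keys ?(ltnW hb) // => /andP[_ h].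
  have [_ h'] := hn n m t i h.
  by rewrite [LHS]h' ?uniform_digit_cell //; exact: measurable_digit_cell.
rewrite -!big_seq !prodEFin -EFinM card_config natrM invfM !natrX.
by rewrite !big_const_seq !count_predT !iter_mulr_1 !exprVn.
Qed.

Lemma config_event_perm c n m t u w : config_event c w -> (m < L)%N -> (size u < m)%N ->
  perms n m t u w = config_perm c n m t u.
Proof.
move=> cw mL um; apply: (cw (inl (n, m, t, u))).
by rewrite /= mem_cat map_f // mem_perm_keys mL.
Qed.

Lemma config_event_noise c n m t i w : config_event c w -> (m < L)%N -> (i < b ^ m)%N ->
  digit_cell M (config_noise z0 c n m t i) (noise n m t i w).
Proof.
move=> cw mL ib; apply: (cw (inr (n, m, t, i))).
by rewrite /= mem_cat orbC map_f // mem_noise_keys ?mL // ltnW.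
Qed.

Lemma config_event_inj c c' w : config_event c w -> config_event c' w -> c = c'.
Proof.
move=> cw cw'; case: c c' cw cw' => [c1 c2] [c1' c2'] cw cw'; congr (_, _); apply/ffunP => k.
  case: k => -[[[n m] t] u] h; have := h; rewrite mem_perm_keys => /andP[mL um].
  have := config_event_perm n t cw mL um; rewrite (config_event_perm n t cw' mL um).
  by rewrite /config_perm insubT /= => ->.
apply/ffunP => r; case: k => -[[[n m] t] i] h.
have := h; rewrite mem_noise_keys ?(ltnW hb) // => /andP[mL ib].
have := digit_cell_digits (config_event_noise n t cw mL ib) (ltn_ord r).
rewrite (digit_cell_digits (config_event_noise n t cw' mL ib) (ltn_ord r)).
by rewrite /config_noise insubT valK => ->.
Qed.

Lemma trivIset_config_event (D : set config) : trivIset D config_event.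
Proof.
apply/trivIsetP => c c' _ _ /eqP cc'; rewrite -subset0 => w [cw c'w].
by apply: cc'; exact: config_event_inj cw c'w.
Qed.

Lemma config_event_cover : P (\big[setU/set0]_(c : config) config_event c) = 1%E.
Proof.
have c0 : #|config|%:R != 0 :> R.
  by rewrite card_config pnatr_eq0 -lt0n muln_gt0 !expn_gt0 fact_gt0 ltnW.
rewrite -[LHS]mul1e -integral_cst; last by apply: bigsetU_measurable => c _; exact: measurable_config_event.
rewrite ge0_integral_bigsetU; last 5 first.
- exact: measurable_config_event.
- by rewrite /index_enum -enumT enum_uniq.
- exact: trivIset_config_event.
- exact: measurable_cst.
- by move=> w _; rewrite /cst lee_fin.
rewrite (eq_bigr (fun=> (#|config|%:R^-1)%:E)) => [|c _]; last first.
  rewrite integral_cst; last exact: measurable_config_event.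
  by rewrite mul1e; exact: config_event_prob.
by rewrite sumEFin sumr_const -[_ *+ _]mulr_natl divff.
Qed.

(** The configuration events are disjoint, and by independence equally likely; there are as many of them as
configurations, so they cover the probability space up to a null set. *)
Lemma integral_config (f : Omega -> \bar R) (F : config -> R) :
    measurable_fun setT f -> (forall w, (0 <= f w)%E) ->
    (forall c w, config_event c w -> f w = (F c)%:E) ->
  (\int[P]_w f w = (#|config|%:R^-1 * \sum_c F c)%:E)%E.
Proof.
move=> mf f0 fF; pose U := \big[setU/set0]_(c : config) config_event c.
have mU : measurable U by apply: bigsetU_measurable => c _; exact: measurable_config_event.
have PU : P (~` U) = 0%E by rewrite probability_setC // config_event_cover subee.
rewrite (ge0_negligible_integral (measurableC mU) _ _ _ PU) //.
rewrite setDE setCK setTI ge0_integral_bigsetU; last 5 first.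
- exact: measurable_config_event.
- by rewrite /index_enum -enumT enum_uniq.
- exact: trivIset_config_event.
- exact: measurable_funS mf.
- by move=> w _; exact: f0.
rewrite mulr_sumr -sumEFin; apply: eq_bigr => c _.
rewrite (eq_integral (cst (F c)%:E)) => [|w /set_mem cw]; last exact: fF.
rewrite integral_cst; last exact: measurable_config_event.
by rewrite [X in (_ * X)%E]config_event_prob muleC -EFinM.
Qed.

End config_law.

(** * The nodes of tensor products of scrambled nets *)

Section scrambled_nodes.
Context (R : realType) (dd : measure_display) (Omega : measurableType dd)
  (P : probability Omega R) (d s b : nat) (hb : (1 < b)%N) (z0 : 'I_b).
Context (perms : perm_family d s b Omega) (noise : noise_family R d s Omega).
Context (p : 'I_d -> forall m : nat, 'I_(b ^ m) -> s.-tuple R).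
Arguments p : clear implicits.
Hypotheses (hp_inj : forall n m, injective (p n m))
  (hp_net : forall n m, is_net b m (range (p n m))).

Definition source_digit (n : 'I_d) (m : nat) (t : 'I_s) (i r : nat) : 'I_b :=
  if insub i is Some i' then digits hb (tnth (p n m i') t) r else z0.

Lemma source_digitE n m t (i : 'I_(b ^ m)) :
  source_digit n m t i = digits hb (tnth (p n m i) t).
Proof. by apply/funext => r; rewrite /source_digit valK. Qed.

Lemma lebesgue_box_digit_cell (D : nat) (N : 'I_D -> nat) (a : 'I_D -> nat -> 'I_b) :
  lebesgue_tuple R D [set x | forall t, digit_cell (N t) (a t) (tnth x t)] =
  (b%:R ^- (\sum_(t < D) N t))%:E.
Proof.
rewrite (@lebesgue_tuple_box R D (fun t => digit_cell (N t) (a t))) => [|t]; last first.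
  exact: measurable_digit_cell.
rewrite (eq_bigr (fun t => (b%:R ^- N t)%:E)) => [|t _]; last exact: lebesgue_digit_cell.
by rewrite prodEFin prodfV expr_sum.
Qed.

(** Elementary intervals are the sets of points with given digit prefixes in the coordinates. *)
Lemma source_net n m : discrete_net m (fun (i : 'I_(b ^ m)) t => source_digit n m t i).
Proof.
move=> w wm; have [_ cube net] := hp_net n m.
pose j t := size (w t); pose k t := word_num (w t).
have wE t : mkseq (nth z0 (w t)) (j t) = w t by rewrite mkseq_nth.
have EI : elementary_interval b j k =
    [set x : s.-tuple R | forall t, digit_cell (j t) (nth z0 (w t)) (tnth x t)].
  by apply/seteqP; split => x /= h t; have := h t; rewrite /digit_cell wE /= in_itv.
have vol : lebesgue_tuple R s (elementary_interval b j k) = (b%:R ^- m)%:E.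
  by rewrite EI lebesgue_box_digit_cell wm.
have [x [[[i0 _ p0] xE] xU]] := net j k (fun t => word_num_lt (w t)) vol.
have cellP i : in_cell (fun (i : 'I_(b ^ m)) t => source_digit n m t i) w i <->
    elementary_interval b j k (p n m i).
  rewrite EI; split=> [/forallP h t|h].
    apply/(digit_cellE hb); first by apply: cube; exists i.
    by rewrite wE; have /eqP := h t; rewrite source_digitE.
  apply/forallP => t; rewrite source_digitE -[X in _ == X]wE; apply/eqP/(digit_cellE hb).
    by apply: cube; exists i.
  exact: h.
rewrite -(card1 i0); apply: eq_card => i; apply/idP/idP.
  move=> /cellP h; rewrite inE; apply/eqP/(@hp_inj n m).
  by rewrite p0; apply/esym/xU; split => //; exists i.
by rewrite inE => /eqP ->; apply/cellP; rewrite p0.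
Qed.

Definition block_node (n : 'I_d) (m : nat) (i : 'I_(b ^ m)) (w : Omega) : s.-tuple R :=
  scrambled_point hb m (fun t u => perms n m t u w) (fun t => noise n m t i w) (p n m i).

Section on_config_event.
Context (L M : nat).

Lemma block_node_itv (c : config b s d L M) w n m (i : 'I_(b ^ m)) t :
  config_event z0 perms noise c w -> (m < L)%N -> 0 <= tnth (block_node n i w) t < 1.
Proof.
move=> cw mL; rewrite tnth_mktuple scrambleE; apply: append_itv => //.
exact: (digit_cell_itv hb (config_event_noise hb n t cw mL (ltn_ord i))).
Qed.

(** The scrambling decides the first [m] digits of a coordinate, and the noise the following ones. *)
Lemma block_node_digits (c : config b s d L M) w n m (i : 'I_(b ^ m)) t r :
  config_event z0 perms noise c w -> (m < L)%N -> (r < M)%N ->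
  digits hb (tnth (block_node n i w) t) r = config_digit z0 source_digit c n m t i r.
Proof.
move=> cw mL rM; rewrite tnth_mktuple scrambleE digits_append.
  rewrite /append_digits /config_digit source_digitE; case: ifP => rm.
    by rewrite (config_event_perm n t cw mL) // size_mkseq.
  apply: (digit_cell_digits hb z0 (config_event_noise hb n t cw mL (ltn_ord i))).
  by apply: leq_ltn_trans rM; rewrite leq_subr.
exact: (digit_cell_itv hb (config_event_noise hb n t cw mL (ltn_ord i))).
Qed.

Definition tensor_node (m : 'I_d -> nat) (i : forall n, 'I_(b ^ m n)) (w : Omega) :
    (d * s).-tuple R :=
  concat_blocks (fun n => block_node n (i n) w).

Lemma tnth_concat_blocks (x : 'I_d -> s.-tuple R) n t :
  tnth (concat_blocks x) (mxvec_index n t) = tnth (x n) t.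
Proof. by rewrite tnth_mktuple mxvecE mxE. Qed.

Lemma tensor_node_cube (c : config b s d L M) w (m : 'I_d -> nat) (i : forall n, 'I_(b ^ m n)) :
  config_event z0 perms noise c w -> (forall n, (m n < L)%N) ->
  @unit_cube R (d * s) (tensor_node i w).
Proof.
move=> cw mL q; case/mxvec_indexP: q => n t; rewrite tnth_concat_blocks.
exact: block_node_itv cw (mL n).
Qed.

Definition triple_of (D : nat) (g : finite_index b D M) : haar_triple D :=
  ([ffun t => nat_of_ord (g t).1.1], [ffun t => nat_of_ord (g t).1.2],
   [ffun t => nat_of_ord (g t).2]).

Lemma haar_tensor_blocks (g : finite_index b (d * s) M) (x : 'I_d -> s.-tuple R) :
  haar_tensor b (triple_of g) (concat_blocks x) =
  \prod_(n < d) \prod_(t < s) haar b (block_index g n t).1.1 (block_index g n t).1.2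
    (block_index g n t).2 (tnth (x n) t).
Proof.
rewrite /haar_tensor big_mxvec_index; apply: eq_bigr => n _; apply: eq_bigr => t _.
by rewrite tnth_concat_blocks /triple_of /= !ffunE.
Qed.

Lemma block_haar_digits (c : config b s d L M) w n m (i : 'I_(b ^ m)) (g : finite_index b (d * s) M) :
    config_event z0 perms noise c w -> (m < L)%N -> finite_index_ok g ->
  \prod_(t < s) haar b (block_index g n t).1.1 (block_index g n t).1.2
    (block_index g n t).2 (tnth (block_node n i w) t) =
  \prod_(t < s) haar_at R (block_index g) n t (config_digit z0 source_digit c n m t i).
Proof.
move=> cw mL gok; apply: eq_bigr => t _; have [jM ib _] := block_index_valid gok n t.
rewrite (haar_digits hb) //; last exact: block_node_itv cw mL.
apply: digit_haar_ext => r rj; apply: block_node_digits => //.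
exact: leq_trans rj jM.
Qed.

End on_config_event.

End scrambled_nodes.

Section quad_tensor_theory.
Context (R : realType) (d s : nat).
Implicit Types (Q : 'I_d -> quadrature R s).

Let q0 : R * s.-tuple R := (0, [tuple 0 | _ < s]).

Lemma sum_dffun_ord (N : 'I_d -> nat) (K : nat) (G : ('I_d -> nat) -> R) :
    (forall n, (N n <= K)%N) ->
  \sum_(c : {dffun forall n : 'I_d, 'I_(N n)}) G (fun n => c n) =
  \sum_(f in family (fun n (i : 'I_K) => (i < N n)%N)) G (fun n => f n).
Proof.
move=> NK; pose h (c : {dffun forall n : 'I_d, 'I_(N n)}) : {ffun 'I_d -> 'I_K} :=
  [ffun n => widen_ord (NK n) (c n)].
have hinj : injective h.
  move=> c c' /ffunP e; apply/ffunP => n; apply/val_inj.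
  by have := congr1 val (e n); rewrite !ffunE.
rewrite (eq_bigl (fun f => f \in [set h c | c in {: {dffun forall n : 'I_d, 'I_(N n)}}]%SET)); last first.
  move=> f; apply/familyP/imsetP => [fN|[c _ ->] n]; last first.
    by rewrite unfold_in /h ffunE /= ltn_ord.
  exists (finfun (fun n => Ordinal (fN n : (f n < N n)%N))) => //.
  by apply/ffunP => n; rewrite !ffunE; exact/val_inj.
rewrite big_imset /=; last by move=> c c' _ _; exact: hinj.
apply: eq_bigr => c _; congr G; apply/funext => n; by rewrite ffunE.
Qed.

(** The dependent index type of a tensor product quadrature is replaced by a family inside a fixed type,
whose size bounds those of all factors; this allows the quadratures to vary with the outcome. *)
Lemma quad_tensorE Q (K : nat) (f : (d * s).-tuple R -> R) :
    (forall n, (size (Q n) <= K)%N) ->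
  quad_tensor Q f = \sum_(c in family (fun n (i : 'I_K) => (i < size (Q n))%N))
    (\prod_(n < d) (nth q0 (Q n) (c n)).1) *
      f (concat_blocks (fun n => (nth q0 (Q n) (c n)).2)).
Proof.
move=> QK.
rewrite -(@sum_dffun_ord (fun n => size (Q n)) K (fun c =>
    (\prod_(n < d) (nth q0 (Q n) (c n)).1) *
      f (concat_blocks (fun n => (nth q0 (Q n) (c n)).2)))) //.
apply: eq_bigr => c _.
have E n : tnth (in_tuple (Q n)) (c n) = nth q0 (Q n) (c n) by exact: tnth_nth.
congr (_ * f _); first by apply: eq_bigr => n _; rewrite E.
by congr concat_blocks; apply/funext => n; rewrite E.
Qed.

Lemma quad_tensor_prod Q (phi : 'I_d -> s.-tuple R -> R) (f : (d * s).-tuple R -> R) :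
    (forall x, f (concat_blocks x) = \prod_(n < d) phi n (x n)) ->
  quad_tensor Q f = \prod_(n < d) \sum_(q <- Q n) q.1 * phi n q.2.
Proof.
move=> fE; pose K := (\sum_(n < d) size (Q n))%N.
have QK n : (size (Q n) <= K)%N by rewrite /K (bigD1 n) //= leq_addr.
rewrite (quad_tensorE _ QK).
rewrite (eq_bigr (fun n => \sum_(i < size (Q n)) (nth q0 (Q n) i).1 * phi n (nth q0 (Q n) i).2)).
  rewrite (@prod_sum_widen R d K (fun n => size (Q n))
    (fun n i => (nth q0 (Q n) i).1 * phi n (nth q0 (Q n) i).2)) //.
  by apply: eq_bigr => c _; rewrite fE -big_split.
by move=> n _; rewrite (big_nth q0) big_mkord.
Qed.

Lemma sum_quad_sub (U U' : quadrature R s) (phi : s.-tuple R -> R) :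
  \sum_(q <- quad_sub U U') q.1 * phi q.2 =
  \sum_(q <- U) q.1 * phi q.2 - \sum_(q <- U') q.1 * phi q.2.
Proof.
rewrite /quad_sub big_cat big_map /= -sumrN; congr (_ + _).
by apply: eq_bigr => q _; rewrite mulNr.
Qed.

End quad_tensor_theory.

(** * The Smolyak method as a sum over nodes *)

Section smolyak_on_nodes.
Context (R : realType) (dd : measure_display) (Omega : measurableType dd)
  (d s b : nat) (hb : (1 < b)%N) (z0 : 'I_b).
Context (perms : perm_family d s b Omega) (noise : noise_family R d s Omega).
Context (p : 'I_d -> forall m : nat, 'I_(b ^ m) -> s.-tuple R).
Arguments p : clear implicits.

Definition random_block (w : Omega) : 'I_d -> nat -> quadrature R s :=
  building_block hb p (fun n m t u => perms n m t u w) (fun n m t i => noise n m t i w).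

Definition block_size (l : nat) : nat := if l is m.+1 then b ^ m else 0%N.

Lemma size_random_block w n l : size (random_block w n l) = block_size l.
Proof. by case: l => //= m; rewrite size_map size_enum_ord. Qed.

Lemma smolyak_sum (I : finType) (S : pred I) (x : I -> R) (f : I -> (d * s).-tuple R -> R)
    (U : 'I_d -> nat -> quadrature R s) L :
  smolyak U L (fun y => \sum_(i | S i) x i * f i y) = \sum_(i | S i) x i * smolyak U L (f i).
Proof.
rewrite /smolyak; under [RHS]eq_bigr => i _ do rewrite mulr_sumr.
rewrite [RHS]exchange_big /=; apply: eq_bigr => l _; rewrite /quad_tensor.
under [RHS]eq_bigr => i _ do rewrite mulr_sumr.
rewrite [RHS]exchange_big /=; apply: eq_bigr => c _; rewrite mulr_sumr.
by apply: eq_bigr => i _; rewrite mulrCA.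
Qed.

Lemma smolyakB (f g : (d * s).-tuple R -> R) (U : 'I_d -> nat -> quadrature R s) L :
  smolyak U L (fun y => f y - g y) = smolyak U L f - smolyak U L g.
Proof.
rewrite /smolyak -sumrB; apply: eq_bigr => l _; rewrite /quad_tensor -sumrB.
by apply: eq_bigr => c _; rewrite mulrBr.
Qed.

(** The nodes enter a Haar function only through digits that the configuration determines. *)
Lemma smolyak_haar_tensor (L M : nat) (c : config b s d L M) w
    (g : finite_index b (d * s) M) :
    config_event z0 perms noise c w -> finite_index_ok g ->
  smolyak (random_block w) L (haar_tensor b (triple_of g)) =
  smolyak_haar R z0 (source_digit hb z0 p) (block_index g) c.
Proof.
move=> cw gok; rewrite /smolyak /smolyak_haar; apply: eq_bigr => l _.
pose phi (n : 'I_d) (x : s.-tuple R) := \prod_(t < s) haar b (block_index g n t).1.1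
  (block_index g n t).1.2 (block_index g n t).2 (tnth x t).
rewrite (quad_tensor_prod _ (phi := phi)) => [|x]; last exact: haar_tensor_blocks.
have E n k : (k <= L)%N -> \sum_(q <- random_block w n k) q.1 * phi n q.2 =
    block_mean R z0 (source_digit hb z0 p) (block_index g) c n k.
  case: k => [_|m mL] /=; first by rewrite big_nil.
  rewrite big_map big_enum /= /block_sum mulr_sumr; apply: eq_bigr => i _.
  by congr (_ * _); exact: block_haar_digits.
apply: eq_bigr => n _; have lL : (l n <= L)%N := ltn_ord (l n).
by rewrite sum_quad_sub !E // (leq_trans (leq_pred _)).
Qed.

Let q0 : R * s.-tuple R := (0, [tuple 0 | _ < s]).

Lemma nth_random_block n m j : (j < b ^ m)%N -> exists i : 'I_(b ^ m),
  forall w, nth q0 (random_block w n m.+1) j = (b%:R ^- m, block_node hb perms noise p n i w).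
Proof.
move=> jb; exists (Ordinal jb) => w /=.
rewrite (nth_map (Ordinal jb)) ?size_enum_ord //.
by have -> : nth (Ordinal jb) (enum 'I_(b ^ m)) j = Ordinal jb
  by apply/val_inj; rewrite /= nth_enum_ord.
Qed.

Lemma quad_sub_node L n l j : (0 < l <= L)%N -> (j < block_size l + block_size l.-1)%N ->
  exists (a : R) (mi : {m : nat & 'I_(b ^ m)}), [/\ `|a| <= 1, (tag mi < L)%N &
    forall w, nth q0 (quad_sub (random_block w n l) (random_block w n l.-1)) j =
      (a, block_node hb perms noise p n (tagged mi) w)].
Proof.
have bR m : `|b%:R ^- m| <= 1 :> R.
  rewrite ger0_norm ?invr_ge0 ?exprn_ge0 // invf_le1 ?exprn_gt0 ?ltr0n ?(ltnW hb) //.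
  by rewrite exprn_ege1 // ler1n (ltnW hb).
case: l => [//|m] mL jl; rewrite /quad_sub -[m.+1.-1]/m.
have {}jl : (j < b ^ m + block_size m)%N := jl.
case: (ltnP j (b ^ m)) => jm.
  have [i E] := nth_random_block n jm.
  exists (b%:R ^- m), (existT (fun m => 'I_(b ^ m)) m i); split; [exact: bR|exact: mL|].
  by move=> w; rewrite nth_cat size_random_block [block_size _]/= jm; exact: E.
case: m mL jl jm => [|m] mL jl jm; first by move: jl; rewrite addn0 ltnNge jm.
have jm' : (j - b ^ m.+1 < b ^ m)%N by rewrite ltn_subLR.
have [i E] := nth_random_block n jm'.
exists (- b%:R ^- m), (existT (fun m => 'I_(b ^ m)) m i); split.
- by rewrite normrN; exact: bR.
- exact: ltnW.
move=> w; rewrite nth_cat size_random_block [block_size _]/= ltnNge jm [~~ _]/=.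
by rewrite (nth_map q0) ?[nth q0 _ _]E // size_random_block.
Qed.

(** The number of nodes and their weights do not depend on the outcome.  The weights are products of numbers
[b ^- m] up to sign, hence at most 1. *)
Lemma smolyak_nodes L : (0 < L)%N ->
  exists (I : finType) (a : I -> R) (m : I -> 'I_d -> nat) (i : forall x n, 'I_(b ^ m x n)),
  [/\ forall x, `|a x| <= 1, forall x n, (m x n < L)%N &
    forall w f, smolyak (random_block w) L f =
      \sum_x a x * f (tensor_node hb perms noise p (i x) w)].
Proof.
move=> L0; pose N (l : {ffun 'I_d -> 'I_L.+1}) n := (block_size (l n) + block_size (l n).-1)%N.
pose K := (\max_(l : {ffun 'I_d -> 'I_L.+1}) \max_(n < d) N l n)%N.
have NK l n : (N l n <= K)%N.
  apply: leq_trans (leq_bigmax (F := fun l => \max_(n < d) N l n)%N l).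
  exact: (leq_bigmax (F := N l)).
pose I := ({ffun 'I_d -> 'I_L.+1} * {ffun 'I_d -> 'I_K})%type.
pose used (x : I) := (x.1 \in multi_indices L d) &&
  (x.2 \in family (fun n (j : 'I_K) => (j < N x.1 n)%N)).
have /choice[A HA] (xn : I * 'I_d) : exists A : R * {m : nat & 'I_(b ^ m)},
    [/\ `|A.1| <= 1, (tag A.2 < L)%N & used xn.1 -> forall w,
      nth q0 (quad_sub (random_block w xn.2 (xn.1.1 xn.2))
        (random_block w xn.2 (xn.1.1 xn.2).-1)) (xn.1.2 xn.2) =
      (A.1, block_node hb perms noise p xn.2 (tagged A.2) w)].
  case: xn => -[l c] n /=; case: (boolP (used (l, c))) => [/andP[]|_]; last first.
    have b0 : (0 < b ^ 0)%N by [].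
    by exists (0, existT (fun m => 'I_(b ^ m)) 0%N (Ordinal b0)); split; rewrite ?normr0.
  rewrite inE /= => /andP[/forallP/(_ n) l0 _] /familyP/(_ n) cN.
  have lL : (0 < l n <= L)%N by rewrite l0 -ltnS ltn_ord.
  by have [a [mi [a1 mL E]]] := quad_sub_node n lL cN; exists (a, mi); split.
exists I, (fun x => (used x)%:R * \prod_(n < d) (A (x, n)).1).
exists (fun x n => tag (A (x, n)).2), (fun x n => tagged (A (x, n)).2); split.
- move=> x; case: (used x); last by rewrite mul0r normr0.
  by rewrite mul1r normr_prod prodr_ile1 // => n _; have [-> _ _] := HA (x, n); rewrite normr_ge0.
- by move=> x n; have [] := HA (x, n).
- move=> w f; rewrite /smolyak.
  pose T l (c : {ffun 'I_d -> 'I_K}) := (\prod_(n < d) (A ((l, c), n)).1) *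
    f (tensor_node hb perms noise p (fun n => tagged (A ((l, c), n)).2) w).
  transitivity (\sum_(l in multi_indices L d)
    \sum_(c in family (fun n (j : 'I_K) => (j < N l n)%N)) T l c).
    apply: eq_bigr => l lQ.
    have sE n : size (quad_sub (random_block w n (l n)) (random_block w n (l n).-1)) = N l n.
      by rewrite /quad_sub size_cat size_map !size_random_block.
    rewrite (@quad_tensorE _ _ _ _ K) => [|n]; last by rewrite sE.
    have fE : family (fun n (j : 'I_K) => (j < size (quad_sub (random_block w n (l n))
        (random_block w n (l n).-1)))%N) =i family (fun n (j : 'I_K) => (j < N l n)%N).
      by move=> c; apply: eq_forallb => n; rewrite !unfold_in sE.
    rewrite (eq_bigl _ _ fE); apply: eq_bigr => c cN.
    have E n := (let: And3 _ _ h := HA ((l, c), n) in h) (introT andP (conj lQ cN)) w.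
    rewrite /T; congr (_ * f _); first by apply: eq_bigr => n _; rewrite E.
    by congr concat_blocks; apply/funext => n; rewrite E.
  rewrite pair_big_dep /= big_mkcond /=; apply: eq_bigr => -[l c] _.
  by rewrite /used /T /=; case: ifP => _; rewrite ?mul1r ?mul0r.
Qed.

End smolyak_on_nodes.

(** * Cells of the cube and uniformly distributed points *)

Section cells.
Context (R : realType) (b : nat) (hb : (1 < b)%N) (z0 : 'I_b) (D : nat).

Notation lam := (lebesgue_tuple R D).
Notation cube := (@unit_cube R D).

Definition words (N : nat) : finType := {ffun 'I_D -> N.-tuple 'I_b}.

Definition cell_index (N : nat) (x : D.-tuple R) : words N :=
  [ffun t => [tuple digits hb (tnth x t) r | r < N]].

(** The default digit [z0] only serves to read a word as a sequence of digits. *)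
Definition cell (N : nat) (a : words N) : set (D.-tuple R) :=
  [set x | forall t, digit_cell N (nth z0 (a t)) (tnth x t)].

Lemma mkseq_words N (a : words N) t : mkseq (nth z0 (a t)) N = a t.
Proof. by have := mkseq_nth z0 (a t); rewrite size_tuple. Qed.

Lemma cell_cube N (a : words N) : cell a `<=` cube.
Proof. by move=> x h t; exact: (digit_cell_itv hb (h t)). Qed.

Lemma cell_indexE N (a : words N) x : cube x -> cell a x <-> cell_index N x = a.
Proof.
move=> xc; have E t : mkseq (digits hb (tnth x t)) N = tval (cell_index N x t).
  rewrite ffunE; apply: (@eq_from_nth _ z0); rewrite ?size_tuple ?size_mkseq // => r rN.
  by rewrite nth_mkseq // -(tnth_nth _ _ (Ordinal rN)) tnth_mktuple.
split=> [h|<- t].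
  apply/ffunP => t; apply/val_inj => /=; rewrite -E.
  by have /(digit_cellE hb _ _ (xc t)) -> := h t; rewrite mkseq_words.
by apply/(digit_cellE hb _ _ (xc t)); rewrite mkseq_words E.
Qed.

Lemma measurable_box (B : 'I_D -> set R) : (forall t, measurable (B t)) ->
  measurable [set x : D.-tuple R | forall t, B t (tnth x t)].
Proof.
move=> mB; rewrite (_ : [set _ | _] = \bigcap_(t in [set: 'I_D]) ((@tnth D R ^~ t) @^-1` B t)).
  apply: fin_bigcap_measurable => // t _; rewrite -[X in measurable X]setTI.
  exact: measurable_tnth.
by apply/seteqP; split => x h t; [move=> _; exact: h|exact: h].
Qed.

Lemma measurable_cell N (a : words N) : measurable (cell a).
Proof.
apply: (@measurable_box (fun t => digit_cell N (nth z0 (a t)))) => t.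
exact: measurable_digit_cell.
Qed.

Lemma lebesgue_cell N (a : words N) : lam (cell a) = (b%:R ^- (D * N))%:E.
Proof.
rewrite (lebesgue_box_digit_cell R hb (fun=> N) (fun t => nth z0 (a t))).
by rewrite sum_nat_const card_ord.
Qed.

Lemma card_words N : #|words N| = (b ^ (D * N))%N.
Proof. by rewrite card_ffun card_tuple !card_ord -expnM mulnC. Qed.

Lemma cube_cells N : cube = \big[setU/set0]_(a : words N) cell a.
Proof.
apply/seteqP; split=> x.
  move=> xc; rewrite -bigcup_seq; exists (cell_index N x); first exact: mem_index_enum.
  exact/cell_indexE.
by rewrite -bigcup_seq => -[a _ /cell_cube].
Qed.

Lemma trivIset_cell N (A : set (words N)) : trivIset A (@cell N).
Proof.
apply/trivIsetP => a a' _ _ /eqP aa'; rewrite -subset0 => x [xa xa'].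
have xc := cell_cube xa; apply: aa'.
by move/(cell_indexE _ xc) : xa => <-; move/(cell_indexE _ xc) : xa' => <-.
Qed.

Lemma measurable_cube : measurable cube.
Proof. by rewrite (cube_cells 0); apply: bigsetU_measurable => a _; exact: measurable_cell. Qed.

Lemma measure_cells N (S : pred (words N)) (mu : {measure set (D.-tuple R) -> \bar R}) :
  mu (\big[setU/set0]_(a : words N | S a) cell a) = (\sum_(a : words N | S a) mu (cell a))%E.
Proof.
rewrite -big_filter -[RHS]big_filter; set r := [seq a <- _ | S a].
rewrite -[LHS]mul1e -integral_cst; last by apply: bigsetU_measurable => a _; exact: measurable_cell.
rewrite ge0_integral_bigsetU; last 5 first.
- exact: measurable_cell.
- by rewrite filter_uniq // /index_enum -enumT enum_uniq.
- exact: trivIset_cell.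
- exact: measurable_cst.
- by move=> w _; rewrite /cst lee_fin.
apply: eq_bigr => a _; rewrite integral_cst; last exact: measurable_cell.
by rewrite mul1e.
Qed.

Lemma lebesgue_cube : lam cube = 1%E.
Proof.
rewrite (cube_cells 0) (measure_cells xpredT) (eq_bigr (fun=> 1%:E)) => [|a _].
  by rewrite sumEFin sumr_const card_words muln0 expn0.
by apply: etrans (lebesgue_cell a) _; rewrite muln0 expr0 invr1.
Qed.

(** Sets that are finite unions of cells inside the cube, and arbitrary measurable sets outside of it. *)
Definition badic (A : set (D.-tuple R)) : Prop := measurable A /\
  exists (N : nat) (S : pred (words N)), forall x, cube x -> A x <-> S (cell_index N x).

Lemma cell_index_coarser (T : Type) N N' : (N <= N')%N -> forall S : words N -> T,
  exists S' : words N' -> T, forall x, S (cell_index N x) = S' (cell_index N' x).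
Proof.
move=> NN S; exists (fun a : words N' => S [ffun t => [tuple nth z0 (a t) r | r < N]]) => x.
congr S; apply/ffunP => t; rewrite !ffunE; apply: eq_from_tnth => r.
rewrite !tnth_mktuple.
by rewrite -(tnth_nth z0 _ (widen_ord NN r)) tnth_mktuple.
Qed.

Lemma badic_setI : setI_closed badic.
Proof.
move=> A A' [mA [N [S AS]]] [mA' [N' [S' AS']]]; split; first exact: measurableI.
have [S1 S1E] := cell_index_coarser (leq_maxl N N') S.
have [S2 S2E] := cell_index_coarser (leq_maxr N N') S'.
exists (maxn N N'), (fun a => S1 a && S2 a) => x xc.
rewrite -S1E -S2E; split=> [[/(AS _ xc) -> /(AS' _ xc) ->] //|/andP[h h']].
by split; [exact/(AS _ xc)|exact/(AS' _ xc)].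
Qed.

Lemma badic_cells N (S : pred (words N)) : badic (\big[setU/set0]_(a : words N | S a) cell a).
Proof.
split; first by apply: bigsetU_measurable => a _; exact: measurable_cell.
exists N, S => x xc; rewrite -bigcup_seq_cond; split=> [[a /= /andP[_ Sa] /(cell_indexE _ xc) -> //]|h].
exists (cell_index N x); first by rewrite /= mem_index_enum.
exact/cell_indexE.
Qed.

(** Inside the cube, a half-space is the countable union of the cells contained in it. *)
Lemma measurable_below t r : <<s badic>> [set x : D.-tuple R | tnth x t < r].
Proof.
have -> : [set x : D.-tuple R | tnth x t < r] =
    (~` cube `&` [set x : D.-tuple R | tnth x t < r]) `|`
    \bigcup_N \big[setU/set0]_(a : words N | (word_num (a t)).+1%:R <= b%:R ^+ N * r) cell a.
  apply/seteqP; split=> x /=.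
    move=> xr; case: (pselect (cube x)) => xc; [right|by left].
    have [x0 x1] := andP (xc t).
    (* The cell of x then lies below r, because its side b ^- N is at most r - tnth x t. *)
    pose N := (Num.truncn (r - tnth x t)^-1).+1.
    have rx : 0 < r - tnth x t by rewrite subr_gt0.
    have Nr : 1 <= b%:R ^+ N * (r - tnth x t).
      rewrite -ler_pdivrMr // mul1r; apply: le_trans (ltW (truncnS_gt _)) _.
      by rewrite -natrX ler_nat ltnW // ltn_expl.
    exists N => //; rewrite -bigcup_seq_cond; exists (cell_index N x); last exact/cell_indexE.
    rewrite /= mem_index_enum /=.
    have /(mem_digit_cell hb) : digit_cell N (nth z0 (cell_index N x t)) (tnth x t).
      by have /(cell_indexE _ xc) := erefl (cell_index N x); apply.
    rewrite mkseq_words => /andP[h _]; move: Nr; rewrite mulrBr -natr1.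
    by move: h; lra.
  case=> [[_ //]|[N _]]; rewrite -bigcup_seq_cond => -[a /= /andP[_ h] /(_ t)/(mem_digit_cell hb)].
  rewrite mkseq_words => /andP[_ h'].
  have B0 : 0 < b%:R ^+ N :> R by rewrite exprn_gt0 // ltr0n ltnW.
  by rewrite -(ltr_pM2l B0); apply: lt_le_trans h' h.
apply: (@measurableU _ (g_sigma_algebraType badic)).
  apply: sub_sigma_algebra; split.
    apply: measurableI; first exact: measurableC measurable_cube.
    rewrite (_ : [set x | tnth x t < r] = (@tnth D R ^~ t) @^-1` `]-oo, r[%classic); last first.
      by apply/seteqP; split=> x /=; rewrite in_itv.
    rewrite -[X in measurable X]setTI; exact: measurable_tnth.
  by exists 0%N, xpred0 => x xc; split=> // -[].
apply: (@bigcupT_measurable _ (g_sigma_algebraType badic)) => N.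
by apply: sub_sigma_algebra; exact: badic_cells.
Qed.

Lemma badic_generate : @measurable _ (D.-tuple R) = <<s badic>>.
Proof.
apply/seteqP; split; last first.
  by apply: smallest_sub; [exact: sigma_algebra_measurable|move=> A []].
have mid : measurable_fun [set: g_sigma_algebraType badic] (id : _ -> D.-tuple R).
  apply/measurable_fun_tnthP => t; apply: (measurability _ (RGenInftyO.measurableE R)).
  move=> _ [_ [r ->] <-]; rewrite setTI.
  rewrite (_ : _ @^-1` _ = [set x : D.-tuple R | tnth x t < r]); first exact: measurable_below.
  by apply/seteqP; split=> x /=; rewrite in_itv.
by move=> A mA; have := mid measurableT A mA; rewrite setTI.
Qed.

Section uniform_points.
Context (dd : measure_display) (Omega : measurableType dd) (P : probability Omega R).
Context (X : Omega -> D.-tuple R).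
Hypotheses (mX : measurable_fun setT X)
  (XP : forall N (a : words N), P (X @^-1` cell a) = (b%:R ^- (D * N))%:E).

Let mX_mixin := isMeasurableFun.Build _ _ _ _ _ mX.
Let X' : {mfun Omega >-> D.-tuple R} := HB.pack X mX_mixin.

(** The law of [X] and the uniform measure agree on the cells, hence on the b-adic sets, which are stable
under intersection and generate the Borel sets. *)
Lemma uniform_point_law (h : D.-tuple R -> \bar R) :
    measurable_fun setT h -> (forall x, (0 <= h x)%E) ->
  (\int[P]_w h (X w) = \int[lam]_(x in cube) h x)%E.
Proof.
move=> mh h0; pose m1 : probability (D.-tuple R) R := distribution P X'.
pose m2 : {measure set (D.-tuple R) -> \bar R} := mrestr lam measurable_cube.
have cellP N (a : words N) : m1 (cell a) = m2 (cell a).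
  rewrite [LHS]XP; apply/esym/(etrans _ (lebesgue_cell a)).
  by rewrite /m2 /= /mrestr setIidl //; exact: cell_cube.
have m2C : m2 (~` cube) = 0%E by rewrite /m2 /= /mrestr setICl measure0.
have m1cube : m1 cube = 1%E.
  rewrite (cube_cells 0) (measure_cells xpredT m1); apply: etrans lebesgue_cube.
  rewrite (cube_cells 0) (measure_cells xpredT lam); apply: eq_bigr => a _.
  by apply: etrans (cellP _ a) _; rewrite /m2 /= /mrestr setIidl //; exact: cell_cube.
have m1C : m1 (~` cube) = 0%E.
  rewrite probability_setC; last exact: measurable_cube.
  by rewrite [X in (_ - X)%E]m1cube subee.
have split_cube (m : {measure set (D.-tuple R) -> \bar R}) A : measurable A ->
    m (~` cube) = 0%E -> m A = m (A `&` cube).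
  move=> mA mC; rewrite -{1}(setDUK (@subIsetl _ A cube)) setDIr setDv set0U measureU.
  - rewrite [X in (_ + X)%E](@subset_measure0 _ _ _ m _ (~` cube)) ?adde0 //.
    + by apply: measurableD => //; exact: measurable_cube.
    + by apply: measurableC; exact: measurable_cube.
  - by apply: measurableI => //; exact: measurable_cube.
  - by apply: measurableD => //; exact: measurable_cube.
  - by apply/seteqP; split=> x // [[_ xc] [_ nxc]].
have mE A : measurable A -> m1 A = m2 A.
  apply: (measure_unique badic (fun=> setT)) => //.
  - exact: badic_generate.
  - exact: badic_setI.
  - by move=> _; split => //; exists 0%N, xpredT.
  - by rewrite bigcup_const //; exists 0%N.
  - move=> {}A [mA [N [S AS]]]; rewrite (split_cube m1) // (split_cube m2) //.
    have -> : A `&` cube = \big[setU/set0]_(a : words N | S a) cell a.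
      apply/seteqP; split=> x; rewrite -bigcup_seq_cond.
        move=> [/[swap] xc /(AS _ xc) Sx]; exists (cell_index N x).
          by rewrite /= mem_index_enum.
        exact/cell_indexE.
      move=> [a /= /andP[_ Sa] xa]; have xc := cell_cube xa; split=> //.
      by apply/(AS _ xc); move/(cell_indexE _ xc) : xa => ->.
    by rewrite !measure_cells; apply: eq_bigr => a _; exact: cellP.
  - by move=> _; apply: le_lt_trans (probability_le1 _ _) _; rewrite ?ltry.
transitivity (\int[m1]_x h x)%E; first by rewrite ge0_integral_distribution.
transitivity (\int[m1]_(x in cube) h x)%E.
  rewrite (ge0_negligible_integral (N := ~` cube)) //.
  - by rewrite setTD setCK.
  - by apply: measurableC; exact: measurable_cube.
apply: eq_measure_integral => A mA Ac; apply: etrans (mE _ mA) _.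
by rewrite /m2 /= /mrestr setIidl.
Qed.

End uniform_points.

End cells.

(** * Density of step functions in mean square *)

Import HBSimple HBNNSimple.

Section step_approximation.
Context (R : realType) (b : nat) (hb : (1 < b)%N) (z0 : 'I_b) (D : nat).

Notation lam := (lebesgue_tuple R D).
Notation cube := (@unit_cube R D).
Notation words := (words b D).
Notation cell_index := (@cell_index R b hb D).
Notation cell := (@cell R b z0 D).

Let cube_fin : (lam cube < +oo)%E. Proof. by rewrite (lebesgue_cube R hb z0) ltry. Qed.

Let mcube : measurable cube. Proof. exact: (@measurable_cube R b hb z0 D). Qed.

Implicit Types f g : D.-tuple R -> R.

Definition sqint (f : D.-tuple R -> R) : \bar R := (\int[lam]_(x in cube) (f x ^+ 2)%:E)%E.

Lemma measurable_sqr_EFin (A : set (D.-tuple R)) (f : D.-tuple R -> R) : measurable_fun setT f ->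
  measurable_fun A (fun x => (f x ^+ 2)%:E).
Proof.
by move=> mf; apply/measurable_EFinP; apply: measurable_funX; exact: measurable_funTS.
Qed.

Let sqr_ge0E (r : R) : (0 <= (r ^+ 2)%:E)%E.
Proof. by rewrite lee_fin sqr_ge0. Qed.

Lemma sqint_ge0 f : (0 <= sqint f)%E.
Proof. by apply: integral_ge0 => x _; exact: sqr_ge0E. Qed.

Lemma sqint_le f g : measurable_fun setT f -> measurable_fun setT g ->
  (forall x, cube x -> f x ^+ 2 <= g x ^+ 2) -> (sqint f <= sqint g)%E.
Proof.
move=> mf mg fg; apply: ge0_le_integral => //; try exact: measurable_sqr_EFin.
Qed.

Lemma eq_sqint f g : (forall x, cube x -> f x = g x) -> sqint f = sqint g.
Proof. by move=> fg; apply: eq_integral => x /set_mem xc; rewrite fg. Qed.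

Lemma sqintD_le f g : measurable_fun setT f -> measurable_fun setT g ->
  (sqint (fun x => f x + g x)%R <= 2%:E * sqint f + 2%:E * sqint g)%E.
Proof.
move=> mf mg; rewrite /sqint -!ge0_integralZl_EFin //; try exact: measurable_sqr_EFin.
have m2 (h : D.-tuple R -> R) : measurable_fun setT h -> measurable_fun cube (fun x => (2%:E * (h x ^+ 2)%:E)%E).
  move=> mh; apply/measurable_EFinP; apply: measurable_funM => //.
  by apply: measurable_funX; exact: measurable_funTS.
rewrite -ge0_integralD //; try exact: m2; last 2 first.
- by move=> x _; rewrite -EFinM lee_fin mulr_ge0 ?sqr_ge0.
- by move=> x _; rewrite -EFinM lee_fin mulr_ge0 ?sqr_ge0.
apply: ge0_le_integral => //.
- by apply: (@measurable_sqr_EFin cube (fun x => f x + g x)); exact: measurable_funD.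
- by apply: emeasurable_funD; exact: m2.
- move=> x _; rewrite -!EFinM -EFinD lee_fin.
  by have := sqr_ge0 (f x - g x); lra.
Qed.

Lemma sqintZ f c : measurable_fun setT f ->
  sqint (fun x => c * f x)%R = ((c ^+ 2)%:E * sqint f)%E.
Proof.
move=> mf; rewrite /sqint -ge0_integralZl_EFin ?sqr_ge0 //; last exact: measurable_sqr_EFin.
by apply: eq_integral => x _; rewrite exprMn EFinM.
Qed.

Definition step (N : nat) (phi : words N -> R) (x : D.-tuple R) : R :=
  \sum_(a : words N) phi a * \1_(cell a) x.

Lemma measurable_step N (phi : words N -> R) : measurable_fun setT (step phi).
Proof.
apply: measurable_sum => a; apply: measurable_funM => //.
by apply: measurable_indic; exact: measurable_cell.
Qed.

Lemma stepE N (phi : words N -> R) x : cube x -> step phi x = phi (cell_index N x).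
Proof.
move=> xc; rewrite /step (bigD1 (cell_index N x)) //= indicE mem_set ?mulr1; last exact/cell_indexE.
rewrite big1 ?addr0 // => a /eqP ax; rewrite indicE memNset ?mulr0 //.
by move=> /(cell_indexE hb z0 _ xc) e; apply: ax.
Qed.

Definition approximable (f : D.-tuple R -> R) : Prop := measurable_fun setT f /\
  forall e : R, 0 < e -> exists N (phi : words N -> R),
    (sqint (fun x => f x - step phi x)%R < e%:E)%E.

Lemma step_finer N N' (phi : words N -> R) : (N <= N')%N ->
  exists phi' : words N' -> R, forall x, cube x -> step phi x = step phi' x.
Proof.
move=> NN; have [phi' E] := cell_index_coarser R hb z0 NN phi.
by exists phi' => x xc; rewrite !stepE.
Qed.

Lemma approximable_finer f (e : R) (N0 : nat) : approximable f -> 0 < e ->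
  exists N (phi : words N -> R), (N0 <= N)%N /\ (sqint (fun x => f x - step phi x)%R < e%:E)%E.
Proof.
move=> [mf af] e0; have [N [phi h]] := af e e0.
have [phi' E] := step_finer phi (leq_maxr N0 N).
exists (maxn N0 N), phi'; rewrite leq_maxl; split=> //.
by rewrite (eq_sqint (g := fun x => f x - step phi x)) // => x xc; rewrite E.
Qed.

Lemma approximable_step f N (phi : words N -> R) : measurable_fun setT f ->
  (forall x, cube x -> f x = phi (cell_index N x)) -> approximable f.
Proof.
move=> mf fE; split=> // e e0; exists N, phi.
rewrite (eq_sqint (g := fun=> 0)) => [|x xc]; last by rewrite fE // stepE // subrr.
by rewrite /sqint integral0_eq ?lte_fin // => x _; rewrite expr0n.
Qed.

Lemma approximableD f g : approximable f -> approximable g ->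
  approximable (fun x => f x + g x).
Proof.
move=> af ag; have [mf _] := af; have [mg _] := ag.
split=> [|e e0]; first exact: measurable_funD.
have e4 : 0 < e / 4 by rewrite divr_gt0.
have [N [phi [_ hf]]] := approximable_finer 0 af e4.
have [N' [phi' [NN hg]]] := approximable_finer N ag e4.
have [phi2 E] := step_finer phi NN.
exists N', (fun a => phi2 a + phi' a).
have m1 : measurable_fun setT (fun x => f x - step phi x).
  by apply: measurable_funB => //; exact: measurable_step.
have m2 : measurable_fun setT (fun x => g x - step phi' x).
  by apply: measurable_funB => //; exact: measurable_step.
rewrite (eq_sqint (g := fun x => (f x - step phi x) + (g x - step phi' x))) => [|x xc]; last first.
  by rewrite E // !stepE //; ring.
apply: le_lt_trans (sqintD_le m1 m2) _.
have -> : e%:E = (2%:E * (e / 4)%:E + 2%:E * (e / 4)%:E)%E.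
  by rewrite -!EFinM -EFinD; congr EFin; field.
by apply: lteD; rewrite lte_pmul2l.
Qed.

Lemma approximableZ f c : approximable f -> approximable (fun x => c * f x).
Proof.
move=> af; have [mf _] := af; split=> [|e e0]; first exact: measurable_funM.
have c0 : 0 < c ^+ 2 + 1 by rewrite ltr_wpDl ?sqr_ge0.
have [N [phi [_ h]]] := approximable_finer 0 af (divr_gt0 e0 c0).
exists N, (fun a => c * phi a).
rewrite (eq_sqint (g := fun x => c * (f x - step phi x))) => [|x xc]; last first.
  by rewrite !stepE // mulrBr.
rewrite sqintZ; last by apply: measurable_funB => //; exact: measurable_step.
apply: le_lt_trans (_ : ((c ^+ 2)%:E * (e / (c ^+ 2 + 1))%:E < e%:E)%E).
  by rewrite lee_wpmul2l ?lee_fin ?sqr_ge0 // ltW.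
rewrite -EFinM lte_fin mulrA ltr_pdivrMr // mulrDr mulr1 mulrC ltrDl //.
Qed.

Lemma approximable_sum (I : Type) (r : seq I) (f : I -> D.-tuple R -> R) :
  (forall i, approximable (f i)) -> approximable (fun x => \sum_(i <- r) f i x).
Proof.
move=> af; elim: r => [|i r IH].
  apply: (@approximable_step _ 0 (fun=> 0)) => [|x _]; last by rewrite big_nil.
  by apply: measurable_sum => i; have [] := af i.
rewrite (_ : (fun _ => _) = fun x => f i x + \sum_(i <- r) f i x); first exact: approximableD.
by apply/funext => x; rewrite big_cons.
Qed.

(** The differences [f - f_ n] tend to zero in mean square by dominated convergence. *)
Lemma approximable_dominated (f : D.-tuple R -> R) (f_ : nat -> D.-tuple R -> R)
    (G : D.-tuple R -> R) :
    measurable_fun setT f -> (forall n, approximable (f_ n)) ->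
    (forall x, cube x -> f_ n x @[n --> \oo] --> f x) ->
    lam.-integrable cube (EFin \o G) ->
    (forall n x, cube x -> (f x - f_ n x) ^+ 2 <= G x) ->
  approximable f.
Proof.
move=> mf af cf iG fG; split=> // e e0.
have e4 : 0 < e / 4 by rewrite divr_gt0.
have mfn n : measurable_fun setT (fun x => f x - f_ n x).
  by apply: measurable_funB => //; have [] := af n.
have : (sqint (fun x => f x - f_ n x)%R @[n --> \oo] --> 0)%E.
  rewrite -(@integral0 _ _ _ lam cube).
  have [] // := (@dominated_convergence _ _ _ lam cube mcube
    (fun n x => ((f x - f_ n x) ^+ 2)%:E) (cst 0%E) (EFin \o G) _ _ _ iG _).
  - by move=> n; exact: measurable_sqr_EFin.
  - apply: aeW => x xc; apply: cvg_EFin; first by near=> n.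
    have -> : 0 = (f x - f x) * (f x - f x) by rewrite subrr mulr0.
    have h : f x - f_ n x @[n --> \oo] --> f x - f x by apply: cvgB; [exact: cvg_cst|exact: cf].
    exact: (cvgM h h).
  - apply: aeW => x n xc; rewrite gee0_abs ?sqr_ge0E // lee_fin.
    exact: fG.
move=> /fine_cvgP[fnf cvf].
have [n [fn cn]] : exists n, sqint (fun x => f x - f_ n x) \is a fin_num /\
    fine (sqint (fun x => f x - f_ n x)) < e / 4.
  near \oo => n; exists n; split; first by near: n.
  near: n; exact: (cvgr_lt _ cvf).
have {}cn : (sqint (fun x => f x - f_ n x)%R < (e / 4)%:E)%E by rewrite -(fineK fn) lte_fin.
have [N [phi [_ h]]] := approximable_finer 0 (af n) e4.
exists N, phi.
have m2 : measurable_fun setT (fun x => f_ n x - step phi x).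
  by apply: measurable_funB; [have [] := af n|exact: measurable_step].
rewrite (eq_sqint (g := fun x => (f x - f_ n x) + (f_ n x - step phi x))) => [|x xc]; last by ring.
apply: le_lt_trans (sqintD_le (mfn n) m2) _.
have -> : e%:E = (2%:E * (e / 4)%:E + 2%:E * (e / 4)%:E)%E.
  by rewrite -!EFinM -EFinD; congr EFin; field.
by apply: lteD; rewrite lte_pmul2l.
Unshelve. all: by end_near. Qed.

(** The sets with approximable indicator form a Dynkin class that contains the b-adic sets. *)
Lemma approximable_indic (A : set (D.-tuple R)) : measurable A -> approximable \1_A.
Proof.
move=> mA; suff : smallest dynkin (badic hb (D:=D)) `<=` [set A | measurable A /\ approximable \1_A].
  rewrite (setI_closed_g_dynkin_g_sigma_algebra (@badic_setI R b hb z0 D)) -badic_generate //.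
  by move=> /(_ A mA)[].
apply: smallest_sub; last first.
  move=> B [mB [N [S BS]]]; split=> //.
  apply: (@approximable_step _ N (fun a => (S a)%:R)) => [|x xc]; first exact: measurable_indic.
  by rewrite indicE; congr (nat_of_bool _)%:R; apply/idP/idP => [/set_mem/(BS x xc)|/(BS x xc)/mem_set].
split.
- split; first exact: measurableT.
  by apply: (@approximable_step _ 0 (fun=> 1)) => [|x _]; [exact: measurable_indic|rewrite indicT].
- move=> B [mB aB]; split; first exact: measurableC.
  rewrite (_ : \1_(~` B) = fun x => 1 + (-1) * \1_B x :> R); last first.
    by apply/funext => x; rewrite !indicE in_setC; case: (_ \in _) => /=; ring.
  apply: approximableD; last exact: approximableZ.
  by apply: (@approximable_step _ 0 (fun=> 1)) => [|x _].
- move=> F tF aF; have mUF : measurable (\bigcup_k F k) by apply: bigcup_measurable => k _; have [] := aF k.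
  split=> //.
  have E n x : \sum_(k < n) (\1_(F k) x : R) =
      if pselect (exists k, F k x) is left h then (projT1 (cid h) < n)%:R else 0.
    case: pselect => [h|h]; last first.
      rewrite big1 // => k _; rewrite indicE memNset // => Fk; apply: h; by exists k.
    case: cid => k /= Fk.
    have Fj (j : nat) : j != k -> (\1_(F j) x : R) = 0.
      move=> jk; rewrite indicE memNset // => Fj.
      by move/trivIsetP : tF => /(_ j k I I jk); rewrite -subset0 => /(_ x (conj Fj Fk)).
    have [kn|nk] := ltnP k n.
      rewrite (bigD1 (Ordinal kn)) //= indicE mem_set // big1 ?addr0 // => j jk.
      by apply: Fj; rewrite -val_eqE in jk.
    by rewrite big1 // => j _; apply: Fj; rewrite ltn_eqF // (leq_trans (ltn_ord j)).
  have Ef x : \1_(\bigcup_k F k) x = (if pselect (exists k, F k x) is left h then 1 else 0) :> R.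
    rewrite indicE; case: pselect => [[k h]|h]; first by rewrite mem_set //; exists k.
    by rewrite memNset // => -[k _ h']; apply: h; exists k.
  apply: (@approximable_dominated _ (fun n x => \sum_(k < n) \1_(F k) x) (cst 1)).
  + exact: measurable_indic.
  + by move=> n; apply: approximable_sum => k; have [] := aF k.
  + move=> x _; rewrite Ef; under eq_fun do rewrite E.
    case: pselect => [h|h]; last exact: cvg_cst.
    case: cid => k /= Fk; apply: cvg_near_cst; near=> n.
    by apply/eqP; rewrite (_ : (k < n)%N = true) //; near: n; exists k.+1.
  + apply: (measurable_bounded_integrable mcube cube_fin) => //.
    by exists 1; split=> // y y1 x _ /=; rewrite normr1 ltW.
  + move=> n x _; rewrite Ef E /=; case: pselect => [h|h]; last by rewrite subrr expr0n.
    by case: (_ < n)%N; rewrite ?subrr ?subr0 ?expr0n ?expr1n.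
Unshelve. all: by end_near. Qed.

Lemma approximable_nnsfun (f : {nnsfun (D.-tuple R) >-> R}) : approximable f.
Proof.
rewrite (_ : (f : _ -> _) = fun x => \sum_(y <- finmap.enum_fset (fset_set (range f))) y * \1_(f @^-1` [set y]) x).
  by apply: approximable_sum => y; apply: approximableZ; exact: approximable_indic.
by apply/funext => x; rewrite fimfunE fsbig_finite.
Qed.

Lemma integrable_sqr f : measurable_fun setT f -> (sqint f < +oo)%E ->
  lam.-integrable cube (EFin \o (fun x => f x ^+ 2)).
Proof.
move=> mf fi; apply/integrableP; split; first exact: measurable_sqr_EFin.
rewrite (eq_integral (fun x => (f x ^+ 2)%:E)) // => x _.
by rewrite [LHS]/= ger0_norm ?sqr_ge0.
Qed.

Lemma approximable_nneg f : measurable_fun setT f -> (forall x, 0 <= f x) ->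
  (sqint f < +oo)%E -> approximable f.
Proof.
move=> mf f0 fi; have mE : measurable_fun setT (EFin \o f) by exact/measurable_EFinP.
have f0E x : setT x -> (0 <= (EFin \o f) x)%E by rewrite lee_fin.
pose g := nnsfun_approx measurableT mE.
apply: (@approximable_dominated f g (fun x => f x ^+ 2)) => //.
- by move=> n; exact: approximable_nnsfun.
- move=> x _; have := cvg_nnsfun_approx measurableT mE f0E I => /(_ x).
  by move=> /fine_cvgP[_]; apply.
- exact: integrable_sqr.
- move=> n x _; rewrite lerXn2r ?nnegrE //.
    rewrite subr_ge0 -lee_fin /g nnsfun_approxE; exact: le_approx.
  by rewrite gerBl; exact: fun_ge0.
Qed.

(** Indicators generate the simple functions, nonnegative functions are dominated limits of simple ones, and
each function is the difference of its positive and negative parts. *)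
Lemma approximable_sqint f : measurable_fun setT f -> (sqint f < +oo)%E -> approximable f.
Proof.
move=> mf fi.
have mp : measurable_fun setT (fun x => Num.max (f x) 0) by apply: measurable_maxr.
have mn : measurable_fun setT (fun x => Num.max (- f x) 0).
  by apply: measurable_maxr => //; exact: measurableT_comp.
rewrite (_ : f = fun x => Num.max (f x) 0 + (-1) * Num.max (- f x) 0); last first.
  apply/funext => x; have [h|h] := leP (f x) 0.
    by rewrite max_l ?oppr_ge0 //; ring.
  by rewrite max_r ?oppr_le0 ?(ltW h) //; ring.
apply: approximableD; last apply: approximableZ; apply: approximable_nneg => //;
  try by move=> x; rewrite le_max lexx orbT.
- apply: le_lt_trans fi; apply: sqint_le => // x _.
  by have [h|h] := leP (f x) 0; rewrite ?expr0n ?sqr_ge0.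
- apply: le_lt_trans fi; apply: sqint_le => // x _.
  by have [h|h] := leP (- f x) 0; rewrite ?expr0n ?sqr_ge0 ?sqrrN.
Qed.

End step_approximation.

(** * Truncated Haar expansions *)

Section haar_kernel.
Context (R : realType) (b : nat) (hb : (1 < b)%N) (M : nat).

Notation same r a a' := (mkseq a r == mkseq a' r).

Let bR : b%:R != 0 :> R. Proof. by rewrite pnatr_eq0 -lt0n ltnW. Qed.

Lemma same_succ r (a a' : nat -> 'I_b) : same r.+1 a a' = same r a a' && (a r == a' r).
Proof. by rewrite !mkseqS eqseq_rcons. Qed.

(** The [b] Haar functions of the same position satisfy
[\sum_e (b 1_{y = e} - 1) (b 1_{y' = e} - 1) = b ^ 2 1_{y = y'} - b]. *)
Lemma digit_haar_level j (a a' : nat -> 'I_b) : (j < M)%N ->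
  \sum_(e < b) \sum_(k < b ^ M) (if (k < b ^ j)%N
    then digit_haar R j.+1 e k a * digit_haar R j.+1 e k a' else 0) =
  b%:R ^+ j.+1 * (same j.+1 a a')%:R - b%:R ^+ j * (same j a a')%:R.
Proof.
move=> jM; set c : R := b%:R `^ ((j.+1%:R - 2) / 2).
have c2 : c * c = b%:R ^+ j / b%:R.
  rewrite /c -powRD; last by apply/implyP.
  have -> : (j.+1%:R - 2) / 2 + (j.+1%:R - 2) / 2 = j%:R - 1 :> R.
    by rewrite -addn1 natrD; field.
  rewrite powRB ?powR_mulrn ?powRr1 ?ler0n //.
  by apply/implyP.
pose h (y e : 'I_b) : R := b%:R * (y == e)%:R - 1.
have E1 (e : 'I_b) : \sum_(k < b ^ M) (if (k < b ^ j)%N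
    then digit_haar R j.+1 e k a * digit_haar R j.+1 e k a' else 0) =
    b%:R ^+ j / b%:R * (same j a a')%:R * (h (a j) e * h (a' j) e).
  have wlt (x : nat -> 'I_b) : (word_num (mkseq x j) < b ^ j)%N.
    by have := word_num_lt (mkseq x j); rewrite size_mkseq.
  have wM : (word_num (mkseq a j) < b ^ M)%N.
    by apply: leq_trans (wlt a) _; rewrite leq_exp2l // ltnW.
  rewrite (bigD1 (Ordinal wM)) //= wlt eqxx /= big1 ?addr0 => [|k]; last first.
    rewrite -val_eqE eq_sym /= => /negPf kE; rewrite kE.
    by case: ifP; rewrite //= mul0r mulr0 mul0r.
  rewrite -/c -c2 mul1r; case: (mkseq a j =P mkseq a' j) => [-> | ne].
    by rewrite eqxx /h !val_eqE /=; ring.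
  have -> : (word_num (mkseq a' j) == word_num (mkseq a j)) = false.
    apply/eqP => e'; apply: ne; apply: word_num_inj; first by rewrite !size_mkseq.
    by rewrite e'.
  by rewrite /= !mul0r !mulr0 mul0r.
rewrite (eq_bigr _ (fun e _ => E1 e)) -mulr_sumr.
have S1 (y : 'I_b) : \sum_(e < b) (y == e)%:R = 1 :> R.
  by rewrite (bigD1 y) //= eqxx big1 ?addr0 // => e; rewrite eq_sym => /negPf ->.
have -> : \sum_(e < b) h (a j) e * h (a' j) e = b%:R ^+ 2 * (a j == a' j)%:R - b%:R.
  have -> : b%:R ^+ 2 * (a j == a' j)%:R - b%:R = \sum_(e < b) (b%:R ^+ 2 * ((a j == a' j)%:R * (a j == e)%:R)
     - b%:R * (a j == e)%:R - b%:R * (a' j == e)%:R + 1) :> R.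
    by rewrite big_split !sumrB /= -!mulr_sumr !S1 sumr_const card_ord; ring.
  apply: eq_bigr => e _; rewrite /h; case: (a j =P e) => [->|ne] /=.
    by rewrite eq_sym; case: (a' j == e) => /=; ring.
  by case: (a' j == e) => /=; ring.
rewrite same_succ; case: (same j a a') => /=; last by ring.
by case: (a j == a' j) => /=; rewrite ?exprS; field.
Qed.

(** The Haar functions of level at most [M] form a tight frame of the functions constant on cells of side
[b ^- M], so their kernel is that of the projection onto these functions.  Each level contributes the
difference of two such kernels, and the sum telescopes. *)
Lemma digit_haar_kernel (a a' : nat -> 'I_b) :
  \sum_(x : haar_cell_index b M | cell_index_ok x)
     digit_haar R x.1.1 x.1.2 x.2 a * digit_haar R x.1.1 x.1.2 x.2 a' =
  b%:R ^+ M * (same M a a')%:R.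
Proof.
rewrite big_mkcond /=.
pose G (j : 'I_M.+1) (e : 'I_b) (k : 'I_(b ^ M)) := if cell_index_ok (j, e, k) then
  digit_haar R j e k a * digit_haar R j e k a' else 0.
rewrite (eq_bigr (fun x => G x.1.1 x.1.2 x.2)); last by move=> [[j e] k].
rewrite -(pair_bigA _ (fun x k => G x.1 x.2 k)) -(pair_bigA _ (fun j e => \sum_k G j e k)) /=.
rewrite big_ord_recl.
have -> : \sum_(e < b) \sum_(k < b ^ M) G ord0 e k = 1.
  have b0 : (0 < b)%N by exact: ltnW.
  have bM : (0 < b ^ M)%N by rewrite expn_gt0 b0.
  rewrite (bigD1 (Ordinal b0)) //= (bigD1 (Ordinal bM)) //= /G /cell_index_ok /= mulr1.
  rewrite big1 ?addr0 => [|k]; last first.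
    by rewrite -val_eqE /= expn0; case: (k : nat).
  rewrite big1 ?addr0 // => e; rewrite -val_eqE /= => e0.
  by rewrite big1 // => k _; case: (e : nat) e0.
rewrite (eq_bigr (fun j : 'I_M => b%:R ^+ j.+1 * (same j.+1 a a')%:R
  - b%:R ^+ j * (same j a a')%:R)) => [|j _]; last first.
  rewrite -digit_haar_level //; apply: eq_bigr => e _; apply: eq_bigr => k _.
  by rewrite /G /cell_index_ok /= ltn_ord.
have T n : \sum_(j < n) (b%:R ^+ j.+1 * (same j.+1 a a')%:R - b%:R ^+ j * (same j a a')%:R) =
    b%:R ^+ n * (same n a a')%:R - 1 :> R.
  elim: n => [|n IH]; first by rewrite big_ord0 /=; ring.
  by rewrite big_ord_recr /= IH; ring.
by rewrite T; ring.
Qed.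

End haar_kernel.

Section square_integrable.
Context (R : realType) (b : nat) (hb : (1 < b)%N) (z0 : 'I_b) (D : nat).

Notation lam := (lebesgue_tuple R D).
Notation cube := (@unit_cube R D).

Let mcube : measurable cube. Proof. exact: (@measurable_cube R b hb z0 D). Qed.

Let cube_fin : (lam cube < +oo)%E. Proof. by rewrite (lebesgue_cube R hb z0) ltry. Qed.

Implicit Types f g : D.-tuple R -> R.

Definition sqintegrable f := measurable_fun setT f /\ (sqint f < +oo)%E.

Lemma sqintegrableD f g : sqintegrable f -> sqintegrable g -> sqintegrable (fun x => f x + g x).
Proof.
move=> [mf fi] [mg gi]; split; first exact: measurable_funD.
apply: le_lt_trans (sqintD_le hb z0 mf mg) _.
by rewrite lte_add_pinfty // lte_mul_pinfty // lee_fin.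
Qed.

Lemma sqintegrableZ f (c : R) : sqintegrable f -> sqintegrable (fun x => c * f x).
Proof.
move=> [mf fi]; split; first exact: measurable_funM.
rewrite (sqintZ hb z0) //; apply: lte_mul_pinfty => //; rewrite ?lee_fin ?sqr_ge0 //.
Qed.

Lemma sqintegrableB f g : sqintegrable f -> sqintegrable g -> sqintegrable (fun x => f x - g x).
Proof.
move=> hf /(sqintegrableZ (-1)) hg; have := sqintegrableD hf hg.
by rewrite (_ : (fun x => _ + -1 * _) = fun x => f x - g x) //; apply/funext => x; rewrite mulN1r.
Qed.

Lemma sqintegrable_cst (c : R) : sqintegrable (fun=> c).
Proof.
split; first exact: measurable_cst.
rewrite /sqint integral_cst //; apply: lte_mul_pinfty => //; rewrite ?lee_fin ?sqr_ge0 //.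
Qed.

Lemma sqintegrable_sum (I : Type) (r : seq I) (f : I -> D.-tuple R -> R) :
  (forall i, sqintegrable (f i)) -> sqintegrable (fun x => \sum_(i <- r) f i x).
Proof.
move=> hf; elim: r => [|i r IH].
  rewrite (_ : (fun _ => _) = fun=> 0); first exact: sqintegrable_cst.
  by apply/funext => x; rewrite big_nil.
rewrite (_ : (fun _ => _) = fun x => f i x + \sum_(i <- r) f i x); first exact: sqintegrableD.
by apply/funext => x; rewrite big_cons.
Qed.

Lemma sqintegrableM_indic f (A : set (D.-tuple R)) : measurable A -> sqintegrable f ->
  sqintegrable (fun x => f x * \1_A x).
Proof.
move=> mA [mf fi]; have mfA : measurable_fun setT (fun x => f x * \1_A x).
  by apply: measurable_funM => //; exact: measurable_indic.
split=> //; apply: le_lt_trans fi; apply: (sqint_le hb z0) => // x _.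
by rewrite indicE; case: (_ \in _); rewrite ?mulr1 // mulr0 expr0n sqr_ge0.
Qed.

Lemma sqintegrable_cell N (a : words b D N) : sqintegrable (\1_(cell z0 a) : D.-tuple R -> R).
Proof.
have := sqintegrableM_indic (measurable_cell z0 a) (sqintegrable_cst 1).
by rewrite (_ : (fun x => _ * _) = \1_(cell z0 a)) //; apply/funext => x; rewrite mul1r.
Qed.

Lemma sqintegrable_step N (phi : words b D N -> R) : sqintegrable (step z0 phi).
Proof. by apply: sqintegrable_sum => a; apply: sqintegrableZ; exact: sqintegrable_cell. Qed.

Lemma integrable_sqintegrable f : sqintegrable f -> lam.-integrable cube (EFin \o f).
Proof.
move=> [mf fi].
have i1 : lam.-integrable cube (EFin \o (fun x => f x ^+ 2)) by exact: integrable_sqr.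
have i2 : lam.-integrable cube (EFin \o cst 1).
  apply: (measurable_bounded_integrable mcube cube_fin) => //.
  by exists 1; split=> // y y1 x _ /=; rewrite normr1 ltW.
apply: (le_integrable mcube) (integrableD mcube i1 i2).
- by apply/measurable_EFinP; exact: measurable_funTS.
- move=> x _ /=; rewrite lee_fin [leRHS]ger0_norm ?addr_ge0 ?sqr_ge0 //.
  have := sqr_ge0 (`|f x| - 1); rewrite sqrrB real_normK ?num_real //.
  by have := sqr_ge0 (f x); have := normr_ge0 (f x); lra.
Qed.

Lemma cube_integralD f g : sqintegrable f -> sqintegrable g ->
  cube_integral (fun x => f x + g x) = cube_integral f + cube_integral g.
Proof. by move=> hf hg; apply: RintegralD => //; exact: integrable_sqintegrable. Qed.

Lemma cube_integralZ f (c : R) : sqintegrable f ->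
  cube_integral (fun x => c * f x) = c * cube_integral f.
Proof. by move=> hf; apply: RintegralZl => //; exact: integrable_sqintegrable. Qed.

Lemma eq_cube_integral f g : (forall x, cube x -> f x = g x) -> cube_integral f = cube_integral g.
Proof. by move=> fg; apply: eq_Rintegral => x /set_mem; exact: fg. Qed.

Lemma cube_integral_sum (I : Type) (r : seq I) (c : I -> R) (f : I -> D.-tuple R -> R) :
    (forall i, sqintegrable (f i)) ->
  cube_integral (fun x => \sum_(i <- r) c i * f i x) = \sum_(i <- r) c i * cube_integral (f i).
Proof.
move=> hf; elim: r => [|i r IH].
  rewrite big_nil (@eq_cube_integral _ (fun=> 0)) => [|x _]; last by rewrite big_nil.
  by rewrite /cube_integral Rintegral_cst // mul0r.
rewrite big_cons -IH -cube_integralZ // -cube_integralD.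
- by apply: eq_cube_integral => x _; rewrite big_cons.
- exact: sqintegrableZ.
- by apply: sqintegrable_sum => j; exact: sqintegrableZ.
Qed.

Lemma cube_integral_sqr f : sqintegrable f -> (cube_integral (fun x => f x ^+ 2))%:E = sqint f.
Proof.
move=> [mf fi]; rewrite /cube_integral /Rintegral fineK //.
by rewrite ge0_fin_numE //; exact: (sqint_ge0 f).
Qed.

Lemma cube_integral_cell N (a : words b D N) : cube_integral (\1_(cell z0 a) : D.-tuple R -> R) = b%:R ^- (D * N).
Proof.
rewrite /cube_integral /Rintegral integral_indic //; last exact: measurable_cell.
rewrite setIidl; last exact: (cell_cube hb).
exact: (congr1 fine (lebesgue_cell R hb z0 a)).
Qed.

End square_integrable.

Section truncation.
Context (R : realType) (b : nat) (hb : (1 < b)%N) (z0 : 'I_b) (D M : nat).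

Notation lam := (lebesgue_tuple R D).
Notation cube := (@unit_cube R D).
Notation word := (words b D M).
Notation index := (finite_index b D M).
Notation cell_index := (@cell_index R b hb D M).
Notation cell := (@cell R b z0 D M).
Notation step := (@step R b z0 D M).

(** The value of a tensor Haar function on a cell. *)
Definition haar_word (g : index) (a : word) : R :=
  \prod_(t < D) digit_haar R (g t).1.1 (g t).1.2 (g t).2 (nth z0 (a t)).

Lemma haar_tensor_word (g : index) x : cube x ->
  haar_tensor b (triple_of g) x = haar_word g (cell_index x).
Proof.
move=> xc; apply: eq_bigr => t _; rewrite /triple_of /= !ffunE (haar_digits hb _ _ (xc t)) //.
apply: digit_haar_ext => r rj.
have rM : (r < M)%N by apply: leq_trans rj _; rewrite -ltnS.
by rewrite -(tnth_nth _ _ (Ordinal rM)) tnth_mktuple.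
Qed.

Lemma haar_word_kernel (a a' : word) :
  \sum_(g : index | finite_index_ok g) haar_word g a * haar_word g a' =
  b%:R ^+ (D * M) * (a == a')%:R.
Proof.
pose F (t : 'I_D) (x : haar_cell_index b M) := if cell_index_ok x then
  digit_haar R x.1.1 x.1.2 x.2 (nth z0 (a t)) * digit_haar R x.1.1 x.1.2 x.2 (nth z0 (a' t)) else 0.
have -> : \sum_(g : index | finite_index_ok g) haar_word g a * haar_word g a' =
    \sum_(g : index) \prod_t F t (g t).
  rewrite big_mkcond; apply: eq_bigr => g _; case: ifP => [/forallP gok|].
    by rewrite -big_split; apply: eq_bigr => t _; rewrite /F gok.
  move=> /negbT/forallPn[t gt]; rewrite (bigD1 t) //= {1}/F (negPf gt) mul0r //.
rewrite -bigA_distr_bigA.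
have E t : \sum_x F t x = b%:R ^+ M * (a t == a' t)%:R.
  by rewrite -big_mkcond /= digit_haar_kernel // !mkseq_words.
rewrite (eq_bigr _ (fun t _ => E t)) big_split /= prodr_const card_ord -exprM mulnC; congr (_ * _).
rewrite prodr_bool; congr (nat_of_bool _)%:R; apply/forallP/eqP => [h|-> t //].
by apply/ffunP => t; apply/eqP/h.
Qed.

Context (f : D.-tuple R -> R) (hf : sqintegrable f).

Definition cell_mass (a : word) : R := cube_integral (fun x => f x * \1_(cell a) x).

Definition haar_coef (g : index) : R := cube_integral (fun x => f x * haar_tensor b (triple_of g) x).

(** The part of the Haar expansion of [f] with all levels at most [M].  By [truncationE] it is the mean of
[f] over the cell. *)
Definition truncation (a : word) : R := \sum_(g : index | finite_index_ok g) haar_coef g * haar_word g a.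

Let hcell (a : word) : sqintegrable (fun x => f x * \1_(cell a) x).
Proof. by apply: (sqintegrableM_indic hb z0) => //; exact: measurable_cell. Qed.

Lemma haar_coef_cells (g : index) : haar_coef g = \sum_a haar_word g a * cell_mass a.
Proof.
rewrite -(cube_integral_sum hb z0) //; apply: eq_cube_integral => x xc.
rewrite haar_tensor_word // -(stepE hb z0 (haar_word g)) // /step mulr_sumr.
by apply: eq_bigr => a _; rewrite mulrCA.
Qed.

Lemma truncationE a : truncation a = b%:R ^+ (D * M) * cell_mass a.
Proof.
rewrite /truncation (eq_bigr (fun g => \sum_a' cell_mass a' * (haar_word g a' * haar_word g a))) => [|g _].
  rewrite exchange_big /= (bigD1 a) //= -mulr_sumr haar_word_kernel eqxx /= big1 => [|a' aa'].
    by ring.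
  by rewrite -mulr_sumr haar_word_kernel (negPf aa') /= !mulr0.
by rewrite haar_coef_cells mulr_suml; apply: eq_bigr => a' _; ring.
Qed.

Lemma truncation_orthogonal a :
  cube_integral (fun x => (f x - step truncation x) * \1_(cell a) x) = 0.
Proof.
rewrite (@eq_cube_integral _ _ _ (fun x => f x * \1_(cell a) x + - truncation a * \1_(cell a) x)); last first.
  move=> x xc; rewrite (stepE hb) // indicE.
  case: (boolP (x \in cell a)) => [/set_mem/(cell_indexE hb z0 _ xc) <-|_]; by rewrite /=; ring.
have h1 : sqintegrable (\1_(cell a) : _ -> R) by exact: (sqintegrable_cell R hb).
rewrite (cube_integralD hb z0) //; last exact: (sqintegrableZ hb z0).
rewrite (cube_integralZ hb z0) // (cube_integral_cell R hb) truncationE -/(cell_mass a).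
have bD : b%:R ^+ (D * M) != 0 :> R by rewrite expf_neq0 // pnatr_eq0 -lt0n ltnW.
by field.
Qed.

(** Best approximation in mean square, by Pythagoras: the error is orthogonal to all step functions. *)
Lemma truncation_best (psi : word -> R) :
  (sqint (fun x => f x - step truncation x)%R <= sqint (fun x => f x - step psi x)%R)%E.
Proof.
pose u x := f x - step truncation x.
pose v := step (fun a => truncation a - psi a).
have hu : sqintegrable u by apply: (sqintegrableB hb z0) => //; exact: (sqintegrable_step hb).
have hv : sqintegrable v by exact: (sqintegrable_step hb).
have huv : sqintegrable (fun x => u x + v x) by exact: (sqintegrableD hb z0).
have -> : sqint (fun x => f x - step psi x) = sqint (fun x => u x + v x).
  by apply: eq_sqint => x xc; rewrite /u /v !(stepE hb) //; ring.
rewrite -(cube_integral_sqr huv) -(cube_integral_sqr hu) lee_fin.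
have m : measurable cube by exact: (@measurable_cube R b hb z0 D).
have iu : lam.-integrable cube (EFin \o (fun x => u x ^+ 2)) by case: hu => *; exact: integrable_sqr.
have iv : lam.-integrable cube (EFin \o (fun x => v x ^+ 2)) by case: hv => *; exact: integrable_sqr.
have huc (a : word) : sqintegrable (fun x => u x * \1_(cell a) x).
  by apply: (sqintegrableM_indic hb z0) => //; exact: measurable_cell.
(* The mixed term u * v, written so that orthogonality on each cell applies. *)
pose w x := \sum_a (truncation a - psi a) * (u x * \1_(cell a) x).
have wE x : w x = u x * v x.
  by rewrite /v /step mulr_sumr; apply: eq_bigr => a _; rewrite mulrCA.
have hw : sqintegrable w.
  by apply: (sqintegrable_sum hb z0) => a; exact: (sqintegrableZ hb z0).
have w0 : cube_integral w = 0.
  by rewrite (cube_integral_sum hb z0) // big1 // => a _; rewrite truncation_orthogonal mulr0.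
have -> : cube_integral (fun x => (u x + v x) ^+ 2) =
    cube_integral (fun x => (u x ^+ 2 + v x ^+ 2) + 2 * w x).
  by apply: eq_cube_integral => x _; rewrite wE; ring.
have iw : lam.-integrable cube (EFin \o (fun x => 2 * w x)).
  by apply: (integrable_sqintegrable hb z0); exact: (sqintegrableZ hb z0).
rewrite [leRHS](RintegralD m _ iw); last exact: (integrableD m iu iv).
rewrite [X in X + _](RintegralD m iu iv) [X in _ + X](cube_integralZ hb z0) // w0 mulr0 addr0.
by rewrite lerDl; apply: Rintegral_ge0 => x _; exact: sqr_ge0.
Qed.

End truncation.

(** * Distribution of the nodes *)

Section node_distribution.
Context (R : realType) (dd : measure_display) (Omega : measurableType dd)
  (P : probability Omega R) (d s b : nat) (hb : (1 < b)%N) (z0 : 'I_b).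
Context (perms : perm_family d s b Omega) (noise : noise_family R d s Omega).
Context (p : 'I_d -> forall m : nat, 'I_(b ^ m) -> s.-tuple R).
Arguments p : clear implicits.
Hypothesis hrand : independent_scrambling P perms noise.

Lemma measurable_perm_value n m t u (e : 'I_b) : (size u < m)%N ->
  measurable_fun setT (fun w => (perms n m t u w e : nat)%:R : R).
Proof.
move=> um; have [hp _ _] := hrand.
rewrite (_ : (fun w => _) = fun w =>
    \sum_(g : {perm 'I_b}) (g e : nat)%:R * \1_(perms n m t u @^-1` [set g]) w); last first.
  apply/funext => w; rewrite (bigD1 (perms n m t u w)) //= indicE mem_set // mulr1.
  rewrite big1 ?addr0 // => g /eqP gw; rewrite indicE memNset ?mulr0 //= => e'; exact: gw.
apply: measurable_sum => g; apply: measurable_funM => //.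
by apply: measurable_indic; have [] := hp n m t u um g.
Qed.

Lemma measurable_tensor_node (m : 'I_d -> nat) (i : forall n, 'I_(b ^ m n)) :
  measurable_fun setT (tensor_node hb perms noise p i).
Proof.
have [_ hn _] := hrand; apply/measurable_fun_tnthP => q; case/mxvec_indexP: q => n t.
rewrite (_ : _ \o _ = fun w => tnth (block_node hb perms noise p n (i n) w) t); last first.
  by apply/funext => w; rewrite /= tnth_concat_blocks.
rewrite (_ : (fun w => _) = fun w => scramble hb (m n) (fun u => perms n (m n) t u w)
    (tnth (p n (m n) (i n)) t) + b%:R ^- m n * noise n (m n) t (i n) w); last first.
  by apply/funext => w; rewrite tnth_mktuple.
apply: measurable_funD; last first.
  by apply: measurable_funM => //; have [] := hn n (m n) t (i n) (ltn_ord (i n)).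
apply: measurable_sum => j; apply: measurable_funM => //.
by apply: measurable_perm_value; rewrite size_map size_iota.
Qed.

(** A node of the tensor product consists of one node of each block, and its digits are independent and
uniform by [node_law]. *)
Lemma tensor_node_cell L (m : 'I_d -> nat) (i : forall n, 'I_(b ^ m n)) N (a : words b (d * s) N) :
    (forall n, (m n < L)%N) ->
  P (tensor_node hb perms noise p i @^-1` cell z0 a) = (b%:R ^- (d * s * N))%:E.
Proof.
move=> mL; set X := tensor_node hb perms noise p i.
have mA : measurable (X @^-1` cell z0 a).
  by rewrite -[X in measurable X]setTI; apply: measurable_tensor_node => //; exact: measurable_cell.
rewrite -[_ @^-1` _]setIT -integral_indic //.
pose src := source_digit hb z0 p.
pose phi n t (r : 'I_N) (y : 'I_b) : R := (y == nth z0 (a (mxvec_index n t)) r)%:R.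
rewrite (integral_config hb (z0 := z0) hrand (L := L) (M := N)
    (F := fun c => \prod_(n < d) \prod_(t < s) \prod_(r < N)
       phi n t r (config_digit z0 src c n (m n) t (i n) r))); last first.
- move=> c w cw; rewrite indicE; congr EFin.
  have Xc : unit_cube (X w) by exact: (tensor_node_cube hb p i cw mL).
  under eq_bigr do under eq_bigr do rewrite prodr_bool.
  under eq_bigr do rewrite prodr_bool.
  rewrite prodr_bool; congr (nat_of_bool _)%:R; apply/idP/forallP.
    move=> /set_mem h n; apply/forallP => t; apply/forallP => r.
    rewrite -(block_node_digits hb p n (i n) t cw (mL n) (ltn_ord r)); apply/eqP.
    have := h (mxvec_index n t); rewrite tnth_concat_blocks => h'.
    exact: (digit_cell_digits hb z0 h' (ltn_ord r)).
  move=> h; apply/mem_set => q; apply/(digit_cellE hb); first exact: Xc.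
  case/mxvec_indexP: q => n t; apply/eq_in_map => r; rewrite mem_iota => /= rN.
  have /forallP/(_ t)/forallP/(_ (Ordinal rN))/eqP <- := h n.
  by rewrite tnth_concat_blocks (block_node_digits hb p n (i n) t cw (mL n)).
- by move=> w; rewrite lee_fin.
- by apply/measurable_EFinP; exact: measurable_indic.
rewrite node_law //; congr EFin.
have bR : b%:R != 0 :> R by rewrite pnatr_eq0 -lt0n ltnW.
have c0 : #|config b s d L N|%:R != 0 :> R.
  by rewrite card_config // pnatr_eq0 -lt0n muln_gt0 !expn_gt0 fact_gt0 ltnW.
rewrite mulKf // (eq_bigr (fun=> b%:R ^- (s * N))) => [|n _].
  by rewrite prodr_const card_ord exprVn -exprM; congr (_ ^- _); lia.
rewrite (eq_bigr (fun=> b%:R ^- N)) => [|t _].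
  by rewrite prodr_const card_ord exprVn -exprM mulnC.
rewrite (eq_bigr (fun=> b%:R^-1)) => [|r _]; first by rewrite prodr_const card_ord exprVn.
by rewrite /phi (bigD1 (nth z0 (a (mxvec_index n t)) r)) //= eqxx big1 ?addr0 ?mul1r // => y /negPf ->.
Qed.

Lemma expectation_node L (m : 'I_d -> nat) (i : forall n, 'I_(b ^ m n))
    (h : (d * s).-tuple R -> \bar R) :
    (forall n, (m n < L)%N) -> measurable_fun setT h -> (forall x, 0 <= h x)%E ->
  (\int[P]_w h (tensor_node hb perms noise p i w) =
   \int[lebesgue_tuple R (d * s)]_(x in @unit_cube R (d * s)) h x)%E.
Proof.
move=> mL mh h0; apply: (uniform_point_law hb (z0 := z0)) => //.
- exact: measurable_tensor_node.
- by move=> N a; exact: tensor_node_cell mL.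
Qed.

Notation A L w f := (smolyak (random_block hb perms noise p w) L f).

Lemma measurable_smolyak L f : (0 < L)%N -> measurable_fun setT f ->
  measurable_fun setT (fun w => A L w f).
Proof.
move=> L0 mf; have [I [a [m [i [_ _ E]]]]] := smolyak_nodes hb perms noise p L0.
rewrite (_ : (fun w => _) = fun w => \sum_x a x * f (tensor_node hb perms noise p (i x) w)); last first.
  by apply/funext => w; rewrite E.
apply: measurable_sum => x; apply: measurable_funM => //.
by apply: measurableT_comp => //; exact: measurable_tensor_node.
Qed.

(** All nodes are uniformly distributed, so that a triangle inequality is enough.  The bound [K] depends on
[L]; the lemma serves to pass to the limit in the integrand for a fixed level. *)
Lemma smolyak_continuous L : (0 < L)%N -> exists2 K : R, 0 <= K &
  forall f, measurable_fun setT f -> (\int[P]_w (A L w f ^+ 2)%:E <= K%:E * sqint f)%E.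
Proof.
move=> L0; have [I [a [m [i [a1 mL E]]]]] := smolyak_nodes hb perms noise p L0.
exists (#|I|%:R * #|I|%:R) => [|f mf]; first exact: mulr_ge0.
pose X x w := tensor_node hb perms noise p (i x) w.
have mX x : measurable_fun setT (fun w => (f (X x w) ^+ 2)%:E).
  apply/measurable_EFinP; apply: measurable_funX.
  by apply: measurableT_comp => //; exact: measurable_tensor_node.
have X0 x w : (0 <= (f (X x w) ^+ 2)%:E)%E by rewrite lee_fin sqr_ge0.
apply: (@le_trans _ _ (\int[P]_w (#|I|%:R%:E * \sum_x (f (X x w) ^+ 2)%:E))%E).
  apply: ge0_le_integral => //.
  - by move=> w _; rewrite lee_fin sqr_ge0.
  - by apply/measurable_EFinP; apply: measurable_funX; exact: measurable_smolyak.
  - by apply: measurable_funeM; exact: emeasurable_sum.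
  - move=> w _; rewrite E sumEFin -EFinM lee_fin.
    apply: le_trans (sqr_sum_le I (fun x => a x * f (X x w))) _.
    rewrite ler_wpM2l //; apply: ler_sum => x _; rewrite exprMn.
    by rewrite ler_piMl ?sqr_ge0 // -real_normK ?num_real // exprn_ile1.
rewrite ge0_integralZl_EFin //; last 2 first.
- by move=> w _; apply: sume_ge0.
- exact: emeasurable_sum.
rewrite ge0_integral_sum // EFinM -muleA lee_wpmul2l ?lee_fin //.
have mf2 : measurable_fun setT (fun x => (f x ^+ 2)%:E).
  by apply/measurable_EFinP; exact: measurable_funX.
rewrite (eq_bigr (fun=> sqint f)) => [|x _]; last first.
  by apply: (@expectation_node L (m x) (i x) (fun x => (f x ^+ 2)%:E)) => // y; rewrite lee_fin sqr_ge0.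
rewrite (eq_bigr (fun=> (1%:E * sqint f)%E)) => [|x _]; last by rewrite mul1e.
by rewrite -ge0_sume_distrl // sumEFin sumr_const.
Qed.

End node_distribution.

(** * The error of the method *)

Section truncated_error.
Context (R : realType) (dd : measure_display) (Omega : measurableType dd)
  (P : probability Omega R) (d s b : nat) (hb : (1 < b)%N) (hs : (0 < s)%N) (z0 : 'I_b).
Context (perms : perm_family d s b Omega) (noise : noise_family R d s Omega).
Context (p : 'I_d -> forall m : nat, 'I_(b ^ m) -> s.-tuple R).
Arguments p : clear implicits.
Hypotheses (hp_inj : forall n m, injective (p n m))
  (hp_net : forall n m, is_net b m (range (p n m))).
Hypothesis hrand : independent_scrambling P perms noise.
Context (L M : nat) (dL : (0 < d <= L)%N).

Notation D := (d * s)%N.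
Notation A w f := (smolyak (random_block hb perms noise p w) L f).

Let L0 : (0 < L)%N. Proof. by case/andP: dL; exact: leq_trans. Qed.

Lemma eq_smolyak_cube (c : config b s d L M) w (f g : D.-tuple R -> R) :
    config_event z0 perms noise c w -> (forall x, unit_cube x -> f x = g x) ->
  A w f = A w g.
Proof.
move=> cw fg; have [I [a [m [i [_ mL E]]]]] := smolyak_nodes hb perms noise p L0.
rewrite !E; apply: eq_bigr => x _; rewrite fg //.
exact: tensor_node_cube cw (mL x).
Qed.

(** Configurations put all the nodes into the cube, where the truncation is a finite Haar expansion. *)
Lemma truncated_smolyak (f : D.-tuple R -> R) (c : config b s d L M) w :
    config_event z0 perms noise c w ->
  A w (step z0 (truncation z0 (M := M) f)) =
  \sum_(g : finite_index b D M | finite_index_ok g)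
    haar_coef f g * smolyak_haar R z0 (source_digit hb z0 p) (block_index g) c.
Proof.
move=> cw; rewrite (@eq_smolyak_cube c w _ (fun x => \sum_(g : finite_index b D M | finite_index_ok g)
    haar_coef f g * haar_tensor b (triple_of g) x)) //; last first.
  move=> x xc; rewrite (stepE hb) // /truncation; apply: eq_bigr => g _.
  by rewrite (haar_tensor_word hb z0).
rewrite smolyak_sum; apply: eq_bigr => g gok.
by rewrite (smolyak_haar_tensor hb p cw gok).
Qed.

Lemma haar_coef_level0 (f : D.-tuple R -> R) (g : finite_index b D M) :
  index_level g = 0%N -> haar_coef f g = cube_integral f.
Proof.
move=> /eqP; rewrite sum_nat_eq0 => /forallP g0; apply: eq_cube_integral => x xc.
rewrite /haar_tensor big1 ?mulr1 // => t _; rewrite /triple_of /= ffunE.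
have /eqP -> := g0 t; rewrite /= indicE mem_set //= in_itv /=; exact: xc.
Qed.

Lemma truncated_error (f : D.-tuple R -> R) :
  (\int[P]_w ((A w (step z0 (truncation z0 (M := M) f)) - cube_integral f) ^+ 2)%:E <=
   (variance_factor R b s d L * b%:R ^+ (d * s) *
     \sum_(g : finite_index b D M | finite_index_ok g && (L < index_level g + d)%N)
        haar_coef f g ^+ 2)%:E)%E.
Proof.
rewrite (integral_config hb (z0 := z0) hrand (L := L) (M := M)
    (F := fun c => (\sum_(g : finite_index b D M | finite_index_ok g)
    haar_coef f g * smolyak_haar R z0 (source_digit hb z0 p) (block_index g) c
    - cube_integral f) ^+ 2)); last first.
- by move=> c w cw; rewrite (truncated_smolyak f cw).
- by move=> w; rewrite lee_fin sqr_ge0.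
- apply/measurable_EFinP; apply: measurable_funX; apply: measurable_funB => //.
  by apply: (measurable_smolyak hb p hrand) => //; exact: measurable_step.
have c0 : 0 < #|config b s d L M|%:R :> R.
  by rewrite card_config // ltr0n muln_gt0 !expn_gt0 fact_gt0 ltnW.
rewrite lee_fin ler_pdivrMl //.
have := @discrete_variance R b s d L M hb hs z0 (source_digit hb z0 p)
  (fun n m _ => source_net hb z0 hp_inj hp_net n (m := m)) dL (haar_coef f) (cube_integral f)
  (fun g _ => @haar_coef_level0 f g).
by rewrite !mulrA.
Qed.

Lemma haar_sum_le (alpha : R) (f : D.-tuple R -> R) :
  ((\sum_(g : finite_index b D M | finite_index_ok g)
     b%:R `^ (2 * alpha * (index_level g)%:R) * haar_coef f g ^+ 2)%:E <=
   haar_sqnorm b alpha f)%E.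
Proof.
pose h (g : finite_index b D M) := triple_of g.
have hinj : injective h.
  move=> g g' [/ffunP e1 /ffunP e2 /ffunP e3]; apply/ffunP => t.
  move: (e1 t) (e2 t) (e3 t); rewrite !ffunE.
  by case: (g t) (g' t) => [[? ?] ?] [[? ?] ?] /= /val_inj-> /val_inj-> /val_inj->.
pose r := [seq h g | g <- enum (finite_index_ok (M := M) (b := b) (D := D))].
have ur : uniq r by rewrite (map_inj_uniq hinj) enum_uniq.
apply: esum_ge; exists [set` r].
  split; first exact: finite_seq.
  move=> _ /mapP[g + ->] t; rewrite mem_enum => /forallP gok; have /andP[e k] := gok t.
  by rewrite /h /triple_of /= !ffunE; split.
rewrite -fsbig_seq // big_map big_enum /= -sumEFin le_eqVlt; apply/orP; left; apply/eqP.
apply: eq_bigr => g _; congr ((_ `^ (_ * _%:R) * _)%:E).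
by apply: eq_bigr => t _; rewrite ffunE.
Qed.

(** Each remaining frequency has weight at least [b `^ (2 * alpha * (L - d))] in the squared norm. *)
Lemma haar_tail_le (alpha : R) (f : D.-tuple R -> R) : 0 < alpha -> (haar_sqnorm b alpha f <= 1)%E ->
  \sum_(g : finite_index b D M | finite_index_ok g && (L < index_level g + d)%N) haar_coef f g ^+ 2 <=
  b%:R `^ (2 * alpha * d%:R) * b%:R `^ (- (2 * alpha * L%:R)).
Proof.
move=> a0 f1.
have b0 : 0 < b%:R :> R by rewrite ltr0n ltnW.
have b1 : 1 <= b%:R :> R by rewrite ler1n ltnW.
have h1 := le_trans (haar_sum_le alpha f) f1; rewrite lee_fin in h1.
rewrite -powRD; last by apply/implyP => _; rewrite gt_eqF.
set c := b%:R `^ _; have c0 : 0 <= c by exact: powR_ge0.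
rewrite -[leRHS]mulr1; apply: le_trans (ler_wpM2l c0 h1).
rewrite mulr_sumr [leLHS]big_mkcond [leRHS]big_mkcond /=; apply: ler_sum => g _.
case: (finite_index_ok g) => //=; case: ifP => gL; last first.
  by rewrite mulr_ge0 // mulr_ge0 ?powR_ge0 ?sqr_ge0.
rewrite mulrA ler_peMl ?sqr_ge0 // /c -powRD; last by apply/implyP => _; rewrite gt_eqF.
apply: (@le_trans _ _ (b%:R `^ 0)); first by rewrite powRr0.
apply: ler_powR => //.
have : L%:R <= (index_level g)%:R + d%:R :> R by rewrite -natrD ler_nat ltnW.
move=> h; have -> : 2 * alpha * d%:R - 2 * alpha * L%:R + 2 * alpha * (index_level g)%:R =
  2 * alpha * ((index_level g)%:R + d%:R - L%:R) by ring.
by rewrite !mulr_ge0 ?subr_ge0 // ltW.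
Qed.

End truncated_error.

Lemma haar_sqnorm_le1 (R : realType) (b D : nat) (alpha : R) (f : D.-tuple R -> R) :
  (haar_norm b alpha f <= 1)%E -> (haar_sqnorm b alpha f <= 1)%E.
Proof.
rewrite /haar_norm; set x := haar_sqnorm b alpha f => x1.
have x0 : (0 <= x)%E.
  by apply: esum_ge0 => q _; rewrite lee_fin mulr_ge0 ?powR_ge0 ?sqr_ge0.
move: x x0 x1 => [r| |] //; last by rewrite poweR12_sqrt.
move=> r0; rewrite (poweR12_sqrt r0) /= !lee_fin => r1; rewrite lee_fin in r0.
by rewrite -(sqr_sqrtr r0) exprn_ile1 // sqrtr_ge0.
Qed.

(** The part of [f] beyond a truncation contributes at most [K] times its squared norm, which is arbitrarily
small; the truncated part satisfies the same bound at every level [M]. *)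
Lemma smolyak_error (R : realType) (alpha : R) (b s d : nat)
    (hb : (1 < b)%N) (hs : (0 < s)%N)
    (p : 'I_d -> forall m : nat, 'I_(b ^ m) -> s.-tuple R)
    (hp_inj : forall n m, injective (p n m))
    (hp_net : forall n m, is_net b m (range (p n m)))
    (dd : measure_display) (Omega : measurableType dd) (P : probability Omega R)
    (perms : perm_family d s b Omega) (noise : noise_family R d s Omega)
    (hrand : independent_scrambling P perms noise) (L : nat) (f : (d * s).-tuple R -> R) :
    0 < alpha -> (0 < d <= L)%N -> measurable_fun setT f -> (sqint f < +oo)%E ->
    (haar_sqnorm b alpha f <= 1)%E ->
  (\int[P]_w ((smolyak (random_block hb perms noise p w) L f - cube_integral f) ^+ 2)%:E <=
   (2 * (variance_factor R b s d L * b%:R ^+ (d * s) *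
      (b%:R `^ (2 * alpha * d%:R) * b%:R `^ (- (2 * alpha * L%:R)))))%:E)%E.
Proof.
move=> a0 dL mf fi f1; have b0 : (0 < b)%N by exact: ltnW.
pose z0 : 'I_b := Ordinal b0.
have L0 : (0 < L)%N by case/andP: dL; exact: leq_trans.
have [K K0 HK] := smolyak_continuous hb z0 p hrand L0.
apply/lee_addgt0Pr => e e0.
have e1 : 0 < e / (2 * (K + 1)) by rewrite divr_gt0 // mulr_gt0 // ltr_wpDl.
have [M [psi hM]] := (approximable_sqint hb z0 mf fi).2 _ e1.
pose g := step z0 (truncation z0 (M := M) f).
have mg : measurable_fun setT g by exact: measurable_step.
have mfg : measurable_fun setT (fun x => f x - g x) by exact: measurable_funB.
have hg : (sqint (fun x => f x - g x)%R < (e / (2 * (K + 1)))%:E)%E.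
  by apply: le_lt_trans (truncation_best hb z0 _ _) hM; split.
pose A w h := smolyak (random_block hb perms noise p w) L h.
have mA h : measurable_fun setT h -> measurable_fun setT (fun w => A w h).
  exact: (measurable_smolyak hb p hrand).
pose u w := A w g - cube_integral f.
pose v w := A w (fun x => f x - g x).
have mu : measurable_fun setT (fun w => (2 * u w ^+ 2)%:E).
  apply/measurable_EFinP; apply: measurable_funM => //; apply: measurable_funX.
  by apply: measurable_funB => //; exact: mA.
have mv : measurable_fun setT (fun w => (2 * v w ^+ 2)%:E).
  by apply/measurable_EFinP; apply: measurable_funM => //; apply: measurable_funX; exact: mA.
have u0 w : (0 <= (2 * u w ^+ 2)%:E)%E by rewrite lee_fin mulr_ge0 ?sqr_ge0.
have v0 w : (0 <= (2 * v w ^+ 2)%:E)%E by rewrite lee_fin mulr_ge0 ?sqr_ge0.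
apply: (@le_trans _ _ (\int[P]_w ((2 * u w ^+ 2)%:E + (2 * v w ^+ 2)%:E))%E).
  apply: ge0_le_integral => //.
  - by move=> w _; rewrite lee_fin sqr_ge0.
  - apply/measurable_EFinP; apply: measurable_funX; apply: measurable_funB => //; exact: mA.
  - exact: emeasurable_funD.
  - move=> w _; rewrite -EFinD lee_fin.
    have -> : smolyak (random_block hb perms noise p w) L f - cube_integral f = u w + v w.
      by rewrite /u /v /A smolyakB; ring.
    by have := sqr_ge0 (u w - v w); lra.
rewrite ge0_integralD //; apply: leeD.
  under eq_integral do rewrite EFinM.
  rewrite ge0_integralZl_EFin //; last 2 first.
  - by move=> w _; rewrite lee_fin sqr_ge0.
  - by apply/measurable_EFinP; apply: measurable_funX; apply: measurable_funB => //; exact: mA.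
  rewrite [leRHS]EFinM lee_wpmul2l ?lee_fin //.
  apply: le_trans (truncated_error hb hs z0 hp_inj hp_net hrand M dL f) _.
  rewrite lee_fin ler_wpM2l //; last exact: haar_tail_le.
  by rewrite /variance_factor !mulr_ge0 // ?invr_ge0 ?exprn_ge0 ?addr_ge0.
under eq_integral do rewrite EFinM.
rewrite ge0_integralZl_EFin //; last 2 first.
- by move=> w _; rewrite lee_fin sqr_ge0.
- by apply/measurable_EFinP; apply: measurable_funX; exact: mA.
apply: (@le_trans _ _ (2%:E * (K%:E * (e / (2 * (K + 1)))%:E))%E).
  rewrite lee_wpmul2l ?lee_fin //; apply: le_trans (HK _ mfg) _.
  by rewrite lee_wpmul2l ?lee_fin // ltW.
rewrite -!EFinM lee_fin.
have -> : 2 * (K * (e / (2 * (K + 1)))) = e * (K / (K + 1)) by field; lra.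
by rewrite ler_piMr ?(ltW e0) // ler_pdivrMr ?mul1r; lra.
Qed.

Theorem theorem12 (R : realType) (alpha : R) (b s d : nat)
    (halpha : 2^-1 < alpha) (hb : (1 < b)%N) (hs : (0 < s)%N) (hd : (0 < d)%N)
    (p : 'I_d -> forall m : nat, 'I_(b ^ m) -> s.-tuple R)
    (hp_inj : forall n m, injective (p n m))
    (hp_net : forall n m, is_net b m (range (p n m)))
    (dd : measure_display) (Omega : measurableType dd) (P : probability Omega R)
    (perms : perm_family d s b Omega) (noise : noise_family R d s Omega)
    (hrand : independent_scrambling P perms noise) :
  exists C : R, forall L : nat, (d <= L)%N -> ((2 <= d)%N -> (d < L)%N) ->
    (randomized_error P b alpha
       (fun w => smolyak
          (building_block hb p (fun n m t u => perms n m t u w)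
                               (fun n m t i => noise n m t i w)) L)
     <= (C * (ln (num_evals b L d)%:R `^ ((d%:R - 1) * (1 + alpha))
              / (num_evals b L d)%:R `^ (alpha + 2^-1)))%:E)%E.
Proof.
have a0 : 0 < alpha by apply: lt_trans halpha.
pose K : R := 2 * (d%:R * (4 ^+ d * b%:R ^+ (s * d + d.*2)) * b%:R ^+ (d * s) *
  b%:R `^ (2 * alpha * d%:R)).
have K0 : 0 <= K by rewrite !mulr_ge0 ?exprn_ge0 ?powR_ge0.
have [C C0 HC] := rate_ge a0 K0 hb hd.
exists C => L dL d2; set Y := C * _.
have Y0 : 0 <= Y by rewrite mulr_ge0 // divr_ge0 ?powR_ge0.
apply: ge_ereal_sup => _ [f [[mf fi f1] fn] <-].
have := smolyak_error hb hs hp_inj hp_net hrand a0 (introT andP (conj hd dL)) mf fi (haar_sqnorm_le1 fn).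
set E := (\int[P]_w _)%E => hE.
have -> : 'E_P[(fun w => `|smolyak (building_block hb p (fun n m t u => perms n m t u w)
    (fun n m t i => noise n m t i w)) L f - cube_integral f| ^+ 2)%R]%E = E.
  rewrite expectation.unlock; apply: eq_integral => w _.
  by rewrite /= real_normK ?num_real.
have {}hE : (E <= (Y ^+ 2)%:E)%E.
  apply: le_trans hE _; rewrite lee_fin; apply: le_trans (HC L dL d2).
  rewrite /K /variance_factor le_eqVlt; apply/orP; left; apply/eqP; ring.
have -> : Y = (Y ^+ 2) `^ 2^-1.
  by rewrite -powR_mulrn // -powRrM divff // powRr1.
rewrite -poweR_EFin; have E0 : (0 <= E)%E by apply: integral_ge0 => w _; rewrite lee_fin sqr_ge0.
by apply: gt0_ler_poweR => //; rewrite in_itv /= leey andbT // lee_fin sqr_ge0.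
Qed.
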